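(* Consider operators on $L^2([0,1]^N,\mathbb C)$ of the form $$\mathcal A u=A_0u+A_1\langle u\rangle_1+A_2\langle u\rangle_{1,2}+\dots+A_N\langle u\rangle_{1,N},\qquad( * )$$ where each $A_j=A_j(\mathbf k_j)$ is a continuous scalar function depending only on $\mathbf k_j=(k_{j+1},\dots,k_N)\in[0,1]^{N-j}$ (in particular, $A_N$ is a constant). Let $F_j$ and the Floquet–Bloch dispersion branches $\lambda_j(\mathbf k_j)$ of $\mathcal A$ be as defined in the context. (i) Let $\mathcal A$ be of the form $( * )$ with real scalar components $A_j$. Then any set $\lambda_j(\mathbf k_j)$ consists of no more than one element. The spectrum of $\mathcal A$ is a union of intervals $\sigma_j$, $j<N$, and one eigenvalue $\sigma_N$ (some of the $\sigma_j$ or $\sigma_N$ can be empty): $$\sigma(\mathcal A)=\bigcup_{r=0}^N\sigma_r,\qquad\text{where}\quad \sigma_j=\lambda_j([0,1]^{N-j}).$$ (ii) Suppose that we have $N+1$ real continuous functions $\lambda_r=\lambda_r(\mathbf k_r)$, $\mathbf k_r\in[0,1]^{N-r}$, $r=0,\dots,N$ (this means that any set $\lambda_r(\mathbf k_r)$ consists of one element), satisfying $$\lambda_j(\mathbf k_j)\notin\bigcup_{r=0}^{j-1}\lambda_r([0,1]^{j-r},\mathbf k_j)\qquad\forall j\ge1,\ \forall\,\mathbf k_j\in[0,1]^{N-j}.$$ Then there exists a unique operator $\mathcal A$ of the form $( * )$ with real components $A_j$ whose Floquet–Bloch branches are the $\lambda_j$. Its components can be calculated by induction: $$A_0=\lambda_0,\qquad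 A_j(\mathbf k_j)=-\left\langle F_{j-1}^{-1}(\lambda_j(\mathbf k_j),k_j,\mathbf k_j)\right\rangle_j^{-1},\quad j\ge1.$$ The spectrum of $\mathcal A$ satisfies $\sigma(\mathcal A)=\bigcup_{r=0}^N\sigma_r$ with $\sigma_j=\lambda_j([0,1]^{N-j})$.
   Context: Notation: $N\ge1$ is an integer; $\mathbf k_0=(k_1,\dots,k_N)\in[0,1]^N$, $\mathbf k_j=(k_{j+1},\dots,k_N)\in[0,1]^{N-j}$, so $\mathbf k_{j-1}=(k_j,\mathbf k_j)$ with $k_j\in[0,1]$ a scalar; functions of $\mathbf k_N$ are constants. $\langle\cdot\rangle_{i,j}=\int_{[0,1]^{j-i+1}}\cdot\,dk_i\cdots dk_j$ for $j>i$, and $\langle\cdot\rangle_i=\langle\cdot\rangle_{i,i}=\int_0^1\cdot\,dk_i$. $F^{-1}$ and $\langle\cdot\rangle^{-1}$ denote reciprocals. Continued fractions: $F_0(\lambda,\mathbf k_0)=A_0(\mathbf k_0)-\lambda$ and $F_j(\lambda,\mathbf k_j)=A_j(\mathbf k_j)+\langle F_{j-1}^{-1}(\lambda,k_j,\mathbf k_j)\rangle_j^{-1}$, $j=1,\dots,N$. Floquet–Bloch dispersion branches of $\mathcal A$ (with real $A_j$, so that $\mathcal A$ is self-adjoint): $\lambda_0(\mathbf k_0)=A_0(\mathbf k_0)$, regarded as a (one-element) set; by induction, once the sets $\lambda_r(\mathbf k_r)$, $\mathbf k_r\in[0,1]^{N-r}$, are defined for $r=0,\dots,j-1$, for $\mathbf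 k_j\in[0,1]^{N-j}$ $$\lambda_j(\mathbf k_j)=\Big\{\lambda:\ F_j(\lambda,\mathbf k_j)=0\ \text{ for }\ \lambda\in\mathbb R\setminus\bigcup_{r=0}^{j-1}\lambda_r([0,1]^{j-r},\mathbf k_j)\Big\}.$$ Here $\lambda_r([0,1]^{j-r},\mathbf k_j)$ is the union of the sets $\lambda_r(k_{r+1},\dots,k_j,\mathbf k_j)$ over $(k_{r+1},\dots,k_j)\in[0,1]^{j-r}$, and $\lambda_j([0,1]^{N-j})$ is the union of the sets $\lambda_j(\mathbf k_j)$ over $\mathbf k_j\in[0,1]^{N-j}$.
   Formalization: ''Each σ_j (j<N) is an interval'' fails if λ_j(k_j) is empty for some k_j (N=2, A_0=k_1, A_1=2k_2−1); proved instead: σ_j is an interval if λ_j(k_j) is never empty, and for each m≤N the union of σ_0,…,σ_{m−1} is a union of m (possibly empty) intervals. *)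

(* Defs.v *)
From HB Require Import structures.
From mathcomp Require Import all_boot all_order all_algebra.
From mathcomp Require Import all_classical all_reals all_analysis.
From mathcomp Require Import complex.

Set Implicit Arguments.
Unset Strict Implicit.
Unset Printing Implicit Defensive.
Import Order.TTheory GRing.Theory Num.Theory.
Import numFieldNormedType.Exports.
Import ComplexField.Normc.

Local Open Scope classical_set_scope.
Local Open Scope ring_scope.
Local Open Scope complex_scope.

(** The sigma-algebra on ['rV[R]_n] is generated by the coordinates, i.e. it is
    the Borel one; Lebesgue measure is built by recursion on [n], as the image of
    the product measure under [R * 'rV[R]_n -> 'rV[R]_n.+1]. *)

Definition rV_display : measure_display. Proof. exact: default_measure_display. Qed.

Section measurable_rV.
Context {R : realType} (n : nat).

Definition rV_coord (i : 'I_n) (x : 'rV[R]_n) : R := x ord0 i.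

HB.instance Definition _ := @isMeasurable.Build rV_display 'rV[R]_n
  (g_sigma_preimage rV_coord)
  (@sigma_algebra0 _ _ _) (@sigma_algebraC _ _)
  (@sigma_algebra_bigcup _ _ _).

Lemma measurable_rV_coord (i : 'I_n) : measurable_fun [set: 'rV[R]_n] (rV_coord i).
Proof.
move=> _ Y mY; rewrite setTI; apply: sub_sigma_algebra => /=.
rewrite -bigcup_seq/=; exists i => /=; first by rewrite mem_index_enum.
by exists Y => //; rewrite setTI.
Qed.

Lemma measurable_fun_rVP d (T : measurableType d) (f : T -> 'rV[R]_n) :
  (forall i, measurable_fun [set: T] (rV_coord i \o f)) ->
  measurable_fun [set: T] f.
Proof.
move=> mf _ A mA.
suff: g_sigma_preimage (fun i => rV_coord i \o f) `<=` measurable.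
  by rewrite g_sigma_preimage_comp; apply; exists A.
apply: smallest_sub; first exact: sigma_algebra_measurable.
rewrite -bigcup_seq/=; apply: bigcup_sub => i _.
by move=> B [C mC <-]; exact: mf.
Qed.

End measurable_rV.

Section rV_cons.
Context {R : realType} (n : nat).

Definition rV_cons (p : R * 'rV[R]_n) : 'rV[R]_n.+1 :=
  \row_i oapp (p.2 ord0) p.1 (unlift ord0 i).

Definition rV_uncons (x : 'rV[R]_n.+1) : R * 'rV[R]_n :=
  (x ord0 ord0, \row_i x ord0 (lift ord0 i)).

Lemma rV_consK : cancel rV_cons rV_uncons.
Proof.
move=> [t x]; rewrite /rV_uncons /rV_cons !mxE unlift_none/=; congr pair.
by apply/rowP => i; rewrite !mxE liftK.
Qed.

Lemma measurable_rV_cons : measurable_fun [set: R * 'rV[R]_n] rV_cons.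
Proof.
apply: measurable_fun_rVP => i.
case: (unliftP ord0 i) => [j|] ->.
  rewrite (_ : _ \o _ = rV_coord j \o snd).
    exact: (measurableT_comp (@measurable_rV_coord R n j)).
  by apply/funext => p; rewrite /= /rV_coord !mxE liftK.
rewrite (_ : _ \o _ = fst); first exact: measurable_fst.
by apply/funext => p; rewrite /= /rV_coord !mxE unlift_none.
Qed.

Lemma measurable_rV_uncons : measurable_fun [set: 'rV[R]_n.+1] rV_uncons.
Proof.
apply/measurable_fun_pairP; split.
  exact: (@measurable_rV_coord R n.+1 ord0).
apply: measurable_fun_rVP => i.
rewrite (_ : _ \o _ = rV_coord (lift ord0 i)); first exact: measurable_rV_coord.
by apply/funext => x; rewrite /= /rV_coord !mxE.
Qed.

Variable mu : {sigma_finite_measure set 'rV[R]_n -> \bar R}.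

Definition leb_cons : set 'rV[R]_n.+1 -> \bar R :=
  pushforward (@lebesgue_measure R \x mu)%E rV_cons.

Let leb_cons0 : leb_cons set0 = 0%E.
Proof. by rewrite /leb_cons /pushforward preimage_set0 measure0. Qed.

Let leb_cons_ge0 A : (0 <= leb_cons A)%E.
Proof. by rewrite /leb_cons /pushforward; exact: measure_ge0. Qed.

Let leb_cons_sigma_additive : semi_sigma_additive leb_cons.
Proof.
move=> F mF tF mUF; rewrite /leb_cons /pushforward preimage_bigcup.
apply: measure_semi_sigma_additive.
- move=> k; rewrite -[X in measurable X]setTI.
  by apply: measurable_rV_cons => //; exact: mF.
- apply/trivIsetP => /= i j _ _ ij; rewrite -preimage_setI.
  by move/trivIsetP : tF => /(_ _ _ _ _ ij) ->//; rewrite preimage_set0.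
- rewrite -preimage_bigcup -[X in measurable X]setTI.
  exact: measurable_rV_cons.
Qed.

HB.instance Definition _ := isMeasure.Build _ _ _ leb_cons
  leb_cons0 leb_cons_ge0 leb_cons_sigma_additive.

Let leb_cons_sigma_finite : sigma_finite setT leb_cons.
Proof.
have /sigma_finiteP[F [TF ndF Foo]] := sigma_finiteT (@lebesgue_measure R).
have /sigma_finiteP[G [TG ndG Goo]] := sigma_finiteT mu.
exists (fun m => rV_uncons @^-1` (F m `*` G m)).
  rewrite -preimage_bigcup -[LHS](preimage_setT rV_uncons); congr preimage.
  rewrite -setXTT TF TG predeqE => -[x y]; split.
    move=> [/= [m _ Fmx] [k _ Gky]]; exists (maxn m k) => //; split.
    - by move: x Fmx; exact/subsetPset/ndF/leq_maxl.
    - by move: y Gky; exact/subsetPset/ndG/leq_maxr.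
  by move=> [m _ []/= ? ?]; split; exists m.
move=> k; have [? ?] := Foo k; have [? ?] := Goo k; split.
  rewrite -[X in measurable X]setTI.
  by apply: measurable_rV_uncons => //; exact: measurableX.
rewrite /leb_cons /pushforward -comp_preimage.
rewrite (_ : rV_uncons \o rV_cons = id) ?preimage_id; last first.
  by apply/funext => p /=; rewrite rV_consK.
by rewrite product_measure1E// lte_mul_pinfty// ge0_fin_numE.
Qed.

HB.instance Definition _ := Measure_isSigmaFinite.Build _ _ _ leb_cons
  leb_cons_sigma_finite.

End rV_cons.

Fixpoint lebesgue_rV {R : realType} (n : nat) :
    {sigma_finite_measure set 'rV[R]_n -> \bar R} :=
  if n is n'.+1 then leb_cons (lebesgue_rV n') else \d_(0 : 'rV[R]_0).

(** Elements of $L^2([0,1]^N, \mathbb C)$ are represented by functions; equality in $L^2$ is equality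
    almost everywhere on the cube, and values off the cube are irrelevant. *)

Section L2.
Context {R : realType} {N : nat}.
Implicit Types (u v : 'rV[R]_N -> R[i]) (T S : ('rV[R]_N -> R[i]) -> 'rV[R]_N -> R[i]).

Definition cube : set 'rV[R]_N := [set k | forall i, 0 <= k ord0 i <= 1].

Definition eqL2 u v : Prop := u = v %[ae (lebesgue_rV N) in cube].

Definition L2 u : Prop :=
  [/\ measurable_fun cube (@complex.Re R \o u),
      measurable_fun cube (@complex.Im R \o u) &
      (\int[lebesgue_rV N]_(k in cube) (normc (u k) ^+ 2)%:E < +oo)%E].

Definition L2norm u : R :=
  Num.sqrt (\int[lebesgue_rV N]_(k in cube) (normc (u k) ^+ 2)).

Definition bounded_operator T : Prop :=
  [/\ forall u, L2 u -> L2 (T u),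
      forall u v, L2 u -> L2 v -> eqL2 u v -> eqL2 (T u) (T v),
      forall (c : R[i]) u v, L2 u -> L2 v ->
        eqL2 (T (fun k => c * u k + v k)) (fun k => c * T u k + T v k) &
      exists M : R, forall u, L2 u -> L2norm (T u) <= M * L2norm u].

(** [z] is in the resolvent set iff [T - z] has a bounded two-sided inverse. *)
Definition L2_spectrum T : set R[i] :=
  [set z | ~ exists S, bounded_operator S /\
     forall u, L2 u ->
       eqL2 (S (fun k => T u k - z * u k)) u /\
       eqL2 (fun k => T (S u) k - z * S u k) u].

Definition L2_eigenvalue T (z : R[i]) : Prop :=
  exists u, [/\ L2 u, ~ eqL2 u (fun=> 0) & eqL2 (T u) (fun k => z * u k)].

End L2.
Arguments cube {R} N.

(** Coordinates are numbered from 0, so that $k_{i+1}$ is [k ord0 i].  A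
    function of $\mathbf k_j = (k_{j+1}, \dots, k_N)$ is represented by a
    function on the whole cube which does not depend on the first [j]
    coordinates ([tail_fun j]).  Of a sequence [A : nat -> 'rV[R]_N -> R] of
    components (or of branches) only the terms [A j] with [j <= N] matter. *)

Section dispersion.
Context {R : realType} {N : nat}.
Implicit Types (j : nat) (k : 'rV[R]_N) (A : nat -> 'rV[R]_N -> R) (f : 'rV[R]_N -> R).

Definition tail_fun j f : Prop :=
  forall k k', cube N k -> cube N k' ->
    (forall i : 'I_N, (j <= i)%N -> k ord0 i = k' ord0 i) -> f k = f k'.

Definition continuous_tails A : Prop :=
  forall j, (j <= N)%N -> {within cube N, continuous (A j)} /\ tail_fun j (A j).

(** [paste y k] is $(y_1, \dots, y_j, k_{j+1}, \dots, k_N)$. *)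
Definition paste j (y : 'rV[R]_j) k : 'rV[R]_N :=
  \row_(i < N) if insub (val i) is Some i' then y ord0 i' else k ord0 i.

Definition Cintegral n (D : set 'rV[R]_n) (u : 'rV[R]_n -> R[i]) : R[i] :=
  (\int[lebesgue_rV n]_(y in D) complex.Re (u y)) +i*
  (\int[lebesgue_rV n]_(y in D) complex.Im (u y)).

(** $\langle u\rangle_{1,j}$ *)
Definition mean1 j (u : 'rV[R]_N -> R[i]) k : R[i] :=
  Cintegral (cube j) (fun y => u (paste y k)).

Definition operator A (u : 'rV[R]_N -> R[i]) k : R[i] :=
  (A 0%N k)%:C * u k + \sum_(1 <= j < N.+1) (A j k)%:C * mean1 j u k.

Definition set_coord j (t : R) k : 'rV[R]_N :=
  \row_(i < N) if val i == j then t else k ord0 i.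

(** $\langle f\rangle_{j+1}$, the average in the coordinate of index [j] *)
Definition mean j f k : R :=
  \int[lebesgue_measure]_(t in `[0, 1]) f (set_coord j t k).

(** [F A j l] need only be considered for [l] outside the earlier branches;
    there the reciprocals are genuine, so the convention [0^-1 = 0] plays no
    role. *)
Fixpoint F A j (l : R) k : R :=
  if j is j'.+1 then A j k + (mean j' (fun k' => (F A j' l k')^-1) k)^-1
  else A 0%N k - l.

(** The points of the cube which have the same $\mathbf k_j$ as [k]. *)
Definition fiber j k : set 'rV[R]_N :=
  [set k' | cube N k' /\ forall i : 'I_N, (j <= i)%N -> k' ord0 i = k ord0 i].

(** [swept lam j k] is
    $\bigcup_{r<j} \lambda_r([0,1]^{j-r}, \mathbf k_j)$. *)
Definition swept (lam : nat -> 'rV[R]_N -> set R) j k : set R :=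
  \bigcup_(r in `I_j) \bigcup_(k' in fiber j k) lam r k'.

(** [branch_le A j r] is the branch of index [r], for [r <= j]; see [branch0]
    and [branchS] for the recursion satisfied by [branch]. *)
Fixpoint branch_le A j : nat -> 'rV[R]_N -> set R :=
  if j is j'.+1 then fun r k =>
    if (r <= j')%N then branch_le A j' r k
    else [set l | F A j l k = 0 /\ ~ swept (branch_le A j') j k l]
  else fun _ k => [set A 0%N k].

Definition branch A j : 'rV[R]_N -> set R := branch_le A j j.

Lemma branch_leE A j r : (r <= j)%N -> branch_le A j r = branch A r.
Proof.
elim: j => [|j IH]; first by rewrite leqn0 => /eqP ->.
rewrite leq_eqVlt ltnS => /orP[/eqP -> //|rj]; rewrite -IH//.
by apply/funext => k /=; rewrite rj.
Qed.

Lemma branch0 A k : branch A 0%N k = [set A 0%N k].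
Proof. by []. Qed.

Lemma branchS A j k :
  branch A j.+1 k = [set l | F A j.+1 l k = 0 /\ ~ swept (branch A) j.+1 k l].
Proof.
rewrite /branch [branch_le]lock /= -lock /= ltnn.
suff -> : swept (branch_le A j) j.+1 k = swept (branch A) j.+1 k by [].
apply: eq_bigcupr => r /= rj; apply: eq_bigcupr => k' _.
by rewrite branch_leE.
Qed.

(** The set $\sigma_j = \lambda_j([0,1]^{N-j})$ is an interval as soon as
    $\lambda_j(\mathbf k_j)$ is never empty.  If it is empty for some $\mathbf k_j$,
    then $\sigma_j$ itself may be disconnected: for $N = 2$, $A_0 = k_1$ and
    $A_1 = 2 k_2 - 1$ one has $\sigma_0 = [0, 1]$ and
    $\sigma_1 = [-a, 0) \cup (1, 1 + a]$ with $a = 1/(e - 1)$, the set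
    $\lambda_1(1/2)$ being empty.  What remains true is that
    $\sigma_0 \cup \dots \cup \sigma_{m-1}$ is a union of [m] intervals. *)
Definition band A j : set R := \bigcup_(k in cube N) branch A j k.

Definition has_branches A (lam : nat -> 'rV[R]_N -> R) : Prop :=
  forall j k, (j <= N)%N -> cube N k -> branch A j k = [set lam j k].

End dispersion.

(* Main.v *)
(** Adding the term [A_j <.>_(1,j)] is a rank one perturbation on every fibre of
    the first [j] coordinates, so that the resolvent can be written explicitly as
    long as [F_0, ..., F_j] do not vanish, and an induction on [j] gives the
    resolvent of the whole operator.  If on the contrary [F_r] vanishes at some
    [k] for [r < N], one multiplies the solution of the truncated equation by step
    functions concentrating at [k] and of mean zero in the coordinate [r]: they
    form a Weyl sequence.  For [r = N] the solution itself is an eigenfunction.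

    Off the earlier branches [F_j] is strictly decreasing in the spectral
    parameter, hence has at most one zero.  By the intermediate value theorem this
    zero persists under small perturbations of [k], so that the branches are
    continuous where they exist.  Over one fibre the earlier branches and the zero
    of [F_j] form at most [j + 1] intervals: moving the fibre along segments
    never pushes the spectrum across a gap of the whole, so a union over fibres
    cannot have more gaps than a single fibre, and each [j] adds at most one
    point. *)

Require Import Defs.
From HB Require Import structures.
From mathcomp Require Import all_boot all_order all_algebra.
From mathcomp Require Import all_classical all_reals all_analysis.
From mathcomp Require Import complex measurable_realfun.
From mathcomp Require Import ring lra.

Set Implicit Arguments.
Unset Strict Implicit.
Unset Printing Implicit Defensive.
Import Order.TTheory GRing.Theory Num.Theory.
Import numFieldNormedType.Exports.

Local Open Scope classical_set_scope.
Local Open Scope ring_scope.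
Local Open Scope complex_scope.

(** * Lebesgue measure on the cube *)

(** Equality in $L^2$ holds only almost everywhere, while the continued fraction lives on single
    fibres, which have measure zero. So the algebra of the resolvent is done pointwise, for
    representatives integrable on every fibre ([cfint]); each class has one, and the identities pass
    to $L^2$ only at the end.

    The obstacle for Weyl sequences is that [l] may lie in a lower branch over some other fibre, so
    that the solution of the truncated equation need not exist on the whole cube. The components are
    therefore composed with the retraction [clamp] onto a box, small in the coordinates from [r] on;
    nothing changes where the test function lives. Clamping to the cube itself turns components
    controlled only there into bounded continuous functions on the whole space.

    Reality of the spectrum also comes from the continued fraction: off the real axis the imaginary
    parts of $F_j$ and of the parameter have opposite signs, so no denominator vanishes.

    Intervals are counted by chains alternating between points inside and outside a set ([alt]),
    which can be carried over from a union of fibres to one fibre. *)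

Lemma measurable_cube (R : realType) (n : nat) : measurable (@cube R n).
Proof.
have -> : @cube R n = \bigcap_(i in [set: 'I_n]) (rV_coord i @^-1` `[0, 1]%classic).
  apply/seteqP; split => [k kn i _|k kn i]; first by rewrite /= in_itv/= kn.
  by have := kn i Logic.I; rewrite /= in_itv.
apply: fin_bigcap_measurable => [|i _]; first exact: finite_finset.
by rewrite -[X in measurable X]setTI; exact: measurable_rV_coord.
Qed.

Lemma cube_cons {R : realType} n :
  @rV_cons R n @^-1` cube n.+1 = `[0, 1]%classic `*` cube n.
Proof.
apply/seteqP; split => [[t x] tx|[t x] [/= tI xI] i].
  split => [|i]; first by have := tx ord0; rewrite /rV_cons mxE unlift_none/= in_itv.
  by have := tx (lift ord0 i); rewrite /rV_cons mxE liftK.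
rewrite /rV_cons mxE; case: (unliftP ord0 i) => [j _|_] /=; first exact: xI.
by move: tI; rewrite in_itv.
Qed.

Lemma lebesgue_unit {R : realType} : @lebesgue_measure R `[0, 1]%classic = 1%E.
Proof. by rewrite lebesgue_measure_itv/= lte_fin ltr01 sube0. Qed.

Lemma lebesgue_cube {R : realType} n : lebesgue_rV n (@cube R n) = 1%E.
Proof.
elim: n => [|n IH] /=.
  by rewrite diracE mem_set// => i; case: i.
rewrite /leb_cons /pushforward cube_cons product_measure1E//; last exact: measurable_cube.
by rewrite IH mule1; exact: lebesgue_unit.
Qed.

Section cube_measure.
Context {R : realType}.
Local Open Scope ereal_scope.

Lemma lebesgue_unit_lty : @lebesgue_measure R `[0%R, 1%R]%classic < +oo.
Proof. by rewrite lebesgue_unit ltry. Qed.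

Lemma lebesgue_cube_lty n : lebesgue_rV n (@cube R n) < +oo.
Proof. by rewrite lebesgue_cube ltry. Qed.

(** Integrals over [0,1] and over the cube become integrals of total functions against probability
    measures, so that the average of a constant is that constant and iterated averages carry no
    domain conditions. *)
Definition unif : {finite_measure set (measurableTypeR R) -> \bar R} :=
  @mfrestr _ (measurableTypeR R) R _ (@lebesgue_measure R)
    (measurable_itv `[0%R, 1%R]) lebesgue_unit_lty.

Definition cubem n : {finite_measure set 'rV[R]_n -> \bar R} :=
  mfrestr (@measurable_cube R n) (lebesgue_cube_lty n).

Lemma unifT : unif setT = 1.
Proof.
by rewrite /unif/= /mfrestr /mrestr setTI; exact: lebesgue_unit.
Qed.

Lemma cubemT n : cubem n setT = 1.
Proof. by rewrite /cubem/= /mfrestr /mrestr setTI lebesgue_cube. Qed.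

(** Agreement on rectangles determines a product of sigma-finite measures; thus the restricted
    measure is a product again, and Tonelli's theorem can peel off one coordinate at a time. *)
Lemma cubemE n A : measurable A ->
  cubem n.+1 A = (unif \x cubem n) (@rV_cons R n @^-1` A).
Proof.
move=> mA; set B := _ @^-1` _.
have mB : @measurable _ (measurableTypeR R * 'rV[R]_n)%type B.
  by rewrite -[X in measurable X]setTI; exact: measurable_rV_cons.
have mQ : measurable ((`[0%R, 1%R]%classic : set (measurableTypeR R)) `*` @cube R n).
  by apply: measurableX => //; exact: measurable_cube.
rewrite (@product_measure_unique _ _ _ _ _ _ _ (mrestr (lebesgue_measure \x lebesgue_rV n) mQ))//.
- rewrite /cubem /= /mfrestr /mrestr /= /leb_cons /pushforward preimage_setI.
  by rewrite cube_cons.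
- move=> C D mC mD; rewrite -[LHS]/((lebesgue_measure \x lebesgue_rV n) ((C `*` D) `&` (_ `*` _))) -setXI
    product_measure1E//; last 2 first.
  + exact: measurableI.
  + by apply: measurableI => //; exact: measurable_cube.
Qed.

Lemma measurable_rV_consR n :
  measurable_fun [set: measurableTypeR R * 'rV[R]_n] (@rV_cons R n).
Proof. exact: measurable_rV_cons. Qed.

Lemma integral_cubem_cons n (g : 'rV[R]_n.+1 -> \bar R) :
  measurable_fun setT g -> (forall x, 0 <= g x) ->
  \int[cubem n.+1]_x g x = \int[unif]_t \int[cubem n]_x g (rV_cons (t, x)).
Proof.
move=> mg g0.
have mc := @measurable_rV_consR n.
have mgc := measurableT_comp mg mc.
have <- := @fubini_tonelli1 _ _ _ _ _ unif (cubem n) _ mgc (fun x => g0 _).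
have := ge0_integral_pushforward mc (unif \x cubem n) measurableT mg (fun x _ => g0 x).
rewrite preimage_setT => <-.
by apply: eq_measure_integral => A mA _; exact: cubemE.
Qed.

Lemma unif_cst (x : \bar R) : 0 <= x -> \int[unif]_t x = x.
Proof. by move=> x0; rewrite integral_cst// -[RHS]mule1; congr (_ * _); exact: unifT. Qed.

Lemma cubem_cst n (x : \bar R) : 0 <= x -> \int[cubem n]_t x = x.
Proof. by move=> x0; rewrite integral_cst// -[RHS]mule1; congr (_ * _); exact: cubemT. Qed.

End cube_measure.

(** * Gluing of coordinates, and Tonelli's theorem along it *)

Section paste.
Context {R : realType}.

Lemma rV_cons0 n (t : R) (x : 'rV_n) : rV_cons (t, x) ord0 ord0 = t.
Proof. by rewrite /rV_cons mxE unlift_none. Qed.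

Lemma rV_consS n (t : R) (x : 'rV_n) i : rV_cons (t, x) ord0 (lift ord0 i) = x ord0 i.
Proof. by rewrite /rV_cons mxE liftK. Qed.

Lemma paste_lt j N (y : 'rV[R]_j) (k : 'rV_N) (i : 'I_N) (ij : (i < j)%N) :
  paste y k ord0 i = y ord0 (Ordinal ij).
Proof. by rewrite /paste mxE insubT. Qed.

Lemma paste_ge j N (y : 'rV[R]_j) (k : 'rV_N) (i : 'I_N) :
  (j <= i)%N -> paste y k ord0 i = k ord0 i.
Proof. by move=> ji; rewrite /paste mxE insubN// -leqNgt. Qed.

Lemma paste_cons j N (t s : R) (y : 'rV_j) (k : 'rV_N) :
  paste (rV_cons (t, y)) (rV_cons (s, k)) = rV_cons (t, paste y k).
Proof.
apply/rowP => i; case: (unliftP ord0 i) => [i' ->|->]; last first.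
  rewrite rV_cons0 (paste_lt _ _ (i := ord0) (ltn0Sn j)) -[RHS](rV_cons0 t y).
  by congr (rV_cons _ _ _); exact: val_inj.
rewrite rV_consS; have [ij|ij] := ltnP i' j; last by rewrite !paste_ge// rV_consS.
have ij' : (lift ord0 i' < j.+1)%N by [].
rewrite (paste_lt _ _ ij') (paste_lt _ _ ij) -(rV_consS t y).
by congr (rV_cons _ _ _); exact: val_inj.
Qed.

Lemma paste0 N (y : 'rV[R]_0) (k : 'rV_N) : paste y k = k.
Proof. by apply/rowP => i; rewrite paste_ge. Qed.

Lemma pasteA i j N (x : 'rV[R]_i) (y : 'rV_j) (k : 'rV_N) : (i <= j)%N ->
  paste x (paste y k) = paste (paste x y) k.
Proof.
move=> ij; apply/rowP => a; have [ai|ia] := ltnP a i.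
  have aj := leq_trans ai ij.
  by rewrite (paste_lt _ _ ai) (paste_lt _ _ aj) (paste_lt _ _ (i := Ordinal aj) ai).
rewrite paste_ge//; have [aj|ja] := ltnP a j; last by rewrite !paste_ge.
by rewrite !(paste_lt _ _ aj) paste_ge.
Qed.

Lemma measurable_paste j N :
  measurable_fun [set: 'rV[R]_j * 'rV[R]_N] (fun p => paste p.1 p.2).
Proof.
apply: measurable_fun_rVP => i.
have [ij|ij] := boolP (i < j)%N.
  rewrite (_ : _ \o _ = rV_coord (Ordinal ij) \o fst).
    exact: (measurableT_comp (@measurable_rV_coord R j _)).
  by apply/funext => p; rewrite /= /rV_coord paste_lt.
rewrite (_ : _ \o _ = rV_coord i \o snd).
  exact: (measurableT_comp (@measurable_rV_coord R N _)).
by apply/funext => p; rewrite /= /rV_coord paste_ge// leqNgt.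
Qed.

Lemma measurable_paste1 j N (k : 'rV[R]_N) :
  measurable_fun setT (fun y : 'rV[R]_j => paste y k).
Proof.
exact: (measurableT_comp (@measurable_paste j N) (pair2_measurable k)).
Qed.

End paste.


Section tonelli_paste.
Context {R : realType}.
Local Open Scope ereal_scope.

Lemma measurable_int_paste j N (g : 'rV[R]_N -> \bar R) :
  measurable_fun setT g -> (forall x, 0 <= g x) ->
  measurable_fun setT (fun k => \int[cubem j]_y g (paste y k)).
Proof.
move=> mg g0.
have mp : measurable_fun [set: 'rV[R]_N * 'rV[R]_j] (fun p => paste p.2 p.1).
  exact: (measurableT_comp (@measurable_paste R j N) (measurable_fun_pair measurable_snd measurable_fst)).
exact: (@measurable_fun_fubini_tonelli_F _ _ _ _ _ (cubem j) _
  (measurableT_comp mg mp) (fun=> g0 _)).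
Qed.

(** The outer integral does not see its first [j] coordinates, which [paste] overwrites, and the
    measures have mass one. The induction peels off coordinate 0 on both sides. *)
Lemma tonelli_paste j N (g : 'rV[R]_N -> \bar R) : (j <= N)%N ->
  measurable_fun setT g -> (forall x, 0 <= g x) ->
  \int[cubem N]_k \int[cubem j]_y g (paste y k) = \int[cubem N]_k g k.
Proof.
elim: j N g => [|j IH] [|N] g // jN mg g0; only 1, 2:
  by apply: eq_integral => k _; under eq_integral do rewrite paste0; rewrite cubem_cst.
rewrite integral_cubem_cons//; last 2 first.
- exact: measurable_int_paste.
- by move=> x; exact: integral_ge0.
have mc t : measurable_fun setT (fun x : 'rV[R]_N => g (rV_cons (t, x))).
  exact: (measurableT_comp mg (measurableT_comp (@measurable_rV_consR R N) (pair1_measurable t))).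
have E s k : \int[cubem j.+1]_y g (paste y (rV_cons (s, k))) =
    \int[unif]_t \int[cubem j]_y g (rV_cons (t, paste y k)).
  rewrite integral_cubem_cons//.
    by under eq_integral do under eq_integral do rewrite paste_cons.
  exact: (measurableT_comp mg (measurable_paste1 _)).
under eq_integral do under eq_integral do rewrite E.
(* The outer coordinate [s] has been overwritten, so the integrand is constant in it. *)
rewrite unif_cst; last by apply: integral_ge0 => k _; do 2 (apply: integral_ge0 => ? _).
pose f (p : 'rV[R]_N * measurableTypeR R) :=
  \int[cubem j]_y g (rV_cons (p.2, paste y p.1)).
have mf : measurable_fun setT f.
  pose h (p : ('rV[R]_N * measurableTypeR R) * 'rV[R]_j) :=
    g (rV_cons (p.1.2, paste p.2 p.1.1)).
  have mh : measurable_fun setT h.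
    have m1 : measurable_fun setT (fun p : ('rV[R]_N * measurableTypeR R) * 'rV[R]_j => p.1.2).
      exact: (measurableT_comp measurable_snd measurable_fst).
    have m2 : measurable_fun setT (fun p : ('rV[R]_N * measurableTypeR R) * 'rV[R]_j => p.1.1).
      exact: (measurableT_comp measurable_fst measurable_fst).
    have m3 := measurableT_comp (@measurable_paste R j N) (measurable_fun_pair measurable_snd m2).
    exact: (measurableT_comp mg (measurableT_comp (@measurable_rV_consR R N)
      (measurable_fun_pair m1 m3))).
  exact: (@measurable_fun_fubini_tonelli_F _ _ _ _ _ (cubem j) h mh (fun=> g0 _)).
have f0 p : 0 <= f p by exact: integral_ge0.
(* Moving the integral over [t] outside leaves, for each fixed [t], the statement in dimension
   [N]. *)
rewrite (@fubini_tonelli _ _ _ _ _ (cubem N) unif f mf f0) /f/= integral_cubem_cons//.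
by apply: eq_integral => t _; exact: (IH N (fun x => g (rV_cons (t, x)))).
Qed.

End tonelli_paste.


Section restricted_integral.
Context d (T : measurableType d) (R : realType).
Variables (mu : {measure set T -> \bar R}) (D : set T) (mD : measurable D).
Local Open Scope ereal_scope.

Lemma ge0_integral_mrestr (f : T -> \bar R) : measurable_fun setT f ->
  (forall x, 0 <= f x) -> \int[mrestr mu mD]_x f x = \int[mu]_(x in D) f x.
Proof.
move=> mf f0; rewrite [LHS](@ge0_negligible_integral _ _ _ _ _ (~` D))//.
- rewrite setDE setCK setTI; apply: eq_measure_integral => A mA AD.
  by rewrite /= /mrestr setIidl.
- exact: measurableC.
- by rewrite /= /mrestr setICl measure0.
Qed.

Lemma integral_mrestr (f : T -> \bar R) : measurable_fun setT f ->
  \int[mrestr mu mD]_x f x = \int[mu]_(x in D) f x.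
Proof.
move=> mf; rewrite [LHS]integralE [RHS]integralE !ge0_integral_mrestr//.
- exact: measurable_funeneg.
- exact: measurable_funepos.
Qed.

End restricted_integral.

Section marginal.
Context {R : realType}.
Local Open Scope ereal_scope.

Lemma integral_unif (f : measurableTypeR R -> \bar R) : measurable_fun setT f ->
  \int[unif]_t f t = \int[lebesgue_measure]_(t in `[0%R, 1%R]) f t.
Proof. exact: integral_mrestr. Qed.

Lemma integral_cubem n (f : 'rV[R]_n -> \bar R) : measurable_fun setT f ->
  \int[cubem n]_t f t = \int[lebesgue_rV n]_(t in cube n) f t.
Proof. exact: integral_mrestr. Qed.

Lemma ge0_integral_coord n (i : 'I_n) (f : measurableTypeR R -> \bar R) :
  measurable_fun setT f -> (forall t, 0 <= f t) ->
  \int[cubem n]_y f (y ord0 i) = \int[unif]_t f t.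
Proof.
elim: n i => [[]//|n IH] i mf f0.
have mi : measurable_fun [set: 'rV[R]_n.+1] (fun y => f (y ord0 i)).
  exact: (measurableT_comp mf (@measurable_rV_coord R _ i)).
rewrite integral_cubem_cons//.
case: (unliftP ord0 i) => [j|] ->.
  under eq_integral do under eq_integral do rewrite rV_consS.
  by rewrite IH// unif_cst// integral_ge0.
by apply: eq_integral => t _; under eq_integral do rewrite rV_cons0; rewrite cubem_cst.
Qed.

Lemma integral_coord n (i : 'I_n) (f : measurableTypeR R -> \bar R) :
  measurable_fun setT f -> \int[cubem n]_y f (y ord0 i) = \int[unif]_t f t.
Proof.
move=> mf; rewrite [LHS]integralE [RHS]integralE; congr (_ - _).
  rewrite -(@ge0_integral_coord _ i f^\+ (measurable_funepos mf) (fun t => funepos_ge0 f t)).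
  by apply: eq_integral => y _; rewrite !funeposE.
rewrite -(@ge0_integral_coord _ i f^\- (measurable_funeneg mf) (fun t => funeneg_ge0 f t)).
by apply: eq_integral => y _; rewrite !funenegE.
Qed.

End marginal.

(** * Means over fibres *)

Section fibre_integrable.
Context {R : realType}.

(* [tail_fun] without the restriction to the cube. *)
Definition gtail {T : Type} {N} j (f : 'rV[R]_N -> T) : Prop :=
  forall k k' : 'rV[R]_N, (forall i : 'I_N, (j <= i)%N -> k ord0 i = k' ord0 i) -> f k = f k'.

Lemma gtailW {T : Type} {N} i j (f : 'rV[R]_N -> T) : (i <= j)%N -> gtail j f -> gtail i f.
Proof. by move=> ij fj k k' kk'; apply: fj => a /(leq_trans ij); exact: kk'. Qed.

Lemma gtail_paste {T : Type} {N} i j (f : 'rV[R]_N -> T) (y : 'rV_i) k : (i <= j)%N -> gtail j f ->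
  f (paste y k) = f k.
Proof. by move=> ij; apply => a /(leq_trans ij) ia; rewrite paste_ge. Qed.

Variable N : nat.
Implicit Types f g : 'rV[R]_N -> R.

(* Integrable on every fibre and not only on almost every one, so that the
   identities for iterated means hold pointwise. *)
Definition fint f : Prop := measurable_fun setT f /\
  forall k j, (j <= N)%N -> (\int[cubem j]_y `|f (paste y k)|%:E < +oo)%E.

Definition rmean j f k : R := \int[cubem j]_y f (paste y k).

Lemma measurable_fibre j f k : measurable_fun setT f ->
  measurable_fun setT (fun y : 'rV_j => f (paste y k)).
Proof. by move=> mf; exact: (measurableT_comp mf (measurable_paste1 k)). Qed.

Lemma fint_integrable j f k : (j <= N)%N -> fint f ->
  (cubem j).-integrable setT (EFin \o (fun y => f (paste y k))).
Proof.
move=> jN [mf fi]; apply/integrableP; split; last exact: (fi k j jN).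
by apply/measurable_EFinP; exact: measurable_fibre.
Qed.

Lemma measurable_rmean j f : measurable_fun setT f -> measurable_fun setT (rmean j f).
Proof.
move=> mf; have mE : measurable_fun setT (EFin \o f) by exact/measurable_EFinP.
have mp := @measurable_int_paste R j N _ (measurable_funepos mE) (funepos_ge0 _).
have mn := @measurable_int_paste R j N _ (measurable_funeneg mE) (funeneg_ge0 _).
have := measurableT_comp (fine_measurable measurableT) (emeasurable_funB mp mn).
congr (measurable_fun _ _); apply/funext => k; rewrite /rmean /Rintegral integralE/=.
congr (fine (_ - _)); apply: eq_integral => y _; first by rewrite !funeposE.
by rewrite !funenegE.
Qed.

Lemma rmean_gtail j f : gtail j (rmean j f).
Proof.
move=> k k' kk'; apply: eq_Rintegral => y _; congr (f _); apply/rowP => i.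
have [ij|ij] := ltnP i j; first by rewrite !(paste_lt _ _ ij).
by rewrite !paste_ge// kk'.
Qed.

Lemma rmean_id j f k : gtail j f -> rmean j f k = f k.
Proof.
move=> fj; transitivity (\int[@cubem R j]_(y in setT) f k).
  by apply: eq_Rintegral => y _; rewrite (gtail_paste _ _ (leqnn j) fj).
by rewrite Rintegral_cst// -[RHS]mulr1; congr (_ * _); rewrite -[RHS]/(fine 1%E); congr fine; exact: cubemT.
Qed.

Lemma rmeanD j f g k : (j <= N)%N -> fint f -> fint g ->
  rmean j (f \+ g) k = rmean j f k + rmean j g k.
Proof. by move=> jN ff fg; rewrite /rmean RintegralD//; exact: fint_integrable. Qed.

Lemma rmeanB j f g k : (j <= N)%N -> fint f -> fint g ->
  rmean j (f \- g) k = rmean j f k - rmean j g k.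
Proof. by move=> jN ff fg; rewrite /rmean RintegralB//; exact: fint_integrable. Qed.

Lemma rmeanM j f g k : (j <= N)%N -> gtail j f -> fint g ->
  rmean j (f \* g) k = f k * rmean j g k.
Proof.
move=> jN fj fg; rewrite /rmean -RintegralZl//; last exact: fint_integrable.
by apply: eq_Rintegral => y _ /=; rewrite (gtail_paste _ _ (leqnn j) fj).
Qed.

Lemma abs_rmean_le j f k : (j <= N)%N -> measurable_fun setT f ->
  (`|rmean j f k|%:E <= \int[cubem j]_y `|f (paste y k)|%:E)%E.
Proof.
move=> jN mf; have mE : measurable_fun setT (EFin \o (fun y : 'rV_j => f (paste y k))).
  by apply/measurable_EFinP; exact: measurable_fibre.
have := le_abse_integral (cubem j) measurableT mE.
have [->|fin] := eqVneq (\int[cubem j]_y `|f (paste y k)|%:E)%E +oo%E; first by rewrite !leey.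
have fi : (cubem j).-integrable setT (EFin \o (fun y : 'rV_j => f (paste y k))).
  by apply/integrableP; split => //; rewrite ltey.
by rewrite -EFin_normr_Rintegral.
Qed.

Lemma ge0_int_paste i j (f : 'rV[R]_N -> \bar R) k : (i <= j)%N ->
  measurable_fun setT f -> (forall x, 0 <= f x)%E ->
  (\int[cubem j]_y \int[cubem i]_x f (paste x (paste y k)) = \int[cubem j]_y f (paste y k))%E.
Proof.
move=> ij mf f0; under eq_integral do under eq_integral do rewrite (pasteA _ _ _ ij).
exact: (@tonelli_paste R i j (fun y => f (paste y k)) ij
  (measurableT_comp mf (measurable_paste1 k)) (fun=> f0 _)).
Qed.

Lemma fint_rmean i f : fint f -> fint (rmean i f).
Proof.
move=> [mf ff]; split=> [|k j jN]; first exact: measurable_rmean.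
have [ij|ji] := leqP i j; last first.
  rewrite (eq_integral (fun=> `|rmean i f k|%:E)); last first.
    by move=> y _; rewrite (gtail_paste _ _ (ltnW ji) (rmean_gtail _)).
  by rewrite cubem_cst// ltry.
apply: le_lt_trans (ff k j jN).
have ma : measurable_fun setT (fun x => `|f x|%:E).
  by apply/measurable_EFinP; exact: measurableT_comp.
rewrite -[leRHS](@ge0_int_paste i j (fun x => `|f x|%:E))//.
apply: ge0_le_integral => //.
- apply/measurable_EFinP; apply: measurableT_comp => //.
  by apply: measurable_fibre; exact: measurable_rmean.
- exact: (measurableT_comp (@measurable_int_paste _ i _ _ ma (fun=> normr_ge0 _)) (measurable_paste1 k)).
- by move=> y _; apply: abs_rmean_le => //; exact: leq_trans jN.
Qed.

(** The tower property at every [k], not only almost everywhere: integrability on each fibre allows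
    splitting into positive and negative parts, to which Tonelli's theorem applies separately. *)
Lemma rmean_rmean i j f k : (i <= j <= N)%N -> fint f -> rmean j (rmean i f) k = rmean j f k.
Proof.
move=> /andP[ij jN] [mf ff]; have iN := leq_trans ij jN.
have mE : measurable_fun setT (EFin \o f) by exact/measurable_EFinP.
have mp := measurable_funepos mE; have mn := measurable_funeneg mE.
have dom (g : 'rV[R]_N -> \bar R) i' k' : (i' <= N)%N -> measurable_fun setT g ->
    (forall x, 0 <= g x <= `|f x|%:E)%E ->
    (\int[cubem i']_y g (paste y k') < +oo)%E.
  move=> iN' mg gf; apply: le_lt_trans (ff k' i' iN'); apply: ge0_le_integral => //.
  - by move=> y _; case/andP: (gf (paste y k')).
  - exact: (measurableT_comp mg (measurable_paste1 k')).
  - by apply/measurable_EFinP; apply: measurableT_comp => //; exact: measurable_fibre.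
  - by move=> y _; case/andP: (gf (paste y k')).
have pf x : (0 <= (EFin \o f)^\+ x <= `|f x|%:E)%E.
  by rewrite funepos_ge0/= funeposE/= -EFin_max lee_fin ge_max normr_ge0 ler_norm.
have nf x : (0 <= (EFin \o f)^\- x <= `|f x|%:E)%E.
  by rewrite funeneg_ge0/= funenegE/= -EFin_max lee_fin ge_max normr_ge0 -normrN ler_norm.
rewrite /rmean /Rintegral; congr fine; rewrite [RHS]integralE.
rewrite (eq_integral (fun y => \int[cubem i]_x (EFin \o f)^\+ (paste x (paste y k))
   - \int[cubem i]_x (EFin \o f)^\- (paste x (paste y k)))%E); last first.
  move=> y _; rewrite fineK; last exact: integrable_fin_num (fint_integrable _ _ _).
  rewrite [LHS]integralE; congr (_ - _)%E; apply: eq_integral => x _.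
    by rewrite !funeposE.
  by rewrite !funenegE.
rewrite integralB//.
- congr (_ - _)%E.
    rewrite (@ge0_int_paste i j (EFin \o f)^\+%E)//.
    by apply: eq_integral => y _; rewrite !funeposE.
  rewrite (@ge0_int_paste i j (EFin \o f)^\-%E)//.
  by apply: eq_integral => y _; rewrite !funenegE.
- apply/integrableP; split.
    exact: (measurableT_comp (@measurable_int_paste _ i _ _ mp (fun=> funepos_ge0 _ _)) (measurable_paste1 k)).
  rewrite (eq_integral (fun y => \int[cubem i]_x (EFin \o f)^\+ (paste x (paste y k)))%E).
    by rewrite (@ge0_int_paste i j (EFin \o f)^\+%E)//; exact: dom.
  by move=> y _; rewrite gee0_abs// integral_ge0.
- apply/integrableP; split.
    exact: (measurableT_comp (@measurable_int_paste _ i _ _ mn (fun=> funeneg_ge0 _ _)) (measurable_paste1 k)).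
  rewrite (eq_integral (fun y => \int[cubem i]_x (EFin \o f)^\- (paste x (paste y k)))%E).
    by rewrite (@ge0_int_paste i j (EFin \o f)^\-%E)//; exact: dom.
  by move=> y _; rewrite gee0_abs// integral_ge0.
Qed.

(** Of the [j.+1] averaged coordinates, [f] sees only the last one, of index [j], and each
    coordinate of the cube is uniformly distributed. *)
Lemma rmean_mean j f k : (j < N)%N -> measurable_fun setT f -> gtail j f ->
  rmean j.+1 f k = mean j f k.
Proof.
move=> jN mf fj; have mt : measurable_fun [set: measurableTypeR R] (fun t => (f (set_coord j t k))%:E).
  apply/measurable_EFinP; apply: (measurableT_comp mf).
  apply: measurable_fun_rVP => i.
  have [ij|ij] := eqVneq (val i) j.
    by rewrite (_ : _ \o _ = id)//; apply/funext => t; rewrite /= /rV_coord mxE ij eqxx.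
  rewrite (_ : _ \o _ = cst (k ord0 i)); first exact: measurable_cst.
  by apply/funext => t; rewrite /= /rV_coord mxE (negbTE ij).
rewrite /rmean /mean /Rintegral; congr fine.
rewrite -(integral_unif mt) -(integral_coord (@Ordinal j.+1 j (ltnSn j)) mt).
apply: eq_integral => y _; congr EFin; apply: fj => i ji.
rewrite [RHS]mxE; case: eqP => [ij|/eqP ij]; last by rewrite paste_ge// ltn_neqAle eq_sym ij.
have h : (i < j.+1)%N by rewrite ij.
by rewrite (paste_lt _ _ h); congr (y _ _); apply: val_inj.
Qed.

End fibre_integrable.

(** * Complex-valued functions and their means *)

Section complex_parts.
Variable R : rcfType.
Implicit Types x y : R[i].

Lemma complexP x y : complex.Re x = complex.Re y -> complex.Im x = complex.Im y -> x = y.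
Proof. by case: x y => [a b] [c d] /= -> ->. Qed.

Lemma cReD x y : complex.Re (x + y) = complex.Re x + complex.Re y.
Proof. by case: x y => [a b] [c d]. Qed.
Lemma cImD x y : complex.Im (x + y) = complex.Im x + complex.Im y.
Proof. by case: x y => [a b] [c d]. Qed.
Lemma cReM x y : complex.Re (x * y) = complex.Re x * complex.Re y - complex.Im x * complex.Im y.
Proof. by case: x y => [a b] [c d]. Qed.
Lemma cImM x y : complex.Im (x * y) = complex.Re x * complex.Im y + complex.Im x * complex.Re y.
Proof. by case: x y => [a b] [c d] /=; rewrite addrC. Qed.

(** The squared modulus as a polynomial in the two parts, free of the square root in [normc]. *)
Definition sqnorm x : R := complex.Re x ^+ 2 + complex.Im x ^+ 2.

Lemma sqnormE x : ComplexField.Normc.normc x ^+ 2 = sqnorm x.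
Proof. by case: x => a b; rewrite /ComplexField.Normc.normc sqr_sqrtr// addr_ge0// sqr_ge0. Qed.

Lemma sqnorm_ge0 x : 0 <= sqnorm x.
Proof. by rewrite addr_ge0// sqr_ge0. Qed.

Lemma sqnorm_eq0 x : (sqnorm x == 0) = (x == 0).
Proof. by rewrite paddr_eq0 ?sqr_ge0// !sqrf_eq0; case: x => a b; rewrite eq_complex. Qed.

Lemma sqnorm_gt0 x : (0 < sqnorm x) = (x != 0).
Proof. by rewrite lt_def sqnorm_eq0 sqnorm_ge0 andbT. Qed.

Lemma sqnormM x y : sqnorm (x * y) = sqnorm x * sqnorm y.
Proof. by rewrite /sqnorm cReM cImM; ring. Qed.

Lemma cReV x : complex.Re x^-1 = complex.Re x / sqnorm x.
Proof. by case: x. Qed.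
Lemma cImV x : complex.Im x^-1 = - complex.Im x / sqnorm x.
Proof. by case: x => a b /=; rewrite mulNr. Qed.

End complex_parts.

Section complex_fibre_integrable.
Context {R : realType} {N : nat}.
Implicit Types (f g : 'rV[R]_N -> R) (u v b : 'rV[R]_N -> R[i]).

Lemma fintD f g : fint f -> fint g -> fint (f \+ g).
Proof.
move=> [mf ff] [mg gg]; split=> [|k j jN]; first exact: measurable_funD.
have := integrableD measurableT (fint_integrable k jN (conj mf ff)) (fint_integrable k jN (conj mg gg)).
by move=> /integrableP[].
Qed.

Lemma fint_mul f g (C : R) : measurable_fun setT f -> (forall k, `|f k| <= C) ->
  fint g -> fint (f \* g).
Proof.
move=> mf fC [mg gg]; split=> [|k j jN]; first exact: measurable_funM.
have [_ h] := integrableP _ _ _ (integrableZl measurableT C (fint_integrable k jN (conj mg gg))).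
apply: le_lt_trans h; apply: ge0_le_integral => //.
- apply/measurable_EFinP; apply: measurableT_comp => //.
  by apply: measurable_fibre; exact: measurable_funM.
- apply/measurable_EFinP; apply: measurableT_comp => //; apply: measurable_funM => //.
  exact: measurable_fibre.
- move=> y _; rewrite lee_fin/= !normrM ler_wpM2r//.
  by rewrite (le_trans (fC _))// ler_norm.
Qed.

Lemma fint_cst (c : R) : fint (fun _ : 'rV[R]_N => c).
Proof.
split=> [|k j jN]; first exact: measurable_cst.
by rewrite cubem_cst ?ltry// lee_fin.
Qed.

Lemma fint_bounded f (C : R) : measurable_fun setT f -> (forall k, `|f k| <= C) -> fint f.
Proof.
move=> mf fC; have := fint_mul mf fC (fint_cst 1).
by congr fint; apply/funext => k /=; rewrite mulr1.
Qed.

Definition cmeas u : Prop :=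
  measurable_fun setT (@complex.Re R \o u) /\ measurable_fun setT (@complex.Im R \o u).

Definition cfint u : Prop := fint (@complex.Re R \o u) /\ fint (@complex.Im R \o u).

Definition cbounded b : Prop := cmeas b /\
  exists C : R, forall k, `|complex.Re (b k)| <= C /\ `|complex.Im (b k)| <= C.

Lemma cfint_meas u : cfint u -> cmeas u.
Proof. by move=> [[? _] [? _]]. Qed.

Lemma cbounded_fint b : cbounded b -> cfint b.
Proof.
move=> [[mr mi] [C bC]].
by split; apply: (@fint_bounded _ C) => // k; case: (bC k).
Qed.

Lemma cfintD u v : cfint u -> cfint v -> cfint (fun k => u k + v k).
Proof.
move=> [ur ui] [vr vi]; split.
  by have := fintD ur vr; congr fint; apply/funext => k /=; rewrite cReD.
by have := fintD ui vi; congr fint; apply/funext => k /=; rewrite cImD.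
Qed.

Lemma cmeasM b u : cmeas b -> cmeas u -> cmeas (fun k => b k * u k).
Proof.
move=> [br bi] [ur ui]; split.
  have := measurable_funB (measurable_funM br ur) (measurable_funM bi ui).
  by congr (measurable_fun _ _); apply/funext => k /=; rewrite cReM.
have := measurable_funD (measurable_funM br ui) (measurable_funM bi ur).
by congr (measurable_fun _ _); apply/funext => k /=; rewrite cImM.
Qed.

(** Separate integrability of the four real products is what expands a complex product under a mean.
    It covers a bounded factor on either side, as the coefficient pulled out of a mean may be
    unbounded while the test function is bounded. *)
Definition cmulint b u : Prop := [/\ cmeas b, cfint u,
  fint ((@complex.Re R \o b) \* (@complex.Re R \o u)) /\
  fint ((@complex.Im R \o b) \* (@complex.Im R \o u)),
  fint ((@complex.Re R \o b) \* (@complex.Im R \o u)) &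
  fint ((@complex.Im R \o b) \* (@complex.Re R \o u))].

Lemma cbounded_cmulint b u : cbounded b -> cfint u -> cmulint b u.
Proof.
move=> [[br bi] [C bC]] [ur ui].
have rC k : `|complex.Re (b k)| <= C by case: (bC k).
have iC k : `|complex.Im (b k)| <= C by case: (bC k).
by split; [| |split|..]; [split|split|exact: (fint_mul br rC)|exact: (fint_mul bi iC)|
  exact: (fint_mul br rC)|exact: (fint_mul bi iC)].
Qed.

Lemma cmulint_bounded b u : cfint b -> cbounded u -> cmulint b u.
Proof.
move=> bf bu; have [ub uf [p q] r s] := cbounded_cmulint bu bf.
have sw f g : fint (f \* g) -> fint (g \* f).
  by congr fint; apply/funext => k /=; rewrite mulrC.
by split; [exact: cfint_meas|exact: cbounded_fint|split; exact: sw|exact: sw s|exact: sw r].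
Qed.

Lemma cmulint_fint b u : cmulint b u -> cfint (fun k => b k * u k).
Proof.
move=> [_ _ [rr ii] ri ir].
have fN f : fint f -> fint (\- f).
  move=> [mf ff]; split=> [|k j jN]; first exact: measurable_funN.
  by under eq_integral do rewrite normrN; exact: ff.
split.
  have := fintD rr (fN _ ii).
  by congr fint; apply/funext => k /=; rewrite cReM.
have := fintD ri ir.
by congr fint; apply/funext => k /=; rewrite cImM.
Qed.

Lemma cfintM b u : cbounded b -> cfint u -> cfint (fun k => b k * u k).
Proof. by move=> bb uf; exact/cmulint_fint/cbounded_cmulint. Qed.

Lemma cbounded_cst (c : R[i]) : cbounded (fun=> c).
Proof.
split; first by split; exact: measurable_cst.
exists (Num.max `|complex.Re c| `|complex.Im c|) => k.
by rewrite !le_max !lexx orbT.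
Qed.

Lemma cboundedM b b' : cbounded b -> cbounded b' -> cbounded (fun k => b k * b' k).
Proof.
move=> [mb [C bC]] [mb' [C' bC']]; split; first exact: cmeasM.
exists (C * C' + C * C') => k; have [p q] := bC k; have [p' q'] := bC' k.
rewrite cReM cImM; split.
  by rewrite (le_trans (ler_normB _ _))// lerD// normrM ler_pM.
by rewrite (le_trans (ler_normD _ _))// lerD// normrM ler_pM.
Qed.

Lemma cboundedD b b' : cbounded b -> cbounded b' -> cbounded (fun k => b k + b' k).
Proof.
move=> [[br bi] [C bC]] [[br' bi'] [C' bC']]; split.
  split.
    have := measurable_funD br br'.
    by congr (measurable_fun _ _); apply/funext => k /=; rewrite cReD.
  have := measurable_funD bi bi'.
  by congr (measurable_fun _ _); apply/funext => k /=; rewrite cImD.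
exists (C + C') => k; have [p q] := bC k; have [p' q'] := bC' k.
by rewrite cReD cImD; split; rewrite (le_trans (ler_normD _ _))// lerD.
Qed.

Lemma mean1E j u k : cmeas u ->
  mean1 j u k = rmean j (@complex.Re R \o u) k +i* rmean j (@complex.Im R \o u) k.
Proof.
move=> [ur ui]; rewrite /mean1 /Cintegral; congr (_ +i* _).
  congr fine; rewrite integral_cubem//.
  by apply/measurable_EFinP; exact: (measurable_fibre k ur).
congr fine; rewrite integral_cubem//.
by apply/measurable_EFinP; exact: (measurable_fibre k ui).
Qed.

Lemma mean1_parts j u : cmeas u ->
  (@complex.Re R \o mean1 j u = rmean j (@complex.Re R \o u)) *
  (@complex.Im R \o mean1 j u = rmean j (@complex.Im R \o u)).
Proof.
move=> mu; split; apply/funext => k.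
  by rewrite -[LHS]/(complex.Re (mean1 j u k)) mean1E.
by rewrite -[LHS]/(complex.Im (mean1 j u k)) mean1E.
Qed.

Lemma mean1_gtail j u : gtail j (mean1 j u).
Proof.
move=> k k' kk'; rewrite /mean1; congr Cintegral; apply/funext => y; congr (u _).
apply/rowP => i; have [ij|ij] := ltnP i j; first by rewrite !(paste_lt _ _ ij).
by rewrite !paste_ge// kk'.
Qed.

Lemma cfint_mean1 j u : cfint u -> cfint (mean1 j u).
Proof.
move=> uf; rewrite /cfint !(mean1_parts _ (cfint_meas uf)).
by case: uf => ur ui; split; exact: fint_rmean.
Qed.

Lemma mean1D j u v k : (j <= N)%N -> cfint u -> cfint v ->
  mean1 j (fun k => u k + v k) k = mean1 j u k + mean1 j v k.
Proof.
move=> jN uf vf; rewrite !mean1E; [|exact: cfint_meas..|exact/cfint_meas/cfintD].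
case: uf vf => ur ui [vr vi]; apply: complexP; rewrite /= ?cReD ?cImD/=.
  by rewrite -rmeanD//; congr rmean; apply/funext => x /=; rewrite cReD.
by rewrite -rmeanD//; congr rmean; apply/funext => x /=; rewrite cImD.
Qed.

Lemma mean1M j b u k : (j <= N)%N -> gtail j b -> cmulint b u ->
  mean1 j (fun k => b k * u k) k = b k * mean1 j u k.
Proof.
move=> jN bj bu; have [bm uf [rr ii] ri ir] := bu.
rewrite !mean1E; [|exact: cfint_meas|exact/cfint_meas/cmulint_fint].
have rj : gtail j (@complex.Re R \o b) by move=> x x' /bj /= ->.
have ij : gtail j (@complex.Im R \o b) by move=> x x' /bj /= ->.
case: uf => ur ui; apply: complexP; rewrite /= ?cReM ?cImM/=.
  rewrite -(rmeanM k jN rj ur) -(rmeanM k jN ij ui) -rmeanB//.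
  by congr rmean; apply/funext => x /=; rewrite cReM.
rewrite -(rmeanM k jN rj ui) -(rmeanM k jN ij ur) -rmeanD//.
by congr rmean; apply/funext => x /=; rewrite cImM.
Qed.

Lemma mean1_id j b k : gtail j b -> cmeas b -> mean1 j b k = b k.
Proof.
move=> bj mb; rewrite mean1E//; apply: complexP; rewrite /= rmean_id//.
  by move=> x x' /bj /= ->.
by move=> x x' /bj /= ->.
Qed.

Lemma mean1_mean1 i j u k : (i <= j <= N)%N -> cfint u ->
  mean1 j (mean1 i u) k = mean1 j u k.
Proof.
move=> ijN uf; rewrite [LHS]mean1E; last exact/cfint_meas/cfint_mean1.
rewrite !(mean1_parts _ (cfint_meas uf)) [RHS]mean1E; last exact: cfint_meas.
by case: uf => ur ui; rewrite !rmean_rmean.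
Qed.

Definition Cmean j u k : R[i] :=
  mean j (@complex.Re R \o u) k +i* mean j (@complex.Im R \o u) k.

Lemma mean1_Cmean j u k : (j < N)%N -> gtail j u -> cmeas u ->
  mean1 j.+1 u k = Cmean j u k.
Proof.
move=> jN uj mu; rewrite mean1E//; case: mu => mr mi.
by rewrite !rmean_mean//; move=> x x' /uj /= ->.
Qed.

End complex_fibre_integrable.

(** * The resolvent as a continued fraction *)

Section resolvent_algebra.
Context {R : realType} {N : nat}.

(* [F] at a complex spectral parameter. *)
Fixpoint Fc (A : nat -> 'rV[R]_N -> R) j (z : R[i]) k : R[i] :=
  if j is j'.+1 then (A j k)%:C + (Cmean j' (fun k' => (Fc A j' z k')^-1) k)^-1
  else (A 0%N k)%:C - z.

Lemma mean_gtail j (f : 'rV[R]_N -> R) : gtail j f -> gtail j.+1 (mean j f).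
Proof.
move=> fj k k' kk'; apply: eq_Rintegral => t _; apply: fj => i ji; rewrite !mxE.
by case: eqP => // /eqP ij; apply: kk'; rewrite ltn_neqAle eq_sym ij.
Qed.

Lemma Cmean_gtail j (u : 'rV[R]_N -> R[i]) : gtail j u -> gtail j.+1 (Cmean j u).
Proof.
move=> uj k k' kk'; rewrite /Cmean; congr (_ +i* _).
  by apply: mean_gtail kk' => x x' /uj /= ->.
by apply: mean_gtail kk' => x x' /uj /= ->.
Qed.

Lemma gtailV j (u : 'rV[R]_N -> R[i]) : gtail j u -> gtail j (fun k => (u k)^-1).
Proof. by move=> uj k k' /uj ->. Qed.

Lemma Fc_gtail (A : nat -> 'rV[R]_N -> R) j z :
  (forall i, (i <= j)%N -> gtail i (A i)) -> gtail j (Fc A j z).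
Proof.
elim: j => [|j IH] hA; first by move=> k k' kk'; rewrite /= (hA 0%N _ k k').
move=> k k' kk'; rewrite /= (hA j.+1 _ k k')//; congr (_ + _^-1).
by apply: Cmean_gtail kk'; apply/gtailV/IH => i /leqW; exact: hA.
Qed.

Variables (A : nat -> 'rV[R]_N -> R) (z : R[i]).
Hypothesis Atail : forall j, (j <= N)%N -> gtail j (A j).
Hypothesis Abnd : forall j, (j <= N)%N -> cbounded (fun k => (A j k)%:C).

Let F j := Fc A j z.
Let m j := Cmean j (fun k => (F j k)^-1).

(** The indices stop before [j]: $F_j$ itself may vanish, which is the case of interest for
    eigenfunctions and Weyl sequences. The bounds on the reciprocals keep [test_fun j] bounded. *)
Definition invertible_below j : Prop := forall i, (i < j)%N ->
  [/\ forall k, Fc A i z k != 0, cbounded (fun k => (Fc A i z k)^-1),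
      forall k, Cmean i (fun k => (Fc A i z k)^-1) k != 0 &
      cbounded (fun k => (Cmean i (fun k => (Fc A i z k)^-1) k)^-1)].

Lemma invertible_belowW j : invertible_below j.+1 -> invertible_below j.
Proof. by move=> h i ij; apply: h; exact: leqW. Qed.

Let Ftail j : (j <= N)%N -> gtail j (F j).
Proof. by move=> jN; apply: Fc_gtail => i /leq_trans /(_ jN); exact: Atail. Qed.

Let mtail j : (j <= N)%N -> gtail j.+1 (m j).
Proof. by move=> jN; apply/Cmean_gtail/gtailV/Ftail. Qed.

Fixpoint trunc_op j (u : 'rV[R]_N -> R[i]) k : R[i] :=
  if j is j'.+1 then trunc_op j' u k + (A j k)%:C * mean1 j u k
  else ((A 0%N k)%:C - z) * u k.

Lemma trunc_opE u k : trunc_op N u k = operator A u k - z * u k.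
Proof.
suff E j : trunc_op j u k = (A 0%N k)%:C * u k +
    \sum_(1 <= i < j.+1) (A i k)%:C * mean1 i u k - z * u k by exact: E.
elim: j => [|j IH] /=; first by rewrite big_nil addr0 mulrBl.
by rewrite big_nat_recr//= IH; ring.
Qed.

(* Normalised by [<w_j>_(1,j) = 1]; it solves
   [(A_0 - z) w_j + A_1 <w_j>_1 + ... + A_j <w_j>_(1,j) = F_j]. *)
Fixpoint test_fun j k : R[i] :=
  if j is j'.+1 then test_fun j' k * (Fc A j' z k)^-1 *
    (Cmean j' (fun k => (Fc A j' z k)^-1) k)^-1
  else 1.

(* Passing from [j'] to [j] adds a rank one term on each fibre, whence the
   Sherman-Morrison correction. *)
Fixpoint resolv j (f : 'rV[R]_N -> R[i]) k : R[i] :=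
  if j is j'.+1 then resolv j' f k - (A j k)%:C * test_fun j k * (Fc A j z k)^-1 *
     mean1 j (fun k => test_fun j' k * (Fc A j' z k)^-1 * f k) k
  else (Fc A 0 z k)^-1 * f k.

Let T := trunc_op.
Let w := test_fun.
Let S := resolv.

Lemma cbounded_test_fun j : invertible_below j -> cbounded (w j).
Proof.
elim: j => [|j IH] ok; first exact: cbounded_cst.
have [_ bF _ bm] := ok _ (ltnSn j).
by do 2 apply: cboundedM => //; exact/IH/invertible_belowW.
Qed.

Lemma cfint_trunc_op j u : (j <= N)%N -> cfint u -> cfint (T j u).
Proof.
elim: j => [|j IH] jN uf /=; last first.
  by apply: cfintD; [exact/IH/uf/ltnW|apply: cfintM; [exact: Abnd|exact: cfint_mean1]].
by apply: cfintM => //; apply: cboundedD; [exact: Abnd|exact: (cbounded_cst (- z))].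
Qed.

(** The truncated operator acts on each fibre of the first [j] coordinates separately, so a factor
    constant on these fibres is a scalar. *)
Lemma trunc_opM j b u k : (j <= N)%N -> gtail j b -> cmulint b u ->
  T j (fun k => b k * u k) k = b k * T j u k.
Proof.
move=> jN bj bu; elim: j jN bj => [|j IH] jN bj /=; first by rewrite mulrCA.
by rewrite mean1M// IH ?(ltnW jN)//; [ring|exact: gtailW bj].
Qed.

Lemma trunc_opD j u v k : (j <= N)%N -> cfint u -> cfint v ->
  T j (fun k => u k + v k) k = T j u k + T j v k.
Proof.
move=> jN uf vf; elim: j jN => [|j IH] jN /=; first by rewrite mulrDr.
by rewrite mean1D// IH ?(ltnW jN)//; ring.
Qed.

Let mean_test j k : (j < N)%N -> invertible_below j.+1 ->
  (forall k, mean1 j (w j) k = 1) ->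
  mean1 j.+1 (fun k => w j k * (F j k)^-1) k = m j k.
Proof.
move=> jN ok wj; have [_ bF _ _] := ok _ (ltnSn j).
have bw := cbounded_test_fun (invertible_belowW ok).
rewrite -(@mean1_mean1 _ _ j)//; [|by rewrite leqnSn jN|exact/cbounded_fint/cboundedM].
rewrite /m -mean1_Cmean//; [|exact/gtailV/Ftail/ltnW|exact: bF.1].
congr mean1; apply/funext => k'.
rewrite (_ : (fun k => _) = (fun k => (F j k)^-1 * w j k)); last by apply/funext => x; rewrite mulrC.
rewrite mean1M ?wj ?mulr1//; [exact: ltnW|exact/gtailV/Ftail/ltnW|].
exact/cbounded_cmulint/cbounded_fint.
Qed.

(** Averaging over the first [j] coordinates turns $w_j F_j^{-1}$ into $F_j^{-1}$, since $F_j$ is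
    constant on those fibres; the average in the coordinate [j] is then cancelled by the last factor
    of [test_fun j.+1]. *)
Lemma mean_test_fun j k : (j <= N)%N -> invertible_below j -> mean1 j (w j) k = 1.
Proof.
elim: j k => [|j IH] k jN ok; first by rewrite mean1_id//; exact: (cbounded_cst 1).1.
have [_ bF m0 bm] := ok _ (ltnSn j).
have bw := cbounded_test_fun (invertible_belowW ok).
rewrite (_ : w j.+1 = (fun k => (m j k)^-1 * (w j k * (F j k)^-1))); last first.
  by apply/funext => x; rewrite mulrC.
rewrite mean1M//; [|exact/gtailV/mtail/ltnW|exact/cbounded_cmulint/cbounded_fint/cboundedM].
rewrite mean_test ?mulVf//; first exact: m0.
by move=> k'; apply: IH; [exact: ltnW|exact: invertible_belowW].
Qed.

(** The factor leading from $w_j$ to $w_{j+1}$ is constant on the fibres of the first [j]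
    coordinates, so $T_j w_{j+1} = m_j^{-1}$; the new term contributes $A_{j+1}$ because $w_{j+1}$
    has mean 1. *)
Lemma trunc_op_test j k : (j <= N)%N -> invertible_below j -> T j (w j) k = F j k.
Proof.
elim: j k => [|j IH] k jN ok; first by rewrite /T /w /= mulr1.
have [F0 bF m0 bm] := ok _ (ltnSn j).
have bw := cbounded_test_fun (invertible_belowW ok).
rewrite -[LHS]/(T j (w j.+1) k + (A j.+1 k)%:C * mean1 j.+1 (w j.+1) k).
rewrite mean_test_fun// mulr1.
rewrite (_ : w j.+1 = (fun k => ((F j k)^-1 * (m j k)^-1) * w j k)); last first.
  by apply/funext => x; rewrite /= mulrC mulrA mulrC mulrA.
rewrite trunc_opM ?IH//; try exact: ltnW; try exact: invertible_belowW.
- by rewrite mulrAC mulVf ?F0// mul1r addrC.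
- move=> x x' xx'; rewrite (Ftail (ltnW jN) xx') (_ : m j x = m j x')//.
  by apply: (mtail (ltnW jN)) => i /ltnW; exact: xx'.
- by apply: cbounded_cmulint; [exact: cboundedM|exact: cbounded_fint].
Qed.

Let testF j : (j < N)%N -> invertible_below j.+1 -> cbounded (fun k => w j k * (F j k)^-1).
Proof.
move=> jN ok; have [_ bF _ _] := ok _ (ltnSn j).
by apply: cboundedM bF; exact/cbounded_test_fun/invertible_belowW.
Qed.

Let coefM j u : (j < N)%N -> invertible_below j.+1 -> cbounded (fun k => (F j.+1 k)^-1) ->
  cfint u -> cbounded (fun k => (A j.+1 k)%:C * w j.+1 k * (F j.+1 k)^-1) /\
  cfint (mean1 j.+1 (fun k => w j k * (F j k)^-1 * u k)).
Proof.
move=> jN ok bF uf; split; last by apply: cfint_mean1; apply: cfintM => //; exact: testF.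
apply: cboundedM bF; apply: cboundedM; first exact: Abnd.
exact: cbounded_test_fun.
Qed.

Lemma cfint_resolv j f : (j <= N)%N -> invertible_below j ->
  cbounded (fun k => (F j k)^-1) -> cfint f -> cfint (S j f).
Proof.
elim: j => [|j IH] jN ok bF ff; first exact: cfintM.
have [b c] := coefM jN ok bF ff; have [_ bF' _ _] := ok _ (ltnSn j).
rewrite (_ : S j.+1 f = (fun k => S j f k + (- 1 * ((A j.+1 k)%:C * w j.+1 k * (F j.+1 k)^-1)) *
   mean1 j.+1 (fun k => w j k * (F j k)^-1 * f k) k)); last first.
  by apply/funext => x; rewrite !mulN1r mulNr.
apply: cfintD; first by apply: IH => //; [exact: ltnW|exact: invertible_belowW].
by apply: cfintM c; apply: cboundedM => //; exact: cbounded_cst.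
Qed.

(** The coefficient of $w_{j+1}$ in the correction. It is constant on the fibres of the first [j.+1]
    coordinates, hence a scalar both for $T_{j+1}$ and for the mean. *)
Let outer j f k : R[i] := - 1 * ((A j.+1 k)%:C * (F j.+1 k)^-1 *
   mean1 j.+1 (fun k => w j k * (F j k)^-1 * f k) k).

Let resolvS j f : S j.+1 f = (fun k => S j f k + outer j f k * w j.+1 k).
Proof.
apply/funext => k.
rewrite -[S j.+1 f k]/(S j f k - (A j.+1 k)%:C * w j.+1 k * (F j.+1 k)^-1 *
  mean1 j.+1 (fun k => w j k * (F j k)^-1 * f k) k) /outer; ring.
Qed.

Let outer_tail j f : (j < N)%N -> gtail j.+1 (outer j f).
Proof.
move=> jN k k' kk'; rewrite /outer (Atail jN kk') (Ftail jN kk'); congr (_ * (_ * _)).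
exact: mean1_gtail.
Qed.

Let outer_fint j f : (j < N)%N -> invertible_below j.+1 -> cbounded (fun k => (F j.+1 k)^-1) ->
  cfint f -> cfint (outer j f).
Proof.
move=> jN ok bF ff; apply: cfintM; first exact: cbounded_cst.
apply: cfintM; first by apply: cboundedM bF; exact: Abnd.
by apply: cfint_mean1; apply: cfintM => //; exact: testF.
Qed.

Let FS j k : F j.+1 k = (A j.+1 k)%:C + (m j k)^-1.
Proof. by []. Qed.

Let wS j k : w j.+1 k = (m j k)^-1 * (w j k * (F j k)^-1).
Proof. by rewrite mulrC. Qed.

Let mean_wS j f k : (j < N)%N -> invertible_below j.+1 -> cfint f ->
  mean1 j.+1 (fun k => w j k * (F j k)^-1 * f k) k = m j k * mean1 j.+1 (fun k => w j.+1 k * f k) k.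
Proof.
move=> jN ok ff; have [_ bF m0 bm] := ok _ (ltnSn j).
rewrite (_ : (fun k => w j.+1 k * f k) = (fun k => (m j k)^-1 * (w j k * (F j k)^-1 * f k))); last first.
  by apply/funext => x; rewrite wS !mulrA.
rewrite [in RHS]mean1M//; last 2 first.
- exact/gtailV/mtail/ltnW.
- by apply: cbounded_cmulint => //; apply: cfintM => //; exact: testF.
by rewrite mulrA mulfV ?mul1r//; exact: m0.
Qed.

Let below_Fb j : invertible_below j.+1 -> cbounded (fun k => (F j k)^-1).
Proof. by move=> ok; have [] := ok _ (ltnSn j). Qed.

(** Reflects the symmetry of the resolvent: $\langle S_j f\rangle = \langle f\,S_j 1\rangle$, where
    $S_j 1 = w_j F_j^{-1}$. *)
Lemma mean_resolv j f k : (j <= N)%N -> invertible_below j -> (forall k, F j k != 0) ->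
  cbounded (fun k => (F j k)^-1) -> cfint f ->
  mean1 j (S j f) k = mean1 j (fun k => w j k * (F j k)^-1 * f k) k.
Proof.
elim: j k => [|j IH] k jN ok F0 bF ff.
  have -> // : S 0 f = (fun k => w 0 k * (F 0 k)^-1 * f k).
  by apply/funext => x; rewrite /S /w /= mul1r.
have [F0' bF' m0 bm] := ok _ (ltnSn j); have ok' := invertible_belowW ok.
have cS := cfint_resolv (ltnW jN) ok' bF' ff.
have cout := outer_fint jN ok bF ff.
rewrite resolvS.
rewrite mean1D//; last exact/cmulint_fint/cmulint_bounded/cbounded_test_fun.
rewrite mean1M//; [|exact: outer_tail|exact/cmulint_bounded/cbounded_test_fun].
rewrite mean_test_fun// mulr1 -(@mean1_mean1 _ _ j) ?leqnSn//.
rewrite (_ : mean1 j (S j f) = mean1 j (fun k => w j k * (F j k)^-1 * f k)); last first.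
  by apply/funext => x; apply: IH => //; exact: ltnW.
rewrite mean1_mean1 ?leqnSn//; last by apply: cfintM => //; exact: testF.
rewrite /outer mean_wS//.
rewrite (_ : (fun k => w j.+1 k / F j.+1 k * f k) = (fun k => (F j.+1 k)^-1 * (w j.+1 k * f k))); last first.
  by apply/funext => x; ring.
rewrite [in RHS]mean1M//; last 2 first.
- exact/gtailV/Ftail.
- by apply: cbounded_cmulint => //; apply: cfintM => //; exact: cbounded_test_fun.
have := F0 k; rewrite FS; have := m0 k; rewrite -/(m j k); move: (m j k) (mean1 _ _ _) => y W y0 h.
(* The side condition left by [field] is $A_{j+1} m_j + 1 \ne 0$, that is $F_{j+1} m_j \ne 0$. *)
field; rewrite y0 /=; apply: contraNneq h => E.
have /eqP : ((A j.+1 k)%:C + y^-1) * y = 0 by rewrite mulrDl mulVf// -[RHS]E; ring.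
by rewrite mulf_eq0 (negbTE y0) orbF.
Qed.

(** $T_{j+1} S_j f = f + A_{j+1}\langle S_j f\rangle$, and the last term is cancelled by [outer]
    times $T_{j+1} w_{j+1} = F_{j+1}$, thanks to [mean_resolv]. *)
Lemma trunc_op_resolv j f k : (j <= N)%N -> invertible_below j -> (forall k, F j k != 0) ->
  cbounded (fun k => (F j k)^-1) -> cfint f -> T j (S j f) k = f k.
Proof.
elim: j k => [|j IH] k jN ok F0 bF ff; first by rewrite /T /S /= mulrA mulfV ?mul1r//; exact: F0.
have [F0' bF' m0 bm] := ok _ (ltnSn j); have ok' := invertible_belowW ok.
have cS := cfint_resolv (ltnW jN) ok' bF' ff.
have cout := outer_fint jN ok bF ff.
have cmo := cmulint_bounded cout (cbounded_test_fun ok).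
rewrite resolvS.
rewrite trunc_opD//; last exact: cmulint_fint.
rewrite trunc_opM//; last exact: outer_tail.
rewrite trunc_op_test// -[T j.+1 (S j f) k]/(T j (S j f) k + (A j.+1 k)%:C * mean1 j.+1 (S j f) k).
rewrite IH//; last exact: ltnW.
rewrite -(@mean1_mean1 _ _ j j.+1 (S j f)) ?leqnSn//.
rewrite (_ : mean1 j (S j f) = mean1 j (fun k => w j k * (F j k)^-1 * f k)); last first.
  by apply/funext => x; apply: mean_resolv => //; exact: ltnW.
rewrite mean1_mean1 ?leqnSn//; last by apply: cfintM => //; exact: testF.
by move: (F0 k) => h; rewrite /outer; field.
Qed.

(** The transposed form of $T_j w_j = F_j$: it expresses that $T_j$ can be moved onto $w_j$ under
    the mean, leaving $F_j$, which is constant on the fibre. *)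
Lemma mean_test_trunc_op j u k : (j <= N)%N -> invertible_below j -> cfint u ->
  mean1 j (fun k => w j k * T j u k) k = F j k * mean1 j u k.
Proof.
elim: j k => [|j IH] k jN ok uf.
  rewrite -mean1M//; last 2 first.
  - exact: Ftail.
  - apply: cbounded_cmulint => //; apply: cboundedD; first exact: Abnd.
    exact: (cbounded_cst (- z)).
  have -> // : (fun k => w 0 k * T 0 u k) = (fun k => F 0 k * u k).
  by apply/funext => x; rewrite /w /= mul1r.
have [F0' bF' m0 bm] := ok _ (ltnSn j); have ok' := invertible_belowW ok.
have cT := cfint_trunc_op (ltnW jN) uf.
have cAM : cfint (fun k => (A j.+1 k)%:C * mean1 j.+1 u k).
  by apply: cfintM; [exact: Abnd|exact: cfint_mean1].
have bw := cbounded_test_fun ok.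
rewrite (_ : (fun k => w j.+1 k * T j.+1 u k) = (fun k => w j.+1 k * T j u k +
    (A j.+1 k)%:C * mean1 j.+1 u k * w j.+1 k)); last first.
  by apply/funext => x; rewrite -[T j.+1 u x]/(T j u x + (A j.+1 x)%:C * mean1 j.+1 u x); ring.
rewrite mean1D//; [|exact: cfintM|exact/cmulint_fint/cmulint_bounded].
rewrite (@mean1M _ _ _ (fun k => (A j.+1 k)%:C * mean1 j.+1 u k))//; last 2 first.
- by move=> x x' xx'; rewrite (Atail jN xx') (mean1_gtail _ xx').
- exact: cmulint_bounded.
rewrite mean_test_fun// mulr1; have := mean_wS k jN ok cT.
rewrite -(@mean1_mean1 _ _ j) ?leqnSn//; last by apply: cfintM => //; exact: testF.
rewrite (_ : mean1 j _ = mean1 j u); last first.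
  apply/funext => x.
  rewrite (_ : (fun k => _) = (fun k => (F j k)^-1 * (w j k * T j u k))); last first.
    by apply/funext => x'; rewrite mulrAC mulrC mulrA.
  rewrite mean1M; [|exact: ltnW|exact/gtailV/Ftail/ltnW|]; last first.
    by apply: cbounded_cmulint => //; apply: cfintM => //; exact: cbounded_test_fun.
  by rewrite IH ?(ltnW jN)// mulrA mulVf ?mul1r//; exact: F0'.
rewrite mean1_mean1 ?leqnSn// => ->.
by rewrite FS mulrDl (mulKf (m0 k)) addrC.
Qed.

Let resolvM j b f k : (j <= N)%N -> invertible_below j -> cbounded (fun k => (F j k)^-1) ->
  gtail j b -> cfint b -> cbounded f -> S j (fun k => b k * f k) k = b k * S j f k.
Proof.
elim: j k => [|j IH] k jN ok bF bj bb bf; first by rewrite /S /=; ring.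
have [F0' bF' m0 bm] := ok _ (ltnSn j); have ok' := invertible_belowW ok.
rewrite !resolvS /outer IH ?(ltnW jN)//; last exact: gtailW bj.
rewrite (_ : (fun k => w j k / F j k * (b k * f k)) = (fun k => b k * (w j k * (F j k)^-1 * f k))); last first.
  by apply/funext => x; ring.
rewrite mean1M//; first by ring.
by apply: cmulint_bounded => //; apply: cboundedM => //; exact: testF.
Qed.

Let resolvD j f g k : (j <= N)%N -> invertible_below j -> cfint f -> cfint g ->
  S j (fun k => f k + g k) k = S j f k + S j g k.
Proof.
elim: j k => [|j IH] k jN ok ff gf; first by rewrite /S /=; ring.
rewrite !resolvS /outer IH ?(ltnW jN)//; last exact: invertible_belowW.
rewrite (_ : (fun k => w j k / F j k * (f k + g k)) = (fun k => (w j k * (F j k)^-1 * f k) +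
  (w j k * (F j k)^-1 * g k))); last by apply/funext => x; ring.
by rewrite mean1D//; [ring|apply: cfintM => //; exact: testF..].
Qed.

Let resolv1 j k : (j <= N)%N -> invertible_below j -> (forall k, F j k != 0) ->
  S j (fun=> 1) k = w j k * (F j k)^-1.
Proof.
elim: j k => [|j IH] k jN ok F0; first by rewrite /S /w /=; ring.
have [F0' bF' m0 bm] := ok _ (ltnSn j); have ok' := invertible_belowW ok.
rewrite resolvS /outer IH ?(ltnW jN)//.
rewrite (_ : (fun k => w j k / F j k * 1) = (fun k => w j k * (F j k)^-1)); last first.
  by apply/funext => x; rewrite mulr1.
rewrite mean_test//; last by move=> k'; apply: mean_test_fun => //; exact: ltnW.
have E : w j k / F j k = m j k * w j.+1 k by rewrite wS mulrA mulfV ?mul1r//; exact: m0.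
rewrite E; have := F0 k; rewrite FS; have := m0 k; rewrite -/(m j k).
move: (m j k) (w j.+1 k) => y W y0 h.
field; rewrite y0 /=; apply: contraNneq h => E'.
have /eqP : ((A j.+1 k)%:C + y^-1) * y = 0 by rewrite mulrDl mulVf// -[RHS]E'; ring.
by rewrite mulf_eq0 (negbTE y0) orbF.
Qed.

(** In infinite dimension a right inverse does not yield a left one, so this is a separate
    computation. $S_j$ maps the extra term $A_{j+1}\langle u\rangle$ of $T_{j+1}u$ to
    $A_{j+1}\langle u\rangle m_j w_{j+1}$, and by [mean_test_trunc_op] the correction removes
    exactly this. *)
Lemma resolv_trunc_op j u k : (j <= N)%N -> invertible_below j -> (forall k, F j k != 0) ->
  cbounded (fun k => (F j k)^-1) -> cfint u -> S j (T j u) k = u k.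
Proof.
elim: j k => [|j IH] k jN ok F0 bF uf; first by rewrite /T /S /= mulrA mulVf ?mul1r//; exact: F0.
have [F0' bF' m0 bm] := ok _ (ltnSn j); have ok' := invertible_belowW ok.
have cT := cfint_trunc_op (ltnW jN) uf.
have cAM : cfint (fun k => (A j.+1 k)%:C * mean1 j.+1 u k).
  by apply: cfintM; [exact: Abnd|exact: cfint_mean1].
rewrite resolvS /outer mean_wS//; last exact: cfint_trunc_op.
rewrite mean_test_trunc_op//.
rewrite -[T j.+1 u]/(fun k => T j u k + (A j.+1 k)%:C * mean1 j.+1 u k).
rewrite resolvD ?IH ?(ltnW jN)//.
rewrite (_ : (fun k => (A j.+1 k)%:C * mean1 j.+1 u k) = (fun k => (A j.+1 k)%:C * mean1 j.+1 u k * 1)); last first.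
  by apply/funext => x; rewrite mulr1.
rewrite resolvM ?(ltnW jN)//; last 2 first.
- apply: (gtailW (leqnSn j)) => x x' xx'.
  by rewrite (Atail jN xx') (mean1_gtail _ xx').
- exact: cbounded_cst.
rewrite resolv1 ?(ltnW jN)//.
have -> : w j k / F j k = m j k * w j.+1 k by rewrite wS mulrA mulfV ?mul1r//; exact: m0.
by move: (F0 k) => h; rewrite /outer; field.
Qed.

End resolvent_algebra.

(** * Bounded operators on the cube *)

Section square_integrable.
Context {R : realType} {N : nat}.
Implicit Types (u v b : 'rV[R]_N -> R[i]).

Lemma eqL2P u v : eqL2 u v <-> {ae cubem N, forall k, cube N k -> u k = v k}.
Proof.
split=> -[B [mB B0 sB]].
  exists B; split => //; apply/eqP; rewrite -measure_le0 -B0.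
  have h := @le_measure _ _ _ (lebesgue_rV N) (B `&` cube N) B.
  apply: h => //; rewrite ?inE//; apply: measurableI => //; exact: measurable_cube.
exists (B `&` cube N); split; [by apply: measurableI => //; exact: measurable_cube|exact: B0|].
move=> k /= nk; split; first exact: sB.
by apply: contrapT => nck; apply: nk => /nck.
Qed.

Lemma eqL2_cube u v : (forall k, cube N k -> u k = v k) -> eqL2 u v.
Proof. by move=> uv; apply: aeW => k; exact: uv. Qed.

Lemma eqL2_sym u v : eqL2 u v -> eqL2 v u.
Proof. exact: ae_eq_sym. Qed.

Lemma eqL2_trans v u w : eqL2 u v -> eqL2 v w -> eqL2 u w.
Proof. exact: ae_eq_trans. Qed.

Lemma eqL2D u u' v v' : eqL2 u u' -> eqL2 v v' ->
  eqL2 (fun k => u k + v k) (fun k => u' k + v' k).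
Proof. by apply: filterS2 => k + + ck => /(_ ck) -> /(_ ck) ->. Qed.

Lemma eqL2M b u v : eqL2 u v -> eqL2 (fun k => b k * u k) (fun k => b k * v k).
Proof. by apply: filterS => k + ck => /(_ ck) ->. Qed.

Definition cube_meas u : Prop :=
  measurable_fun (cube N) (@complex.Re R \o u) /\ measurable_fun (cube N) (@complex.Im R \o u).

Lemma cmeas_cube u : cmeas u -> cube_meas u.
Proof. by move=> [ur ui]; split; exact: measurable_funTS. Qed.

Lemma cube_measD u v : cube_meas u -> cube_meas v -> cube_meas (fun k => u k + v k).
Proof.
move=> [ur ui] [vr vi]; split.
  have := measurable_funD ur vr.
  by congr (measurable_fun _ _); apply/funext => k /=; rewrite cReD.
have := measurable_funD ui vi.
by congr (measurable_fun _ _); apply/funext => k /=; rewrite cImD.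
Qed.

Lemma cube_measM u v : cube_meas u -> cube_meas v -> cube_meas (fun k => u k * v k).
Proof.
move=> [ur ui] [vr vi]; split.
  have := measurable_funB (measurable_funM ur vr) (measurable_funM ui vi).
  by congr (measurable_fun _ _); apply/funext => k /=; rewrite cReM.
have := measurable_funD (measurable_funM ur vi) (measurable_funM ui vr).
by congr (measurable_fun _ _); apply/funext => k /=; rewrite cImM.
Qed.

Lemma cube_meas_eq u v : (forall k, cube N k -> u k = v k) -> cube_meas u -> cube_meas v.
Proof.
move=> uv [ur ui]; split.
  by apply: eq_measurable_fun ur => k /[!inE] ck /=; rewrite uv.
by apply: eq_measurable_fun ui => k /[!inE] ck /=; rewrite uv.
Qed.

(** Kept in the extended reals because [L2norm] passes through [fine], which sends [+oo] to 0: a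
    bound on the norm says nothing before finiteness is known. *)
Definition sqint u : \bar R := (\int[lebesgue_rV N]_(k in cube N) (sqnorm (u k))%:E)%E.

Lemma cube_meas_sqnorm u : cube_meas u -> measurable_fun (cube N) (fun k => sqnorm (u k)).
Proof. by move=> [ur ui]; apply: measurable_funD; exact: measurable_funX. Qed.

Lemma L2P u : L2 u <-> cube_meas u /\ (sqint u < +oo)%E.
Proof.
rewrite /L2 /sqint; under eq_integral do rewrite sqnormE.
by split=> [[? ? ?]|[[? ?] ?]].
Qed.

Lemma L2normE u : L2norm u = Num.sqrt (fine (sqint u)).
Proof. by rewrite /L2norm /Rintegral; under eq_integral do rewrite sqnormE. Qed.

Lemma L2norm_ge0 u : 0 <= L2norm u. Proof. by rewrite sqrtr_ge0. Qed.

Lemma sqint_ge0 u : (0 <= sqint u)%E.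
Proof. by apply: integral_ge0 => k _; rewrite lee_fin sqnorm_ge0. Qed.

Lemma sqint_eq u v : cube_meas u -> cube_meas v -> eqL2 u v -> sqint u = sqint v.
Proof.
move=> mu mv uv; apply: ae_eq_integral.
- exact: measurable_cube.
- by apply/measurable_EFinP; exact: cube_meas_sqnorm.
- by apply/measurable_EFinP; exact: cube_meas_sqnorm.
- by move: uv; apply: filterS => k + ck => /(_ ck) ->.
Qed.

Lemma L2norm_eq u v : cube_meas u -> cube_meas v -> eqL2 u v -> L2norm u = L2norm v.
Proof. by move=> mu mv uv; rewrite !L2normE (sqint_eq mu mv uv). Qed.

Lemma L2_eq u v : cube_meas v -> eqL2 u v -> L2 u -> L2 v.
Proof.
by move=> mv uv /L2P[mu u2]; apply/L2P; split => //; rewrite -(sqint_eq mu mv uv).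
Qed.

Lemma L2norm_le (C : R) u v : 0 <= C -> L2 v -> (sqint u <= C%:E * sqint v)%E ->
  L2norm u <= Num.sqrt C * L2norm v.
Proof.
move=> C0 /L2P[_ v2] uv; rewrite !L2normE -sqrtrM// ler_sqrt; last first.
  by rewrite mulr_ge0// fine_ge0// sqint_ge0.
have vf : sqint v \is a fin_num by rewrite ge0_fin_numE// sqint_ge0.
have uf : sqint u \is a fin_num.
  rewrite ge0_fin_numE ?sqint_ge0//; apply: le_lt_trans uv _.
  by rewrite -(fineK vf) -EFinM ltry.
by rewrite -lee_fin EFinM (fineK uf) (fineK vf).
Qed.

Lemma sqint_le (C : R) u v : cube_meas u -> cube_meas v -> 0 <= C ->
  (forall k, cube N k -> sqnorm (u k) <= C * sqnorm (v k)) -> (sqint u <= C%:E * sqint v)%E.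
Proof.
move=> mu mv C0 uv; rewrite /sqint -ge0_integralZl_EFin//.
- apply: ge0_le_integral.
  + exact: measurable_cube.
  + by move=> k _; rewrite lee_fin sqnorm_ge0.
  + by apply/measurable_EFinP; exact: cube_meas_sqnorm.
  + apply/measurable_EFinP; apply: measurable_funM => //; exact: cube_meas_sqnorm.
  + by move=> k ck; rewrite -EFinM lee_fin uv.
- exact: measurable_cube.
- by move=> k _; rewrite lee_fin sqnorm_ge0.
- by apply/measurable_EFinP; exact: cube_meas_sqnorm.
Qed.

Lemma L2_le (C : R) u v : cube_meas u -> 0 <= C -> L2 v ->
  (forall k, cube N k -> sqnorm (u k) <= C * sqnorm (v k)) ->
  L2 u /\ L2norm u <= Num.sqrt C * L2norm v.
Proof.
move=> mu C0 Lv uv; have /L2P[mv v2] := Lv.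
have h := sqint_le mu mv C0 uv; split; last exact: L2norm_le.
apply/L2P; split=> //; apply: le_lt_trans h _.
have vf : sqint v \is a fin_num by rewrite ge0_fin_numE// sqint_ge0.
by rewrite -(fineK vf) -EFinM ltry.
Qed.

Lemma L2_mul b : cbounded b -> exists2 C : R, 0 <= C & forall u, L2 u ->
  L2 (fun k => b k * u k) /\ L2norm (fun k => b k * u k) <= C * L2norm u.
Proof.
move=> [mb [C bC]]; exists (Num.sqrt (C ^+ 2 + C ^+ 2)); first exact: sqrtr_ge0.
move=> u Lu; apply: L2_le => //.
- by apply: cube_measM; [exact: cmeas_cube|case/L2P: Lu].
- by rewrite addr_ge0// sqr_ge0.
- move=> k _; rewrite sqnormM ler_wpM2r ?sqnorm_ge0//; have [p q] := bC k.
  by apply: lerD; rewrite -[leLHS]real_normK ?num_real// ler_sqr ?nnegrE// (le_trans _ p).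
Qed.

Lemma sqint_add u v : cube_meas u -> cube_meas v ->
  (sqint (fun k => u k + v k)%R <= 2%:E * sqint u + 2%:E * sqint v)%E.
Proof.
move=> mu mv; rewrite /sqint -!ge0_integralZl_EFin//; last first.
all: try exact: measurable_cube.
all: try by move=> k _; rewrite lee_fin sqnorm_ge0.
all: try by apply/measurable_EFinP; exact: cube_meas_sqnorm.
have m2 w : cube_meas w -> measurable_fun (cube N) (fun k => (2%:E * (sqnorm (w k))%:E)%E).
  move=> mw; rewrite (_ : (fun k => _) = EFin \o (fun k => 2 * sqnorm (w k)))//.
  by apply/measurable_EFinP; apply: measurable_funM => //; exact: cube_meas_sqnorm.
rewrite -ge0_integralD//; last first.
all: try exact: m2.
all: try exact: measurable_cube.
all: try by move=> k _; rewrite -EFinM lee_fin mulr_ge0// sqnorm_ge0.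
apply: ge0_le_integral.
- exact: measurable_cube.
- by move=> k _; rewrite lee_fin sqnorm_ge0.
- by apply/measurable_EFinP; exact: (cube_meas_sqnorm (cube_measD mu mv)).
- by apply: emeasurable_funD; exact: m2.
- move=> k _; rewrite -!EFinM -EFinD lee_fin /sqnorm cReD cImD -subr_ge0.
  rewrite (_ : _ - _ = (complex.Re (u k) - complex.Re (v k)) ^+ 2 +
    (complex.Im (u k) - complex.Im (v k)) ^+ 2); last by ring.
  by rewrite addr_ge0// sqr_ge0.
Qed.

(** The constant 2 comes from $|a+b|^2 \le 2|a|^2 + 2|b|^2$; it suffices for the boundedness of a
    sum of operators. *)
Lemma L2_add u v : L2 u -> L2 v -> L2 (fun k => u k + v k) /\
  L2norm (fun k => u k + v k) <= 2 * (L2norm u + L2norm v).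
Proof.
move=> /L2P[mu u2] /L2P[mv v2]; have h := sqint_add mu mv.
have uf : sqint u \is a fin_num by rewrite ge0_fin_numE// sqint_ge0.
have vf : sqint v \is a fin_num by rewrite ge0_fin_numE// sqint_ge0.
have h2 : (sqint (fun k => u k + v k)%R < +oo)%E.
  by apply: le_lt_trans h _; rewrite -(fineK uf) -(fineK vf) -!EFinM -EFinD ltry.
split; first by apply/L2P; split=> //; exact: cube_measD.
have hf : sqint (fun k => u k + v k) \is a fin_num by rewrite ge0_fin_numE// sqint_ge0.
move: h; rewrite -(fineK uf) -(fineK vf) -(fineK hf) -!EFinM -EFinD lee_fin => h.
rewrite -(@ler_pXn2r _ 2)// ?nnegrE ?mulr_ge0 ?addr_ge0 ?L2norm_ge0//.
have nu : L2norm u ^+ 2 = fine (sqint u) by rewrite L2normE sqr_sqrtr// fine_ge0// sqint_ge0.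
have nv : L2norm v ^+ 2 = fine (sqint v) by rewrite L2normE sqr_sqrtr// fine_ge0// sqint_ge0.
rewrite [leLHS](_ : _ = fine (sqint (fun k => u k + v k))); last first.
  by rewrite L2normE sqr_sqrtr// fine_ge0// sqint_ge0.
apply: le_trans h _; rewrite -nu -nv.
by have := L2norm_ge0 u; have := L2norm_ge0 v; nra.
Qed.

End square_integrable.

(** * Means of square integrable functions *)

Section mean_on_L2.
Context {R : realType} {N : nat}.
Implicit Types (u v b : 'rV[R]_N -> R[i]).

Lemma paste_cube j (y : 'rV[R]_j) (k : 'rV_N) : cube j y -> cube N k -> cube N (paste y k).
Proof.
move=> cy ck i; have [ij|ij] := ltnP i j; first by rewrite (paste_lt _ _ ij).
by rewrite paste_ge.
Qed.

Definition restrict_to (D : set 'rV[R]_N) u k : R[i] := if k \in D then u k else 0.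

Lemma restrict_toE D u k : D k -> restrict_to D u k = u k.
Proof. by move=> Dk; rewrite /restrict_to mem_set. Qed.

Lemma cmeas_restrict_to D u : measurable D ->
  measurable_fun D (@complex.Re R \o u) -> measurable_fun D (@complex.Im R \o u) ->
  cmeas (restrict_to D u).
Proof.
move=> mD ur ui; split.
  have := (measurable_restrictT (@complex.Re R \o u) mD).1 ur.
  by congr (measurable_fun _ _); apply/funext => k; rewrite /patch /restrict_to/=; case: ifP.
have := (measurable_restrictT (@complex.Im R \o u) mD).1 ui.
by congr (measurable_fun _ _); apply/funext => k; rewrite /patch /restrict_to/=; case: ifP.
Qed.

Lemma cmeas_restrict_cube u : cube_meas u -> cmeas (restrict_to (cube N) u).
Proof. by move=> [ur ui]; apply: cmeas_restrict_to => //; exact: measurable_cube. Qed.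

Lemma mean1_cube j u v k : (forall k, cube N k -> u k = v k) -> cube N k ->
  mean1 j u k = mean1 j v k.
Proof.
move=> uv ck; rewrite /mean1 /Cintegral; congr (_ +i* _).
  by apply: eq_Rintegral => y /[!inE] cy; rewrite uv//; exact: paste_cube.
by apply: eq_Rintegral => y /[!inE] cy; rewrite uv//; exact: paste_cube.
Qed.

Lemma cmeas_mean1 j u : cmeas u -> cmeas (mean1 j u).
Proof.
by move=> mu; rewrite /cmeas !(mean1_parts j mu); case: mu => ur ui; split; exact: measurable_rmean.
Qed.

Lemma cube_meas_mean1 j u : cube_meas u -> cube_meas (mean1 j u).
Proof.
move=> mu; have := cmeas_cube (cmeas_mean1 j (cmeas_restrict_cube mu)).
apply: cube_meas_eq => k ck; apply: mean1_cube => // k' ck'; exact: restrict_toE.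
Qed.

Lemma sqint_cubem u : cmeas u -> sqint u = (\int[cubem N]_k (sqnorm (u k))%:E)%E.
Proof.
move=> [ur ui]; rewrite integral_cubem//; apply/measurable_EFinP.
by apply: measurable_funD; exact: measurable_funX.
Qed.

Lemma cmeas_sqnorm u : cmeas u -> measurable_fun setT (fun k => (sqnorm (u k))%:E).
Proof.
move=> [ur ui]; apply/measurable_EFinP.
by apply: measurable_funD; exact: measurable_funX.
Qed.

(* A function vanishing on the fibres where it is not integrable. *)
Lemma L2_cfint u : L2 u -> exists2 v, cfint v & eqL2 u v.
Proof.
move=> /L2P[mu u2]; set u0 := restrict_to (cube N) u.
have m0 : cmeas u0 by exact: cmeas_restrict_cube.
have e0 : eqL2 u u0 by apply: eqL2_cube => k ck; rewrite /u0 restrict_toE.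
pose h k : \bar R := (`|complex.Re (u0 k)| + `|complex.Im (u0 k)|)%:E.
have mh : measurable_fun setT h.
  apply/measurable_EFinP; case: m0 => ur ui.
  by apply: measurable_funD; exact: measurableT_comp.
have h0 k : (0 <= h k)%E by rewrite lee_fin addr_ge0.
pose H j k : \bar R := (\int[cubem j]_y h (paste y k))%E.
have mH j : measurable_fun setT (H j) by exact: measurable_int_paste.
have H0 j k : (0 <= H j k)%E by exact: integral_ge0.
pose G := \bigcap_(j in `I_N.+1) [set k | (H j k < +oo)%E].
have mG : measurable G.
  apply: fin_bigcap_measurable => [|j _]; first exact: finite_II.
  rewrite (_ : [set k | _] = H j @^-1` [set x | x < +oo]%E)//.
  rewrite -[X in measurable X]setTI; apply: mH => //.
  rewrite (_ : [set x | _] = ~` [set +oo%E]); first exact/measurableC/emeasurable_set1.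
  by apply/seteqP; split => x /=; [rewrite ltey => /eqP|move=> /eqP; rewrite -ltey].
exists (restrict_to G u0).
  have mv : cmeas (restrict_to G u0).
    by case: m0 => ur ui; apply: cmeas_restrict_to => //; exact: measurable_funTS.
  have fib k j : (j <= N)%N -> (\int[cubem j]_y
      (`|complex.Re (restrict_to G u0 (paste y k))| +
       `|complex.Im (restrict_to G u0 (paste y k))|)%:E < +oo)%E.
    move=> jN; have [Hk|Hk] := pselect (H j k < +oo)%E.
      apply: le_lt_trans Hk; apply: ge0_le_integral => //.
      + apply/measurable_EFinP; apply: measurable_funD; apply: measurableT_comp => //.
          exact: (measurable_fibre k mv.1).
        exact: (measurable_fibre k mv.2).
      + exact: (measurableT_comp mh (measurable_paste1 k)).
      + move=> y _; rewrite /h /restrict_to; case: ifP => // _.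
        by rewrite /= normr0 addr0 lee_fin addr_ge0.
    (* An infinite integral over the fibre is infinite from every point of that fibre, which thus
       lies outside [G]: the new function vanishes on all of it. *)
    rewrite (eq_integral (fun=> 0%E)) ?integral0 ?ltry// => y _.
    rewrite /restrict_to memNset/= ?normr0 ?addr0// => /(_ j jN)/=.
    have -> : H j (paste y k) = H j k; last by [].
    by apply: eq_integral => x _; rewrite pasteA// (_ : paste x y = x)//; apply/rowP => i;
      rewrite (paste_lt _ _ (ltn_ord i)); congr (x _ _); exact: val_inj.
  split; split; [exact: mv.1| |exact: mv.2|] => k j jN; apply: le_lt_trans (fib k j jN);
    (apply: ge0_le_integral => //;
      [apply/measurable_EFinP; apply: measurableT_comp => //;
         [exact: (measurable_fibre k mv.1)||exact: (measurable_fibre k mv.2)]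
      |apply/measurable_EFinP; apply: measurable_funD; apply: measurableT_comp => //;
         [exact: (measurable_fibre k mv.1)|exact: (measurable_fibre k mv.2)]
      |by move=> y _; rewrite lee_fin/= ?lerDl ?lerDr]).
apply: (eqL2_trans e0); apply/eqL2P.
have sq0 : (\int[cubem N]_k (sqnorm (u0 k))%:E < +oo)%E.
  by rewrite -sqint_cubem// -(sqint_eq mu (cmeas_cube m0) e0).
(* Square integrable functions on a probability space are integrable, by $x + y \le 1 + x^2 +
   y^2$. *)
have hfin : (\int[cubem N]_k h k < +oo)%E.
  apply: (@le_lt_trans _ _ (\int[cubem N]_k (1%:E + (sqnorm (u0 k))%:E))%E).
    apply: ge0_le_integral => //.
    - by apply: emeasurable_funD => //; exact: cmeas_sqnorm.
    - move=> k _; rewrite -EFinD lee_fin /sqnorm.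
      rewrite -[complex.Re (u0 k) ^+ 2]real_normK ?num_real//.
      rewrite -[complex.Im (u0 k) ^+ 2]real_normK ?num_real//.
      move: `|complex.Re (u0 k)| `|complex.Im (u0 k)| => x y.
      by have := sqr_ge0 (x - 2^-1); have := sqr_ge0 (y - 2^-1); nra.
  rewrite ge0_integralD//; last 2 first.
  - by move=> k _; rewrite lee_fin sqnorm_ge0.
  - exact: cmeas_sqnorm.
  by rewrite cubem_cst//; exact: lte_add_pinfty (ltry _) sq0.
have aeG : {ae cubem N, forall k, forall j, (j <= N)%N -> (H j k < +oo)%E}.
  apply: ae_foralln => j; have [jN|jN] := leqP j N; last first.
    exact: aeW.
  have iH : (cubem N).-integrable setT (H j).
    apply/integrableP; split => //.
    rewrite (eq_integral (H j)); last by move=> k _; rewrite gee0_abs.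
    by rewrite tonelli_paste.
  move: (integrable_ae measurableT iH); apply: filterS => k /(_ Logic.I) + _.
  by rewrite ge0_fin_numE.
by move: aeG; apply: filterS => k Gk ck; rewrite restrict_toE// => j /= jN; exact: Gk.
Qed.

(** By [tonelli_paste], the null function $|u-v|^2$ has integral zero over almost every fibre, on
    which [u] and [v] then agree almost everywhere and have the same mean. *)
Lemma mean1_eqL2 j u v : (j <= N)%N -> cube_meas u -> cube_meas v -> eqL2 u v ->
  eqL2 (mean1 j u) (mean1 j v).
Proof.
move=> jN mu mv uv.
set u0 := restrict_to (cube N) u; set v0 := restrict_to (cube N) v.
have mu0 : cmeas u0 by exact: cmeas_restrict_cube.
have mv0 : cmeas v0 by exact: cmeas_restrict_cube.
have uu0 : eqL2 (mean1 j u) (mean1 j u0).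
  by apply: eqL2_cube => k ck; apply: mean1_cube => // k' ck'; rewrite /u0 restrict_toE.
have vv0 : eqL2 (mean1 j v) (mean1 j v0).
  by apply: eqL2_cube => k ck; apply: mean1_cube => // k' ck'; rewrite /v0 restrict_toE.
apply: eqL2_trans uu0 _; apply: eqL2_trans (eqL2_sym vv0).
pose g k := sqnorm (u0 k + -1 * v0 k).
have mw : cmeas (fun k => u0 k + -1 * v0 k).
  have [_ mc] : cmeas v0 /\ cmeas (fun k => -1 * v0 k).
    by split=> //; apply: cmeasM => //; exact: (cbounded_cst _).1.
  case: mu0 mc => [ur ui] [wr wi]; split.
    have := measurable_funD ur wr; congr (measurable_fun _ _).
    by apply/funext => k; rewrite /= -cReD.
  have := measurable_funD ui wi; congr (measurable_fun _ _).
  by apply/funext => k; rewrite /= -cImD.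
have mg : measurable_fun setT (fun k => (g k)%:E) by exact: cmeas_sqnorm.
have g0 k : (0 <= (g k)%:E)%E by rewrite lee_fin sqnorm_ge0.
have gz k : g k = 0 -> u0 k = v0 k.
  by move=> /eqP; rewrite sqnorm_eq0 mulN1r subr_eq0 => /eqP.
have G0 : (\int[cubem N]_k \int[cubem j]_y (g (paste y k))%:E = 0)%E.
  rewrite (tonelli_paste (g := fun k => (g k)%:E))//.
  transitivity (\int[cubem N]_k (cst 0 : 'rV[R]_N -> \bar R) k)%E; last by rewrite integral0.
  apply: ae_eq_integral => //.
  move/eqL2P: uv; apply: filterS => k uvk _; rewrite /g /u0 /v0 /restrict_to.
  have [kc|kc] := boolP (k \in cube N).
    rewrite uvk; last exact: set_mem.
    by rewrite mulN1r subrr /= /sqnorm /= expr0n addr0.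
  by rewrite mulr0 addr0 /sqnorm /= expr0n addr0.
apply/eqL2P.
have mG : measurable_fun setT (fun k => \int[cubem j]_y (g (paste y k))%:E)%E.
  exact: (@measurable_int_paste _ j _ (fun k => (g k)%:E)).
have : ae_eq (cubem N) setT (fun k => \int[cubem j]_y (g (paste y k))%:E)%E (cst 0%E).
  apply/ae_eq_integral_abs => //; rewrite -[RHS]G0; apply: eq_integral => k _.
  by rewrite gee0_abs// integral_ge0.
apply: filterS => k /(_ Logic.I) Gk _.
have : ae_eq (cubem j) setT (fun y => (g (paste y k))%:E) (cst 0%E).
  apply/ae_eq_integral_abs => //; first exact: (measurableT_comp mg (measurable_paste1 k)).
  by rewrite -[RHS]Gk; apply: eq_integral => y _; rewrite gee0_abs.
move=> aey; rewrite !mean1E//; congr (_ +i* _); congr fine; apply: ae_eq_integral => //.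
- by apply/measurable_EFinP; exact: (measurable_fibre k mu0.1).
- by apply/measurable_EFinP; exact: (measurable_fibre k mv0.1).
- by move: aey; apply: filterS => y /(_ Logic.I) [/gz /= ->].
- by apply/measurable_EFinP; exact: (measurable_fibre k mu0.2).
- by apply/measurable_EFinP; exact: (measurable_fibre k mv0.2).
- by move: aey; apply: filterS => y /(_ Logic.I) [/gz /= ->].
Qed.

End mean_on_L2.

Section bounded_operators.
Context {R : realType} {N : nat}.
Implicit Types (u v b : 'rV[R]_N -> R[i]) (T S : ('rV[R]_N -> R[i]) -> 'rV[R]_N -> R[i]).

(* Integrate [2 c f - c ^+ 2 <= f ^+ 2], where [c] is the mean of [f]. *)
Lemma sqr_rmean_le j (f : 'rV[R]_N -> R) k : (j <= N)%N -> fint f ->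
  ((rmean j f k ^+ 2)%:E <= \int[cubem j]_y (f (paste y k) ^+ 2)%:E)%E.
Proof.
move=> jN ff; set c := rmean j f k.
have [->|fin] := eqVneq (\int[cubem j]_y (f (paste y k) ^+ 2)%:E)%E +oo%E; first by rewrite leey.
have if2 : (cubem j).-integrable setT (EFin \o (fun y => f (paste y k) ^+ 2)).
  apply/integrableP; split.
    by apply/measurable_EFinP; apply: measurable_funX; exact: measurable_fibre ff.1.
  rewrite (eq_integral (fun y => (f (paste y k) ^+ 2)%:E)).
    by rewrite ltey.
  by move=> y _ /=; rewrite ger0_norm ?sqr_ge0.
have if1 := integrableZl measurableT (2 * c) (fint_integrable k jN ff).
have ic : (cubem j).-integrable setT (fun=> (- c ^+ 2)%:E).
  apply/integrableP; split; first exact: measurable_cst.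
  by rewrite cubem_cst ?ltry// lee_fin.
have il := integrableD measurableT if1 ic.
have := le_integral measurableT il if2; rewrite integralD// integralZl//; last exact: fint_integrable.
have -> : (\int[cubem j]_y (EFin \o (fun y => f (paste y k))) y = c%:E)%E.
  by rewrite /c /rmean /Rintegral fineK// integrable_fin_num//; exact: fint_integrable.
have -> : (\int[cubem j]_y (- c ^+ 2)%:E = (- c ^+ 2)%:E)%E.
  by rewrite integral_cst// -[RHS]mule1; congr (_ * _)%E; exact: cubemT.
rewrite -EFinM -EFinD (_ : 2 * c * c + - c ^+ 2 = c ^+ 2); last by ring.
apply => y _ /=; rewrite -EFinD lee_fin -subr_ge0.
by rewrite (_ : _ - _ = (f (paste y k) - c) ^+ 2) ?sqr_ge0//; ring.
Qed.

(** Jensen's inequality for the square on each fibre, integrated over the cube. *)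
Lemma sqint_mean1_le j u : (j <= N)%N -> cfint u -> (sqint (mean1 j u) <= sqint u)%E.
Proof.
move=> jN uf; have mu := cfint_meas uf.
rewrite (sqint_cubem mu) sqint_cubem; last exact: cmeas_mean1.
have msq := cmeas_sqnorm mu.
rewrite -[leRHS](@tonelli_paste R j N (fun k => (sqnorm (u k))%:E))//; last first.
  by move=> k; rewrite lee_fin sqnorm_ge0.
apply: ge0_le_integral => //.
- by move=> k _; rewrite lee_fin sqnorm_ge0.
- exact: cmeas_sqnorm (cmeas_mean1 j mu).
- apply: (@measurable_int_paste _ j _ (fun k => (sqnorm (u k))%:E)) => // k.
  by rewrite lee_fin sqnorm_ge0.
- move=> k _; have [ur ui] := uf; rewrite mean1E//.
  rewrite /sqnorm/= EFinD.
  have ms (f : 'rV[R]_N -> R) : fint f ->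
      measurable_fun setT (fun y : 'rV_j => (f (paste y k) ^+ 2)%:E).
    by move=> ff; apply/measurable_EFinP; apply: measurable_funX; exact: measurable_fibre ff.1.
  apply: (@le_trans _ _ (\int[cubem j]_y (complex.Re (u (paste y k)) ^+ 2)%:E +
    \int[cubem j]_y (complex.Im (u (paste y k)) ^+ 2)%:E)%E).
    by apply: leeD; [exact: (sqr_rmean_le (f := @complex.Re R \o u) k jN ur)|exact: (sqr_rmean_le (f := @complex.Im R \o u) k jN ui)].
  rewrite -ge0_integralD//.
  + by move=> y _; rewrite lee_fin sqr_ge0.
  + exact: (ms _ ur).
  + by move=> y _; rewrite lee_fin sqr_ge0.
  + exact: (ms _ ui).
Qed.

Lemma L2_cbounded b : cbounded b -> L2 b.
Proof.
move=> [mb [C bC]]; apply/L2P; split; first exact: cmeas_cube.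
rewrite sqint_cubem//; apply: (@le_lt_trans _ _ (\int[cubem N]_k (C ^+ 2 + C ^+ 2)%:E)%E).
  apply: ge0_le_integral => //.
  - by move=> k _; rewrite lee_fin sqnorm_ge0.
  - exact: cmeas_sqnorm.
  - move=> k _; rewrite lee_fin; have [p q] := bC k.
    by apply: lerD; rewrite -[leLHS]real_normK ?num_real// ler_sqr ?nnegrE// (le_trans _ p).
by rewrite cubem_cst ?ltry// lee_fin addr_ge0// sqr_ge0.
Qed.

Lemma L2_scale (c : R[i]) u v : L2 u -> L2 v -> L2 (fun k => c * u k + v k).
Proof.
move=> Lu Lv; have [C C0 LC] := L2_mul (@cbounded_cst R N c).
exact: (L2_add (LC u Lu).1 Lv).1.
Qed.

Lemma bounded_operator_comp T S : bounded_operator T -> bounded_operator S ->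
  bounded_operator (fun u => T (S u)).
Proof.
move=> [T1 T2 T3 [C CT]] [S1 S2 S3 [D DS]]; split.
- by move=> u /S1; exact: T1.
- by move=> u v Lu Lv uv; apply: T2; [exact: S1|exact: S1|exact: S2].
- move=> c u v Lu Lv; apply: eqL2_trans (T3 c _ _ (S1 _ Lu) (S1 _ Lv)).
  apply: T2; [exact/S1/L2_scale|exact: L2_scale (S1 _ Lu) (S1 _ Lv)|exact: S3].
- exists (`|C| * D) => u Lu; apply: le_trans (CT _ (S1 _ Lu)) _.
  rewrite -mulrA (le_trans (ler_wpM2r (L2norm_ge0 _) (ler_norm C)))//.
  by rewrite ler_wpM2l// DS.
Qed.

Lemma bounded_operator_add T S : bounded_operator T -> bounded_operator S ->
  bounded_operator (fun u k => T u k + S u k).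
Proof.
move=> [T1 T2 T3 [C CT]] [S1 S2 S3 [D DS]]; split.
- by move=> u Lu; exact: (L2_add (T1 _ Lu) (S1 _ Lu)).1.
- by move=> u v Lu Lv uv; apply: eqL2D; [exact: T2|exact: S2].
- move=> c u v Lu Lv; apply: eqL2_trans (eqL2D (T3 c _ _ Lu Lv) (S3 c _ _ Lu Lv)) _.
  by apply: eqL2_cube => k _; ring.
- exists (2 * (C + D)) => u Lu; apply: le_trans (L2_add (T1 _ Lu) (S1 _ Lu)).2 _.
  by rewrite -mulrA ler_wpM2l// mulrDl lerD ?CT ?DS.
Qed.

Lemma bounded_operator_mul b : cbounded b -> bounded_operator (fun u k => b k * u k).
Proof.
move=> bb; have [C C0 LC] := L2_mul bb; split.
- by move=> u /LC[].
- by move=> u v _ _; exact: eqL2M.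
- by move=> c u v _ _; apply: eqL2_cube => k _; ring.
- by exists C => u /LC[].
Qed.

Lemma L2_meas u : L2 u -> cube_meas u. Proof. by move/L2P => []. Qed.

Lemma L2_mean1 j u : (j <= N)%N -> L2 u -> L2 (mean1 j u) /\ L2norm (mean1 j u) <= L2norm u.
Proof.
move=> jN Lu; have [v vf uv] := L2_cfint Lu; have mv := cmeas_cube (cfint_meas vf).
have Lv := L2_eq mv uv Lu.
have e := mean1_eqL2 jN (L2_meas Lu) mv uv.
have h := sqint_mean1_le jN vf.
have mm := cube_meas_mean1 j mv.
have Lm : L2 (mean1 j v).
  by apply/L2P; split => //; apply: le_lt_trans h _; case/L2P : Lv.
split; first exact: L2_eq (cube_meas_mean1 j (L2_meas Lu)) (eqL2_sym e) Lm.
rewrite (L2norm_eq (cube_meas_mean1 j (L2_meas Lu)) mm e) (L2norm_eq (L2_meas Lu) mv uv).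
by rewrite -[leRHS]mul1r -sqrtr1 L2norm_le// mul1e.
Qed.

Lemma bounded_operator_mean1 j : (j <= N)%N -> bounded_operator (@mean1 R N j).
Proof.
move=> jN; split.
- by move=> u /(L2_mean1 jN)[].
- by move=> u v /L2_meas mu /L2_meas mv; exact: mean1_eqL2.
- move=> c u v Lu Lv; have [u' u'f uu'] := L2_cfint Lu; have [v' v'f vv'] := L2_cfint Lv.
  have mu' := cmeas_cube (cfint_meas u'f); have mv' := cmeas_cube (cfint_meas v'f).
  have cu'f : cfint (fun k => c * u' k) by apply: cfintM => //; exact: cbounded_cst.
  have e : eqL2 (fun k => c * u k + v k) (fun k => c * u' k + v' k).
    by apply: eqL2D => //; exact: eqL2M.
  apply: eqL2_trans (mean1_eqL2 jN (L2_meas (L2_scale c Lu Lv)) _ e) _.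
    by apply/cmeas_cube/cfint_meas; exact: cfintD.
  apply: (@eqL2_trans _ _ (fun k => c * mean1 j u' k + mean1 j v' k)); last first.
    apply: eqL2D; first by apply: eqL2M; apply: mean1_eqL2 (eqL2_sym uu') => //; exact: L2_meas.
    by apply: mean1_eqL2 (eqL2_sym vv') => //; exact: L2_meas.
  apply: eqL2_cube => k _; rewrite mean1D// mean1M//.
  by apply: cbounded_cmulint => //; exact: cbounded_cst.
- by exists 1 => u /(L2_mean1 jN)[_]; rewrite mul1r.
Qed.

Section resolvent_bounded.
Variables (A : nat -> 'rV[R]_N -> R) (z : R[i]).
Hypothesis Abnd : forall j, (j <= N)%N -> cbounded (fun k => (A j k)%:C).

Lemma bounded_operator_trunc_op j : (j <= N)%N -> bounded_operator (trunc_op A z j).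
Proof.
elim: j => [|j IH] jN /=.
  apply: (@bounded_operator_mul (fun k => (A 0%N k)%:C - z)).
  by apply: cboundedD; [exact: Abnd|exact: (cbounded_cst (- z))].
apply: (@bounded_operator_add (trunc_op A z j)); first exact/IH/ltnW.
exact: (bounded_operator_comp (bounded_operator_mul (Abnd jN)) (bounded_operator_mean1 jN)).
Qed.

Lemma bounded_operator_resolv j : (j <= N)%N -> invertible_below A z j ->
  cbounded (fun k => (Fc A j z k)^-1) -> bounded_operator (resolv A z j).
Proof.
elim: j => [|j IH] jN ok bF /=; first exact: bounded_operator_mul.
have [_ bF' _ _] := ok _ (ltnSn j); have ok' := invertible_belowW ok.
have bw := cbounded_test_fun ok; have bw' := cbounded_test_fun ok'.
have := bounded_operator_add (IH (ltnW jN) ok' bF')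
  (bounded_operator_comp (bounded_operator_mul
     (cboundedM (cbounded_cst (-1)) (cboundedM (cboundedM (Abnd jN) bw) bF)))
   (bounded_operator_comp (bounded_operator_mean1 jN) (bounded_operator_mul (cboundedM bw' bF')))).
congr bounded_operator; apply/funext => u; apply/funext => k.
by rewrite mulN1r mulNr.
Qed.

End resolvent_bounded.
End bounded_operators.

(** * Criteria for the spectrum *)

Section spectrum_criteria.
Context {R : realType} {N : nat}.
Implicit Types (u v b : 'rV[R]_N -> R[i]) (A : nat -> 'rV[R]_N -> R).

Lemma not_spectrum A z : (forall j, (j <= N)%N -> gtail j (A j)) ->
  (forall j, (j <= N)%N -> cbounded (fun k => (A j k)%:C)) ->
  invertible_below A z N -> (forall k, Fc A N z k != 0) ->
  cbounded (fun k => (Fc A N z k)^-1) -> ~ L2_spectrum (operator A) z.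
Proof.
move=> At Ab ok F0 bF; apply; exists (resolv A z N).
have bS := bounded_operator_resolv Ab (leqnn N) ok bF.
have bT := bounded_operator_trunc_op z Ab (leqnn N).
split=> // u Lu; have [v vf uv] := L2_cfint Lu.
have Lv := L2_eq (cmeas_cube (cfint_meas vf)) uv Lu.
have TE w : (fun k => operator A w k - z * w k) = trunc_op A z N w.
  by apply/funext => k; rewrite trunc_opE.
have [T1 T2 _ _] := bT; have [S1 S2 _ _] := bS.
rewrite !TE; split.
  apply: eqL2_trans (S2 _ _ (T1 _ Lu) (T1 _ Lv) (T2 _ _ Lu Lv uv)) _.
  apply: eqL2_trans (eqL2_sym uv); apply: eqL2_cube => k _.
  exact: resolv_trunc_op.
apply: eqL2_trans (T2 _ _ (S1 _ Lu) (S1 _ Lv) (S2 _ _ Lu Lv uv)) _.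
apply: eqL2_trans (eqL2_sym uv); apply: eqL2_cube => k _.
exact: trunc_op_resolv.
Qed.

Lemma approx_spectrum T z : (forall d : R, 0 < d -> exists u : 'rV[R]_N -> R[i],
    [/\ L2 u, 0 < L2norm u, L2 (fun k => T u k - z * u k) &
        L2norm (fun k => T u k - z * u k) <= d * L2norm u]) -> L2_spectrum T z.
Proof.
move=> ap [S [[S1 S2 S3 [M SM]] ST]].
(* [M] may be zero or negative, hence $|M|+1$; for $d = 1/(2(|M|+1))$ the inverse would give $\|u\|
   \le |M|\,d\,\|u\| \le \|u\|/2$. *)
have M0 : 0 < `|M| + 1 by rewrite ltr_wpDl.
have d0 : 0 < (`|M| + 1)^-1 / 2 by rewrite divr_gt0// invr_gt0.
have [u [Lu u0 LTu Tu]] := ap _ d0.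
have e := L2norm_eq (L2_meas (S1 _ LTu)) (L2_meas Lu) (ST u Lu).1.
have := SM _ LTu; rewrite e => h.
have : L2norm u <= `|M| * ((`|M| + 1)^-1 / 2 * L2norm u).
  apply: le_trans h _; apply: le_trans (ler_wpM2r (L2norm_ge0 _) (ler_norm M)) _.
  by rewrite ler_wpM2l.
rewrite !mulrA ler_pMl// ler_pdivlMr// mul1r ler_pdivlMr//.
by have := normr_ge0 M; lra.
Qed.

(* Only the values of [A] near the support of [phi] matter, hence the two families. *)
Lemma spectrum_test A A' z r : (r < N)%N ->
  (forall j, (j <= N)%N -> gtail j (A j)) ->
  (forall j, (j <= N)%N -> cbounded (fun k => (A j k)%:C)) ->
  (forall j, (j <= N)%N -> gtail j (A' j)) ->
  (forall j, (j <= N)%N -> cbounded (fun k => (A' j k)%:C)) ->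
  invertible_below A' z r ->
  forall (phi : 'rV[R]_N -> R[i]) (d : R), gtail r phi -> cbounded phi ->
  (forall k, mean1 r.+1 phi k = 0) -> 0 < L2norm phi -> 0 <= d ->
  (forall k, cube N k -> phi k != 0 ->
     (forall i, (i <= r)%N -> A i k = A' i k) /\ sqnorm (Fc A' r z k) <= d ^+ 2) ->
  exists u, [/\ L2 u, 0 < L2norm u, L2 (fun k => operator A u k - z * u k) &
        L2norm (fun k => operator A u k - z * u k) <= d * L2norm u].
Proof.
move=> rN At Ab A't A'b ok phi d pt pb p0 pn d0 pA; have rN' := ltnW rN.
have bw := cbounded_test_fun ok.
pose u k := phi k * test_fun A' z r k; have bu : cbounded u by exact: cboundedM.
have uf := cbounded_fint bu; have Lu := L2_cbounded bu; have Lp := L2_cbounded pb.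
have bT := bounded_operator_trunc_op z Ab (leqnn N).
have TE w : (fun k => operator A w k - z * w k) = trunc_op A z N w.
  by apply/funext => k; rewrite trunc_opE.
have Mr k : mean1 r u k = phi k.
  by rewrite mean1M ?mean_test_fun ?mulr1//; exact/cbounded_cmulint/cbounded_fint.
(* Averaging is a contraction and takes [u] to [phi], so the norm of [u] stays away from zero. *)
have pu : L2norm phi <= L2norm u.
  by have := (L2_mean1 rN' Lu).2; congr (L2norm _ <= _); apply/funext.
(* Every later mean factors through the one of index [r.+1], where [phi] averages to zero, so the
   terms of the operator beyond [r] disappear. *)
have MN j k : (r < j <= N)%N -> mean1 j u k = 0.
  move=> /andP[rj jN].
  rewrite -(mean1_mean1 k (i := r) (j := j))//; last by rewrite ltnW.
  rewrite (_ : mean1 r u = phi); last exact/funext.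
  rewrite -(mean1_mean1 k (i := r.+1) (j := j)) ?rj//; last exact: cbounded_fint.
  rewrite (_ : mean1 r.+1 phi = fun=> 0); last exact/funext.
  by rewrite mean1_id//; exact: (cbounded_cst 0).1.
have Tk k : cube N k -> trunc_op A z N u k = phi k * Fc A' r z k.
  move=> ck; have [pk0|pk0] := eqVneq (phi k) 0.
    (* Where [phi] vanishes, [A] and [A'] are unrelated, but [phi k] factors out of the truncated
       operator. *)
    have E0 j : (j <= r)%N -> trunc_op A z j u k = 0.
      move=> jr; have jN := leq_trans jr rN'.
      rewrite trunc_opM ?pk0 ?mul0r//; first exact: gtailW pt.
      by apply: cbounded_cmulint => //; exact: cbounded_fint.
    have E j : (r <= j <= N)%N -> trunc_op A z j u k = 0.
      elim: j => [|j IH] /andP[rj jN]; first by apply: E0; move: rj; rewrite leqn0 => /eqP ->.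
      move: rj; rewrite leq_eqVlt => /predU1P[<-|rj]; first exact: E0.
      by rewrite /= IH ?MN ?rj ?mulr0 ?addr0// ?(ltnW jN) ?andbT.
    by rewrite E ?rN' ?leqnn// pk0 mul0r.
  have [AA _] := pA k ck pk0.
  have E0 : trunc_op A z r u k = phi k * Fc A' r z k.
    rewrite trunc_opM//; last by apply: cbounded_cmulint => //; exact: cbounded_fint.
    rewrite -(@trunc_op_test _ _ A' z A't r)//; congr (_ * _).
    have E j : (j <= r)%N -> trunc_op A z j (test_fun A' z r) k = trunc_op A' z j (test_fun A' z r) k.
      elim: j => [|j IH] jr /=; first by rewrite AA.
      by rewrite AA// IH// ltnW.
    exact: E.
  have E j : (r <= j <= N)%N -> trunc_op A z j u k = phi k * Fc A' r z k.
    elim: j => [|j IH] /andP[rj jN]; first by move: rj; rewrite leqn0 => /eqP r0; rewrite -E0 r0.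
    move: rj; rewrite leq_eqVlt => /predU1P[r0|rj]; first by rewrite -r0 E0.
    by rewrite -[LHS]/(trunc_op A z j u k + (A j.+1 k)%:C * mean1 j.+1 u k)
      IH ?MN ?rj ?mulr0 ?addr0// ?(ltnW jN) ?andbT.
  by rewrite E ?rN' ?leqnn.
have [T1 _ _ _] := bT.
exists u; rewrite TE; split; [exact: Lu|exact: lt_le_trans pu|exact: T1|].
have hb k : cube N k -> sqnorm (trunc_op A z N u k) <= d ^+ 2 * sqnorm (phi k).
  move=> ck; rewrite Tk// sqnormM mulrC.
  have [->|pk0] := eqVneq (phi k) 0; first by rewrite /sqnorm /= expr0n addr0 !mulr0.
  by rewrite ler_wpM2r ?sqnorm_ge0//; case: (pA k ck pk0).
have [_] := L2_le (L2_meas (T1 _ Lu)) (sqr_ge0 d) Lp hb.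
rewrite sqrtr_sqr ger0_norm// => h; apply: le_trans h _; by rewrite ler_wpM2l.
Qed.

Lemma eigenvalue_test A z : (forall j, (j <= N)%N -> gtail j (A j)) ->
  (forall j, (j <= N)%N -> cbounded (fun k => (A j k)%:C)) ->
  invertible_below A z N -> (forall k, cube N k -> Fc A N z k = 0) ->
  L2_eigenvalue (operator A) z.
Proof.
move=> At Ab ok F0; exists (test_fun A z N).
have bw := cbounded_test_fun ok; have mw := cmeas_cube bw.1.
split; first exact: L2_cbounded.
  move=> w0; have m0 : cmeas (fun _ : 'rV[R]_N => 0 : R[i]) by exact: (@cbounded_cst R N 0).1.
  have := mean1_eqL2 (leqnn N) mw (cmeas_cube m0) w0.
  move=> [B [mB B0 sB]].
  (* If the function vanished almost everywhere, so would its mean over the whole cube; that mean is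
     1 at every point, so the exceptional set would contain the cube. *)
  have cB : cube N `<=` B.
    move=> k ck; apply: sB => /= /(_ ck); rewrite mean_test_fun// mean1_id//.
    by move/eqP; rewrite oner_eq0.
  have : (lebesgue_rV N (@cube R N) <= lebesgue_rV N B)%E.
    by apply: (@le_measure _ _ _ (lebesgue_rV N)); rewrite ?inE//; exact: measurable_cube.
  by rewrite lebesgue_cube B0 lee_fin ler10.
apply: eqL2_cube => k ck; apply/eqP; rewrite -subr_eq0 -trunc_opE trunc_op_test//.
by rewrite F0.
Qed.

End spectrum_criteria.

(** * Step functions of mean zero in one coordinate *)

Section step_function.
Context {R : realType} {N : nat}.
Variables (a b : 'I_N -> R) (r : 'I_N).
Hypothesis ab : forall i, [/\ 0 <= a i, a i < b i & b i <= 1].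

Let c := (a r + b r) / 2.
Let s (t : R) : R := \1_(`[a r, c[%classic) t - \1_(`[c, b r]%classic) t.
Let tailbox := [set k : 'rV[R]_N | forall i : 'I_N, (r < i)%N -> a i <= k ord0 i <= b i].

(* Supported in a small box and of mean zero in the coordinate [r], so that all
   the means of index greater than [r] vanish. *)
Definition step_fun (k : 'rV[R]_N) : R[i] := (\1_tailbox k)%:C * (s (k ord0 r))%:C.

Lemma cubem_box_gt0 n (a' b' : 'I_n -> R) : (forall i, [/\ 0 <= a' i, a' i < b' i & b' i <= 1]) ->
  (0 < @cubem R n [set k | forall i, a' i <= k ord0 i <= b' i]%R)%E.
Proof.
elim: n a' b' => [|n IH] a' b' ab'.
  rewrite (_ : [set k | _] = setT) ?(lt_le_trans _ (eqxx _))//.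
    by rewrite [X in (_ < X)%E]cubemT lte01.
  by apply/seteqP; split => // k _ [].
have mb m (a1 b1 : 'I_m -> R) : measurable [set k : 'rV[R]_m | forall i, a1 i <= k ord0 i <= b1 i].
  rewrite (_ : [set k | _] = \bigcap_(i in [set: 'I_m]) (rV_coord i @^-1` `[a1 i, b1 i]%classic)).
    apply: fin_bigcap_measurable => [|i _]; first exact: finite_finset.
    by rewrite -[X in measurable X]setTI; exact: measurable_rV_coord.
  by apply/seteqP; split => k kn i; have := kn i; rewrite /= in_itv/= => // /(_ Logic.I).
rewrite [X in (_ < X)%E]cubemE; last exact: mb.
rewrite (_ : _ @^-1` _ = (`[a' ord0, b' ord0]%classic : set (measurableTypeR R)) `*`
   [set k : 'rV[R]_n | forall i, a' (lift ord0 i) <= k ord0 i <= b' (lift ord0 i)]); last first.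
  apply/seteqP; split => [[t x] /= h|[t x] [/= ht hx] i].
    by split => [|i]; [have := h ord0; rewrite rV_cons0 in_itv|have := h (lift ord0 i); rewrite rV_consS].
  case: (unliftP ord0 i) => [j ->|->]; rewrite ?rV_consS ?rV_cons0; first exact: hx.
  by move: ht; rewrite in_itv.
rewrite product_measure1E; [|exact: measurable_itv|exact: mb].
apply: mule_gt0; last by apply: IH => i.
have [a0 abi b1] := ab' ord0.
rewrite /unif /= /mfrestr /mrestr setIidl; last first.
  by move=> t /=; rewrite !in_itv/= => /andP[p q]; rewrite (le_trans a0 p) (le_trans q b1).
have := @lebesgue_measure_itv R `[a' ord0, b' ord0]; rewrite /= lte_fin abi => ->.
by rewrite -EFinB lte_fin subr_gt0.
Qed.

Let ac : a r < c. Proof. by have [_ h _] := ab r; rewrite /c; lra. Qed.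
Let cb : c < b r. Proof. by have [_ h _] := ab r; rewrite /c; lra. Qed.

Lemma step_fun_gtail : gtail r step_fun.
Proof.
move=> k k' kk'; rewrite /step_fun (kk' r)//; congr (_%:C * _); rewrite !indicE; congr (_%:R).
congr (nat_of_bool _); apply/idP/idP; rewrite !inE => h i ri.
  by rewrite -kk' ?(ltnW ri)//; exact: h.
by rewrite kk' ?(ltnW ri)//; exact: h.
Qed.

Let ms : measurable_fun setT s.
Proof. by apply: measurable_funB; exact: measurable_indic. Qed.

Let mtailbox : measurable tailbox.
Proof.
rewrite (_ : tailbox = \bigcap_(i in [set i : 'I_N | (r < i)%N]) (rV_coord i @^-1` `[a i, b i]%classic)).
  apply: fin_bigcap_measurable => [|i _]; first exact: finite_finset.
  by rewrite -[X in measurable X]setTI; exact: measurable_rV_coord.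
by apply/seteqP; split => k kn i ri; have := kn i ri; rewrite /= in_itv.
Qed.

Let creal_bounded (f : 'rV[R]_N -> R) C : measurable_fun setT f -> (forall k, `|f k| <= C) ->
  cbounded (fun k => (f k)%:C).
Proof.
move=> mf fC; split; first by split => //; exact: measurable_cst.
by exists C => k; rewrite /= normr0 fC; split=> //; exact: le_trans (fC k).
Qed.

Let bs : cbounded (fun k : 'rV[R]_N => (s (k ord0 r))%:C).
Proof.
apply: (@creal_bounded _ 2); first exact: (measurableT_comp ms (@measurable_rV_coord R N r)).
move=> k; rewrite /s (le_trans (ler_normB _ _))// !indicE.
by case: (_ \in _); case: (_ \in _); rewrite ?normr1 ?normr0; lra.
Qed.

Let bchi : cbounded (fun k : 'rV[R]_N => (\1_tailbox k)%:C).
Proof.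
apply: (@creal_bounded _ 1) => [|k]; first exact: measurable_indic.
by rewrite indicE; case: (_ \in _); rewrite ?normr1 ?normr0.
Qed.

Lemma step_fun_cbounded : cbounded step_fun.
Proof. exact: cboundedM. Qed.

Lemma step_fun_mean k : mean1 r.+1 step_fun k = 0.
Proof.
rewrite mean1M//; last 2 first.
- move=> x x' xx'; rewrite !indicE; congr (_%:R%:C); congr (nat_of_bool _).
  apply/idP/idP; rewrite !inE => h i ri; first by rewrite -xx'//; exact: h.
  by rewrite xx'//; exact: h.
- by apply: cbounded_cmulint => //; exact: cbounded_fint.
rewrite mean1_Cmean//; last 2 first.
- by move=> x x' xx'; rewrite xx'.
- exact: bs.1.
apply/eqP; rewrite mulf_eq0; apply/orP; right; apply/eqP.
rewrite /Cmean/=; apply: complexP => /=; last first.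
  by rewrite /mean /Rintegral/=; rewrite integral0.
have [a0 abr b1] := ab r.
have E : mean r (@complex.Re R \o (fun k : 'rV[R]_N => (s (k ord0 r))%:C)) k =
    \int[lebesgue_measure]_(t in `[0, 1]) (\1_(`[a r, c[%classic) t - \1_(`[c, b r]%classic) t).
  by apply: eq_Rintegral => t _; rewrite /= mxE eqxx.
have Ii (i : interval R) : [set` i] `<=` `[0, 1]%classic ->
    \int[lebesgue_measure]_(t in `[0, 1]) (\1_[set` i] t) = fine (lebesgue_measure [set` i]).
  by move=> i01; rewrite /Rintegral integral_indic// setIidl.
have int1 (i : interval R) : lebesgue_measure.-integrable `[0, 1]%classic
    (EFin \o (fun t : R => \1_[set` i] t : R)).
  apply/integrableP; split; first by apply/measurable_EFinP; exact: measurable_indic.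
  apply: (@le_lt_trans _ _ (\int[lebesgue_measure]_(t in `[0%R, 1%R]) 1%:E)%E).
    apply: ge0_le_integral => //.
    - by apply/measurable_EFinP; apply: measurableT_comp => //; exact: measurable_indic.
    - by move=> t _; rewrite lee_fin/= indicE; case: (_ \in _); rewrite ?normr1 ?normr0.
  by rewrite integral_cst//= mul1e; exact: lebesgue_unit_lty.
rewrite E RintegralB// !Ii.
- rewrite !lebesgue_measure_itv/= !lte_fin ac cb /= /c; lra.
- by move=> t /=; rewrite !in_itv/= => /andP[p q]; rewrite (le_trans _ p) ?(le_trans q)// (le_trans a0)// ltW.
- move=> t /=; rewrite !in_itv/= => /andP[p q]; rewrite (le_trans _ p)//.
  by rewrite (le_trans (ltW q))// (le_trans (ltW cb)).
Qed.

Lemma step_fun_neq0 k : step_fun k != 0 -> forall i : 'I_N, (r <= i)%N -> a i <= k ord0 i <= b i.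
Proof.
rewrite /step_fun mulf_eq0 negb_or => /andP[p q] i.
rewrite leq_eqVlt => /predU1P[ri|ri].
  have -> : i = r by exact: val_inj.
  apply: contraNT q => h; rewrite /s !indicE !memNset ?subrr//= in_itv/= => /andP[p1 p2].
    by case/negP: h; rewrite p2 andbT (le_trans (ltW ac)).
  by case/negP: h; rewrite p1 (le_trans (ltW p2)) ?ltW.
apply: contraNT p => h; rewrite indicE memNset//= => /(_ i ri).
by apply/negP.
Qed.

Lemma step_fun_L2norm : 0 < L2norm step_fun.
Proof.
rewrite L2normE sqrtr_gt0; have /L2P[_ fin] := L2_cbounded step_fun_cbounded.
rewrite fine_gt0// fin andbT sqint_cubem; last exact: step_fun_cbounded.1.
pose B := [set k : 'rV[R]_N | forall i, a i <= k ord0 i <= b i].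
have mB : measurable B.
  rewrite (_ : B = \bigcap_(i in [set: 'I_N]) (rV_coord i @^-1` `[a i, b i]%classic)).
    apply: fin_bigcap_measurable => [|i _]; first exact: finite_finset.
    by rewrite -[X in measurable X]setTI; exact: measurable_rV_coord.
  by apply/seteqP; split => k kn i; have := kn i; rewrite /= in_itv/= => // /(_ Logic.I).
(* On the box [B] the step function has modulus 1, so its squared norm is at least the measure of
   [B]. *)
apply: (@lt_le_trans _ _ (\int[cubem N]_k (\1_B k)%:E)%E).
  by rewrite integral_indic// setIT; exact: cubem_box_gt0.
apply: ge0_le_integral => //.
- by apply/measurable_EFinP; exact: measurable_indic.
- exact: cmeas_sqnorm step_fun_cbounded.1.
- move=> k _; rewrite lee_fin indicE; have [kB|_] := boolP (k \in B); last exact: sqnorm_ge0.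
  move: kB; rewrite inE => kB.
  rewrite /step_fun sqnormM indicE mem_set; last by move=> i _; exact: kB.
  rewrite /sqnorm /= expr0n !addr0 expr1n mul1r /s !indicE.
  have /andP[p q] := kB r; have [tc|tc] := ltP (k ord0 r) c.
    rewrite mem_set/= ?in_itv/= ?p// memNset/= ?subr0 ?expr1n//.
    by rewrite in_itv/= leNgt tc.
  rewrite memNset/= ?mem_set/= ?in_itv/= ?tc// ?sub0r ?sqrrN ?expr1n//.
  by rewrite ltNge tc andbF.
Qed.

End step_function.

(** * Continuity of the continued fractions *)

Section unit_interval_integrals.
Context {R : realType}.
Implicit Types f g : R -> R.

Lemma unit_interval_integrable f : (forall t, 0 <= t <= 1 -> {for t, continuous f}) ->
  lebesgue_measure.-integrable `[0, 1]%classic (EFin \o f).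
Proof.
move=> cf; apply: (@continuous_compact_integrable R f); first exact: segment_compact.
by apply: continuous_in_subspaceT => t; rewrite inE /= in_itv/=; exact: cf.
Qed.

Lemma Rintegral_unit_cst (c : R) : \int[lebesgue_measure]_(t in `[0, 1]) (cst c t) = c.
Proof. by rewrite Rintegral_cst//= -[RHS]mulr1; congr (_ * _); rewrite lebesgue_unit. Qed.

Lemma Rintegral_unit_gt0 f : (forall t, 0 <= t <= 1 -> {for t, continuous f}) ->
  (forall t, 0 <= t <= 1 -> 0 < f t) -> 0 < \int[lebesgue_measure]_(t in `[0, 1]) f t.
Proof.
move=> cf f0.
have cw : {within `[0, 1]%classic, continuous f}.
  by apply: continuous_in_subspaceT => t; rewrite inE /= in_itv/=; exact: cf.
have [c] := EVT_min ler01 cw; rewrite in_itv/= => c01 fc.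
apply: (lt_le_trans (f0 c c01)); rewrite -[leLHS]Rintegral_unit_cst.
apply: le_Rintegral => //.
- by apply: (@unit_interval_integrable (cst (f c))) => t _; exact: cst_continuous.
- exact: unit_interval_integrable.
Qed.

Lemma Rintegral_unit_lt f g : (forall t, 0 <= t <= 1 -> {for t, continuous f}) ->
  (forall t, 0 <= t <= 1 -> {for t, continuous g}) ->
  (forall t, 0 <= t <= 1 -> f t < g t) ->
  \int[lebesgue_measure]_(t in `[0, 1]) f t < \int[lebesgue_measure]_(t in `[0, 1]) g t.
Proof.
move=> cf cg fg; rewrite -subr_gt0 -RintegralB//; try exact: unit_interval_integrable.
apply: Rintegral_unit_gt0 => t t01; last by rewrite subr_gt0 fg.
by apply: cvgB; [exact: cg|exact: cf].
Qed.

Lemma constant_sign f : (forall t, 0 <= t <= 1 -> {for t, continuous f}) ->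
  (forall t, 0 <= t <= 1 -> f t != 0) ->
  (forall t, 0 <= t <= 1 -> 0 < f t) \/ (forall t, 0 <= t <= 1 -> f t < 0).
Proof.
move=> cf f0; have [p|p] := pselect (forall t, 0 <= t <= 1 -> 0 < f t); first by left.
right => t t01; rewrite ltNge; apply/negP => ft.
move: p => /existsNP[s /not_implyP[s01 /negP]]; rewrite -leNgt => fs.
have key a b : 0 <= a <= 1 -> 0 <= b <= 1 -> a <= b ->
    Num.min (f a) (f b) <= 0 <= Num.max (f a) (f b) -> False.
  move=> /andP[a0 _] /andP[_ b1] ab h.
  have cw : {within `[a, b]%classic, continuous f}.
    apply: continuous_in_subspaceT => x; rewrite inE /= in_itv/= => /andP[ax xb].
    by apply: cf; rewrite (le_trans a0 ax) (le_trans xb b1).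
  have [c] := IVT ab cw h; rewrite in_itv/= => /andP[ac cb] /eqP.
  by apply/negP/f0; rewrite (le_trans a0 ac) (le_trans cb b1).
have [st|/ltW ts] := leP s t.
  by apply: (key s t) => //; rewrite ge_min fs le_max ft orbT.
by apply: (key t s) => //; rewrite ge_min fs le_max ft orbT.
Qed.

Variables (X : topologicalType).

(** The tube lemma, from the compactness of [0,1]. *)
Lemma near_unit_interval (x : X) (P : X -> R -> Prop) :
  (forall t : R, 0 <= t <= 1 -> \forall p \near ((x, t) : X * R), P p.1 p.2) ->
  \forall x' \near x, forall t : R, 0 <= t <= 1 -> P x' t.
Proof.
move=> xP; have := (compact_near_coveringP _).1 (@segment_compact R 0 1).
move=> /(_ X (nbhs x) P _) h.
have : \forall x' \near x, `[0, 1]%classic `<=` P x'.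
  apply: h => t; rewrite /= in_itv/= => /xP [[U V] /= [xU tV] UV].
  by exists (V, U) => //= -[s y] /= [sV yU]; exact: (UV (y, s)).
by apply: filterS => y yP t t01; apply: yP; rewrite /= in_itv.
Qed.

(** Joint continuity along the compact [0,1] makes [g x'] uniformly close to [g x]. The second
    hypothesis gives the integrability of [g x'] for [x'] near [x]. *)
Lemma continuous_Rintegral_unit (x : X) (g : X -> R -> R) :
  (forall t, 0 <= t <= 1 -> {for (x, t), continuous (fun p : X * R => g p.1 p.2)}) ->
  (\forall x' \near x, forall t, 0 <= t <= 1 -> {for t, continuous (g x')}) ->
  {for x, continuous (fun x' => \int[lebesgue_measure]_(t in `[0, 1]) g x' t)}.
Proof.
move=> cg ncg; apply/cvgrPdist_le => e e0.
have near1 : \forall x' \near x, forall t, 0 <= t <= 1 -> `|g x t - g x' t| <= e.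
  apply: near_unit_interval => t t01.
  have /cvgrPdist_le /(_ (e / 2)) := cg t t01; rewrite divr_gt0// => /(_ isT) /= h.
  have h2 : \forall p \near (x, t), `|g x t - g x p.2| <= e / 2.
    case: h => -[U V] /= [xU tV] UV; exists (U, V) => //= -[y s] /= [_ sV].
    by apply: (UV (x, s)); split=> //=; exact: nbhs_singleton.
  apply: filterS2 h h2 => -[y s] /= p q.
  rewrite (_ : g x s - g y s = (g x t - g y s) - (g x t - g x s)); last by ring.
  by rewrite (splitr e) (le_trans (ler_normB _ _))// lerD.
have cgx : forall t, 0 <= t <= 1 -> {for t, continuous (g x)} by exact: (nbhs_singleton ncg).
apply: filterS2 ncg near1 => y cgy xy.
have i1 := unit_interval_integrable cgx; have i2 := unit_interval_integrable cgy.
have cd t : 0 <= t <= 1 -> {for t, continuous (fun t => g x t - g y t)}.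
  by move=> t01; apply: cvgB; [exact: cgx|exact: cgy].
rewrite -RintegralB//; apply: le_trans (le_normr_Rintegral _ _) _ => //.
  exact: unit_interval_integrable.
rewrite -[leRHS]Rintegral_unit_cst; apply: le_Rintegral => //.
- apply: (@unit_interval_integrable (fun t => `|g x t - g y t|)) => t t01.
  by apply: cvg_norm; exact: cd.
- by apply: (@unit_interval_integrable (cst e)) => t _; exact: cst_continuous.
Qed.

End unit_interval_integrals.

Section complex_continuity.
Context {R : realType} {X : topologicalType}.
Implicit Types (f g : X -> R[i]) (x : X).

(** Continuity is stated part by part, as [Cmean] is built from two real integrals. *)
Definition ccontinuous f x : Prop :=
  {for x, continuous (fun x => complex.Re (f x))} /\ {for x, continuous (fun x => complex.Im (f x))}.

Lemma ccontinuousD f g x : ccontinuous f x -> ccontinuous g x -> ccontinuous (fun x => f x + g x) x.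
Proof.
move=> [fr fi] [gr gi]; split.
  rewrite (_ : (fun _ => _) = (fun x => complex.Re (f x) + complex.Re (g x))); first exact: cvgD.
  by apply/funext => y; rewrite cReD.
rewrite (_ : (fun _ => _) = (fun x => complex.Im (f x) + complex.Im (g x))); first exact: cvgD.
by apply/funext => y; rewrite cImD.
Qed.

Lemma continuous_sqnorm f x : ccontinuous f x -> {for x, continuous (fun x => sqnorm (f x))}.
Proof.
move=> [fr fi]; rewrite (_ : (fun _ => _) = (fun x => complex.Re (f x) * complex.Re (f x) +
  complex.Im (f x) * complex.Im (f x))); last by apply/funext => y; rewrite /sqnorm !expr2.
by apply: cvgD; apply: cvgM.
Qed.

Lemma ccontinuousV f x : f x != 0 -> ccontinuous f x -> ccontinuous (fun x => (f x)^-1) x.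
Proof.
move=> f0 cf; have cs := continuous_sqnorm cf; case: cf => fr fi.
have s0 : sqnorm (f x) != 0 by rewrite sqnorm_eq0.
split.
  rewrite (_ : (fun _ => _) = (fun x => complex.Re (f x) / sqnorm (f x))).
    by apply: cvgM => //; exact: cvgV.
  by apply/funext => y; rewrite cReV.
rewrite (_ : (fun _ => _) = (fun x => - complex.Im (f x) / sqnorm (f x))).
  by apply: cvgM; [exact: cvgN|exact: cvgV].
by apply/funext => y; rewrite cImV.
Qed.

Lemma near_cneq0 f x : f x != 0 -> ccontinuous f x -> \forall y \near x, f y != 0.
Proof.
rewrite -sqnorm_gt0 => f0 /continuous_sqnorm cf.
near=> y; rewrite -sqnorm_gt0; near: y; exact: (cvgr_gt _ cf 0 f0).
Unshelve. all: by end_near. Qed.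

End complex_continuity.

Lemma ccontinuous_comp {R : realType} {X Y : topologicalType} (h : X -> Y) (f : Y -> R[i]) x :
  {for x, continuous h} -> ccontinuous f (h x) -> ccontinuous (fun x => f (h x)) x.
Proof.
move=> ch [fr fi]; split.
  exact: (@continuous_comp _ _ _ h (fun y => complex.Re (f y))).
exact: (@continuous_comp _ _ _ h (fun y => complex.Im (f y))).
Qed.

Section continued_fraction_continuity.
Context {R : realType} {N : nat}.

Lemma continuous_rV (T : topologicalType) (f : T -> 'rV[R]_N) x :
  (forall i, {for x, continuous (fun x => f x ord0 i)}) -> {for x, continuous f}.
Proof.
move=> cf A [P MP sPA].
have : \forall y \near x, forall i, P ord0 i (f y ord0 i).
  by apply: filter_forall => i; exact: (cf i _ (MP ord0 i)).
by apply: filterS => y h; apply: sPA => i j; rewrite ord1; exact: h.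
Qed.

Lemma continuous_coord (i : 'I_N) : continuous (fun k : 'rV[R]_N => k ord0 i).
Proof. exact: coord_continuous. Qed.

Lemma continuous_fst (X Y : topologicalType) : continuous (@fst X Y).
Proof. by move=> [x y]; exact: cvg_fst. Qed.

Lemma continuous_snd (X Y : topologicalType) : continuous (@snd X Y).
Proof. by move=> [x y]; exact: cvg_snd. Qed.

(** The spectral parameter travels with the point, because the induction needs continuity jointly in
    both. *)
Definition sweep j (p : (R * 'rV[R]_N) * R) : R * 'rV[R]_N := (p.1.1, set_coord j p.2 p.1.2).

Lemma continuous_sweep j : continuous (sweep j).
Proof.
have c1 : continuous (fun q : (R * 'rV[R]_N) * R => q.1.1).
  by move=> q; apply: (@continuous_comp _ _ _ fst fst); exact: continuous_fst.
have c2 : continuous (fun q : (R * 'rV[R]_N) * R => q.1.2).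
  by move=> q; apply: (@continuous_comp _ _ _ fst snd);
    [exact: continuous_fst|exact: continuous_snd].
have c3 : continuous (fun q : (R * 'rV[R]_N) * R => set_coord j q.2 q.1.2).
  move=> p; apply: continuous_rV => i; rewrite /set_coord.
  have [ij|ij] := eqVneq (val i) j.
    rewrite (_ : (fun _ => _) = snd); first exact: continuous_snd.
    by apply/funext => q; rewrite mxE ij eqxx.
  rewrite (_ : (fun _ => _) = (fun q : (R * 'rV[R]_N) * R => q.1.2 ord0 i)); last first.
    by apply/funext => q; rewrite mxE (negbTE ij).
  apply: (@continuous_comp _ _ _ (fun q : (R * 'rV[R]_N) * R => q.1.2) (fun k => k ord0 i)).
    exact: c2.
  exact: continuous_coord.
by move=> p; exact: (cvg_pair (c1 p) (c3 p)).
Qed.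

Lemma continuous_sweepr j (x : R * 'rV[R]_N) : continuous (fun t => sweep j (x, t)).
Proof.
move=> t; apply: (@continuous_comp _ _ _ (fun t => (x, t)) (sweep j)).
  exact: (cvg_pair (cvg_cst x) cvg_id).
exact: continuous_sweep.
Qed.

Implicit Types (A : nat -> 'rV[R]_N -> R) (x : R * 'rV[R]_N).

Lemma FcE A j (l : R) k : Fc A j l%:C k = (F A j l k)%:C.
Proof.
elim: j k => [|j IH] k /=; first by rewrite rmorphB.
rewrite rmorphD /= fmorphV; congr (_ + _^-1).
have E : (fun k' => (Fc A j l%:C k')^-1) = (fun k' => ((F A j l k')^-1)%:C).
  by apply/funext => k'; rewrite IH fmorphV.
rewrite E /Cmean; apply: complexP => //=.
by rewrite /mean /Rintegral/= integral0.
Qed.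

(* [good A y j l k]: [l + iy] avoids the zero sets of [F_0, ..., F_(j-1)] over the whole fibre of [k]. *)
Fixpoint good A (y : R) j (l : R) k : Prop :=
  if j is j'.+1 then forall t, 0 <= t <= 1 ->
    good A y j' l (set_coord j' t k) /\ Fc A j' (l +i* y) (set_coord j' t k) != 0
  else True.

Definition Fx A y j x : R[i] := Fc A j (x.1 +i* y) x.2.
Definition Qx A y j x : R[i] := Cmean j (fun k => (Fc A j (x.1 +i* y) k)^-1) x.2.

Lemma FxS A y j x : Fx A y j.+1 x = (A j.+1 x.2)%:C + (Qx A y j x)^-1.
Proof. by []. Qed.

Lemma good_sweep A y j x : good A y j.+1 x.1 x.2 <-> forall t, 0 <= t <= 1 ->
  good A y j (sweep j (x, t)).1 (sweep j (x, t)).2 /\ Fx A y j (sweep j (x, t)) != 0.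
Proof. by []. Qed.

(** There is no cancellation in the mean of $1/f$. For nonzero [y] its imaginary part has the sign
    of [y] throughout; for [y = 0] the function is real without zeros, so it has constant sign on
    [0,1] by the intermediate value theorem. *)
Lemma Cmean_neq0 (y : R) (f : R -> R[i]) :
  (forall t, 0 <= t <= 1 -> ccontinuous f t) -> (forall t, 0 <= t <= 1 -> f t != 0) ->
  (y = 0 -> forall t, 0 <= t <= 1 -> complex.Im (f t) = 0) ->
  (y != 0 -> forall t, 0 <= t <= 1 -> y * complex.Im (f t) < 0) ->
  let m := (\int[lebesgue_measure]_(t in `[0, 1]) complex.Re (f t)^-1) +i*
    (\int[lebesgue_measure]_(t in `[0, 1]) complex.Im (f t)^-1) in
  m != 0 /\ (y != 0 -> 0 < y * complex.Im m).
Proof.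
move=> cf f0 fy0 fy m.
have cV t : 0 <= t <= 1 -> ccontinuous (fun t => (f t)^-1) t.
  by move=> t01; apply: ccontinuousV; [exact: f0|exact: cf].
have im_gt0 : y != 0 -> 0 < y * complex.Im m.
  move=> y0; rewrite /m /= -RintegralZl//; last first.
    by apply: (@unit_interval_integrable R (fun t => complex.Im (f t)^-1)) => t /cV[].
  apply: Rintegral_unit_gt0 => t t01.
    by apply: cvgM; [exact: cvg_cst|case: (cV t t01)].
  rewrite cImV mulrA mulrN mulNr oppr_gt0 pmulr_llt0; first exact: fy.
  by rewrite invr_gt0 sqnorm_gt0 f0.
split=> //; have [y0|y0] := eqVneq y 0; last first.
  by apply: contraTneq (im_gt0 y0) => ->; rewrite mulr0 ltxx.
have ReV t : 0 <= t <= 1 -> complex.Re (f t)^-1 != 0.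
  move=> t01; apply: contraNneq (f0 t t01) => h; rewrite -[f t]invrK; apply/eqP.
  rewrite (_ : (f t)^-1 = 0) ?invr0//; apply: complexP; first by rewrite h.
  by rewrite cImV fy0//= oppr0 mul0r.
suff: complex.Re m != 0 by apply: contraNneq => ->.
have [p|p] := constant_sign (f := fun t => complex.Re (f t)^-1) (fun t t01 => (cV t t01).1) ReV.
  by rewrite gt_eqF// Rintegral_unit_gt0// => t /cV[].
rewrite lt_eqF// -oppr_gt0 /m /= -mulN1r -RintegralZl//; last first.
  by apply: (@unit_interval_integrable R (fun t => complex.Re (f t)^-1)) => t /cV[].
apply: Rintegral_unit_gt0 => t t01; last by rewrite mulN1r oppr_gt0 p.
by apply: cvgM; [exact: cvg_cst|case: (cV t t01)].
Qed.

Lemma Im_Fx0 A j x : complex.Im (Fx A 0 j x) = 0.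
Proof. by rewrite /Fx -[_ +i* 0]/(x.1%:C) FcE. Qed.

Section induction_step.
Variables (A : nat -> 'rV[R]_N -> R) (y : R) (j : nat).
Hypothesis IH : forall x, good A y j x.1 x.2 ->
  [/\ \forall x' \near x, good A y j x'.1 x'.2, ccontinuous (Fx A y j) x &
      y != 0 -> y * complex.Im (Fx A y j x) < 0].

Let fibre_continuous x : good A y j.+1 x.1 x.2 -> forall t : R, 0 <= t <= 1 ->
  ccontinuous (fun t => Fx A y j (sweep j (x, t))) t.
Proof.
move=> /good_sweep g t t01; have [gt _] := g t t01; have [_ c _] := IH gt.
apply: (@ccontinuous_comp _ _ _ (fun t => sweep j (x, t)) (Fx A y j)); last exact: c.
exact: continuous_sweepr.
Qed.

Lemma near_goodS x : good A y j.+1 x.1 x.2 -> \forall x' \near x, good A y j.+1 x'.1 x'.2.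
Proof.
move=> /good_sweep g.
have : \forall x' \near x, forall t : R, 0 <= t <= 1 ->
  (good A y j (sweep j (x', t)).1 (sweep j (x', t)).2 /\ Fx A y j (sweep j (x', t)) != 0).
  apply: near_unit_interval => t t01; have [gt F0] := g t t01; have [ng c _] := IH gt.
  have h : \forall p \near sweep j (x, t), good A y j p.1 p.2 /\ Fx A y j p != 0.
    by near=> p; split; near: p; [exact: ng|exact: (near_cneq0 F0 c)].
  have h' : \forall q \near (x, t), good A y j (sweep j q).1 (sweep j q).2 /\
      Fx A y j (sweep j q) != 0 := @continuous_sweep j (x, t) _ h.
  by apply: filterS h' => -[].
by apply: filterS => x' h; apply/good_sweep.
Unshelve. all: by end_near. Qed.

Lemma QxE x : Qx A y j x =
  (\int[lebesgue_measure]_(t in `[0, 1]) complex.Re (Fx A y j (sweep j (x, t)))^-1) +i*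
  (\int[lebesgue_measure]_(t in `[0, 1]) complex.Im (Fx A y j (sweep j (x, t)))^-1).
Proof. by []. Qed.

Lemma Qx_neq0 x : good A y j.+1 x.1 x.2 ->
  Qx A y j x != 0 /\ (y != 0 -> 0 < y * complex.Im (Qx A y j x)).
Proof.
move=> g; rewrite QxE; apply: Cmean_neq0.
- exact: fibre_continuous.
- by move=> t t01; case: (g t t01).
- by move=> y0 t t01; rewrite y0 Im_Fx0.
- by move=> y0 t t01; have [gt _] := g t t01; have [_ _] := IH (x := sweep j (x, t)) gt; apply.
Qed.

Lemma Qx_continuous x : good A y j.+1 x.1 x.2 -> ccontinuous (Qx A y j) x.
Proof.
move=> g.
have cj (x' : R * 'rV[R]_N) t : good A y j.+1 x'.1 x'.2 -> 0 <= t <= 1 ->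
    ccontinuous (fun x => (Fx A y j x)^-1) (sweep j (x', t)).
  by move=> /good_sweep g' t01; have [gt F0] := g' t t01; have [_ c _] := IH gt; exact: ccontinuousV.
have c2 (x' : R * 'rV[R]_N) t : good A y j.+1 x'.1 x'.2 -> 0 <= t <= 1 ->
    ccontinuous (fun t => (Fx A y j (sweep j (x', t)))^-1) t.
  move=> g' t01; apply: (@ccontinuous_comp _ _ _ (fun t => sweep j (x', t)) (fun x => (Fx A y j x)^-1)).
    exact: continuous_sweepr.
  exact: cj.
have c1 t : 0 <= t <= 1 ->
    ccontinuous (fun p : (R * 'rV[R]_N) * R => (Fx A y j (sweep j (p.1, p.2)))^-1) (x, t).
  move=> t01; apply: (@ccontinuous_comp _ _ _ (fun p => sweep j (p.1, p.2)) (fun x => (Fx A y j x)^-1)).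
    rewrite (_ : (fun p => _) = sweep j); first exact: continuous_sweep.
    by apply/funext => -[].
  exact: cj.
have ng := near_goodS g.
split.
  apply: (@continuous_Rintegral_unit R _ x (fun x t => complex.Re (Fx A y j (sweep j (x, t)))^-1)).
    by move=> t /c1[].
  by apply: filterS ng => x' g' t t01; case: (c2 x' t g' t01).
apply: (@continuous_Rintegral_unit R _ x (fun x t => complex.Im (Fx A y j (sweep j (x, t)))^-1)).
  by move=> t /c1[].
by apply: filterS ng => x' g' t t01; case: (c2 x' t g' t01).
Qed.

End induction_step.

(** The sign of the imaginary part is the Nevanlinna property of $-F_j$. The three claims go
    together in the induction, since each step divides by $F_j$ and by the mean of its reciprocal,
    and needs all of them over a whole fibre. *)
Lemma Fx_continuous A y j x : (forall i, (i <= j)%N -> continuous (A i)) -> good A y j x.1 x.2 ->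
  [/\ \forall x' \near x, good A y j x'.1 x'.2, ccontinuous (Fx A y j) x &
      y != 0 -> y * complex.Im (Fx A y j x) < 0].
Proof.
move=> cA; have cA' i : (i <= j)%N -> forall x, ccontinuous (fun x : R * 'rV[R]_N => (A i x.2)%:C) x.
  move=> ij x'; apply: (@ccontinuous_comp _ _ _ snd (fun k => (A i k)%:C)); first exact: continuous_snd.
  by split; [exact: (cA i ij x'.2)|exact: (@cst_continuous _ R 0)].
elim: j x cA' {cA} => [|j IH] x cA g.
  split; first exact: filterT.
    apply: (@ccontinuousD _ _ (fun x => (A 0%N x.2)%:C) (fun x => - (x.1 +i* y))); first exact: cA.
    by split; [apply: cvgN; exact: continuous_fst|exact: (@cst_continuous _ R (- y))].
  by move=> y0; rewrite /Fx /= sub0r mulrN -expr2 oppr_lt0 lt_def sqrf_eq0 y0 sqr_ge0.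
have IH' x' := IH x' (fun i ij => cA i (leqW ij)).
have [Q0 Qi] := Qx_neq0 IH' g.
split; first exact: near_goodS g.
  apply: (@ccontinuousD _ _ (fun x => (A j.+1 x.2)%:C) (fun x => (Qx A y j x)^-1)); first exact: cA.
  by apply: ccontinuousV => //; exact: Qx_continuous.
move=> y0; rewrite FxS cImD cImV /= add0r mulrA mulrN mulNr oppr_lt0 divr_gt0 ?Qi//.
by rewrite sqnorm_gt0.
Qed.

Lemma Qx_good A y j x : (forall i, (i <= j)%N -> continuous (A i)) -> good A y j.+1 x.1 x.2 ->
  Qx A y j x != 0 /\ ccontinuous (Qx A y j) x.
Proof.
move=> cA g; have IH x' := @Fx_continuous A y j x' cA.
by split; [case: (Qx_neq0 IH g)|exact: Qx_continuous].
Qed.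

Lemma good_nonreal A y j x : y != 0 -> (forall i, (i <= j)%N -> continuous (A i)) ->
  good A y j x.1 x.2.
Proof.
move=> y0; elim: j x => [//|j IH] x cA.
apply/good_sweep => t _; have cA' i (ij : (i <= j)%N) := cA i (leqW ij).
have g := IH (sweep j (x, t)) cA'; split=> //.
have [_ _ /(_ y0)] := Fx_continuous cA' g.
by apply: contraTneq => ->; rewrite mulr0 ltxx.
Qed.

End continued_fraction_continuity.

(** * Measurability of continuous functions *)

Section continuous_measurable.
Context {R : realType} {N : nat}.

(* Every open set is a countable union of boxes with rational centres. *)
Lemma open_measurable_rV (O : set 'rV[R]_N) : open O -> measurable O.
Proof.
move=> oO.
pose box (q : 'rV[rat]_N) (m : nat) : set 'rV[R]_N :=
  [set k | forall i, `|k ord0 i - ratr (q ord0 i)| < m.+1%:R^-1].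
have mbox q m : measurable (box q m).
  rewrite (_ : box q m = \bigcap_(i in [set: 'I_N]) (rV_coord i @^-1`
    `]ratr (q ord0 i) - m.+1%:R^-1, ratr (q ord0 i) + m.+1%:R^-1[%classic)).
    apply: fin_bigcap_measurable => [|i _]; first exact: finite_finset.
    by rewrite -[X in measurable X]setTI; exact: measurable_rV_coord.
  apply/seteqP; split => k kn i; have := kn i; rewrite /= in_itv/= ltr_distl//.
  exact.
pose G n : set 'rV[R]_N := if (unpickle n : option ('rV[rat]_N * nat)) is Some (q, m)
  then (if `[< box q m `<=` O >] then box q m else set0) else set0.
have -> : O = \bigcup_n G n.
  apply/seteqP; split => [k Ok|k [n _]]; last first.
    by rewrite /G; case: unpickle => [[q m]|//]; case: ifPn => // /asboolP; exact.
  have /nbhs_ballP[e /= e0 eO] : nbhs k O by exact: open_nbhs_nbhs.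
  (* With $1/(m+1) < e/2$, a box of this radius that contains [k] lies within distance [e] of [k],
     as two radii add up to less than [e]. *)
  pose m := Num.truncn (2 / e).
  have me : m.+1%:R^-1 < e / 2.
    have h : 2 / e < m.+1%:R by rewrite truncnS_gt.
    by rewrite -[e / 2]invf_div ltf_pV2// ?posrE// divr_gt0.
  have m0 : 0 < m.+1%:R^-1 :> R by rewrite invr_gt0.
  have /choice[q qk] : forall i : 'I_N, exists q : rat, `|k ord0 i - ratr q| < m.+1%:R^-1.
    move=> i; have kk : k ord0 i - m.+1%:R^-1 < k ord0 i + m.+1%:R^-1.
      by rewrite ltrBlDr -addrA ltrDl addr_gt0.
    have [q] := rat_in_itvoo kk.
    by rewrite in_itv/= => h; exists q; rewrite distrC ltr_distl.
  exists (pickle (\row_i q i, m)) => //; rewrite /G pickleK.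
  have kb : box (\row_i q i) m k by move=> i; rewrite mxE.
  case: ifPn => // /asboolP []; move=> x bx; apply: eO; split=> // i j.
  rewrite ord1; have := bx j; have := kb j; rewrite /ball/= => p1 p2.
  rewrite (_ : k ord0 j - x ord0 j = (k ord0 j - ratr ((\row_i q i) ord0 j)) -
     (x ord0 j - ratr ((\row_i q i) ord0 j))); last by ring.
  by rewrite (le_lt_trans (ler_normB _ _))// (splitr e) ltrD// (lt_trans _ me).
apply: bigcup_measurable => n _; rewrite /G; case: unpickle => // -[q m].
by case: ifP.
Qed.

Lemma continuous_measurable_rV (f : 'rV[R]_N -> R) : continuous f -> measurable_fun setT f.
Proof.
move=> cf; apply: (measurability _ (RGenOInfty.measurableE R)) => // _ [_ [x ->] <-].
rewrite setTI; apply: open_measurable_rV.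
by apply: open_comp; [move=> k _; exact: cf|exact: interval_open].
Qed.

End continuous_measurable.

(** * Retraction onto a box *)

Section clamp.
Context {R : realType} {N : nat}.
Implicit Types (a b : 'I_N -> R) (A : nat -> 'rV[R]_N -> R) (k : 'rV[R]_N).

(** If the box has the full side [0,1] in the coordinates below [j], clamping commutes with the
    averages in those coordinates, and therefore with the formation of $F_j$. *)
Definition clamp a b k : 'rV[R]_N := \row_i Num.max (a i) (Num.min (b i) (k ord0 i)).

Definition inbox a b k : Prop := forall i, a i <= k ord0 i <= b i.

Lemma clamp_id a b k : inbox a b k -> clamp a b k = k.
Proof.
by move=> kb; apply/rowP => i; rewrite mxE; have /andP[p q] := kb i; rewrite min_r// max_r.
Qed.

Lemma clamp_inbox a b k : (forall i, a i <= b i) -> inbox a b (clamp a b k).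
Proof. by move=> ab i; rewrite mxE le_max lexx/= ge_max ab ge_min lexx. Qed.

Lemma clampK a b k : (forall i, a i <= b i) -> clamp a b (clamp a b k) = clamp a b k.
Proof. by move=> ab; exact/clamp_id/clamp_inbox. Qed.

Lemma continuous_clamp a b : continuous (clamp a b).
Proof.
move=> k; apply: continuous_rV => i; rewrite /clamp.
rewrite (_ : (fun _ => _) = (fun k : 'rV[R]_N => Num.max (a i) (Num.min (b i) (k ord0 i)))); last first.
  by apply/funext => x; rewrite mxE.
apply: (@continuous_max _ _ (cst (a i)) (fun k : 'rV[R]_N => Num.min (b i) (k ord0 i))).
  exact: cst_continuous.
apply: (@continuous_min _ _ (cst (b i)) (fun k : 'rV[R]_N => k ord0 i)).
  exact: cst_continuous.
exact: continuous_coord.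
Qed.

Lemma clamp_set_coord a b j t k : (forall i : 'I_N, val i = j -> a i = 0 /\ b i = 1) ->
  0 <= t <= 1 -> set_coord j t (clamp a b k) = clamp a b (set_coord j t k).
Proof.
move=> ab /andP[t0 t1]; apply/rowP => i; rewrite !mxE; case: eqP => // /ab[-> ->].
by rewrite min_r// max_r.
Qed.

Lemma eq_Cmean j (u v : 'rV[R]_N -> R[i]) k k' :
  (forall t, 0 <= t <= 1 -> u (set_coord j t k) = v (set_coord j t k')) ->
  Cmean j u k = Cmean j v k'.
Proof.
move=> uv; rewrite /Cmean; congr (_ +i* _); apply: eq_Rintegral => t.
  by rewrite inE/= in_itv/= => /uv ->.
by rewrite inE/= in_itv/= => /uv ->.
Qed.

Definition clamped a b A j k : R := A j (clamp a b k).

Lemma Fc_clamped a b A j z k : (forall i : 'I_N, (i < j)%N -> a i = 0 /\ b i = 1) ->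
  Fc (clamped a b A) j z k = Fc A j z (clamp a b k).
Proof.
elim: j k => [//|j IH] k ab /=; congr (_ + _^-1); apply: eq_Cmean => t t01.
rewrite IH; last by move=> i ij; exact/ab/ltnW.
by rewrite clamp_set_coord// => i ij; apply: ab; rewrite ij.
Qed.

Lemma good_clamped a b A y j l k : (forall i : 'I_N, (i < j)%N -> a i = 0 /\ b i = 1) ->
  good (clamped a b A) y j l k <-> good A y j l (clamp a b k).
Proof.
elim: j k => [//|j IH] k ab /=.
have ab' (i : 'I_N) : (i < j)%N -> a i = 0 /\ b i = 1 by move=> ij; exact/ab/ltnW.
have cE t : 0 <= t <= 1 -> set_coord j t (clamp a b k) = clamp a b (set_coord j t k).
  by move=> t01; apply: clamp_set_coord => // i ij; apply: ab; rewrite ij.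
split=> g t t01; have [g1 g2] := g t t01.
  by rewrite cE// -Fc_clamped//; split=> //; apply/(IH _ ab').
by move: g1 g2; rewrite cE// -Fc_clamped// => g1 g2; split=> //; apply/(IH _ ab').
Qed.

Lemma bounded_of_clamp a b (f : 'rV[R]_N -> R) : (forall i, a i <= b i) -> continuous f ->
  (forall k, f (clamp a b k) = f k) -> exists C, forall k, `|f k| <= C.
Proof.
move=> ab cf fc; pose D := [set k : 'rV[R]_N | forall i, `[a i, b i]%classic (k ord0 i)].
have cD : compact D.
  by apply: (@rV_compact R N (fun i => `[a i, b i]%classic)) => i; exact: segment_compact.
have DE k : D (clamp a b k) by move=> i; rewrite /= in_itv/=; exact: clamp_inbox.
have ca : {within D, continuous (fun k => - `|f k|)}.
  by apply: continuous_subspaceT => k; exact: (cvgN (cvg_norm (cf k))).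
have [] := EVT_min_rV _ cD ca; first by exists (clamp a b 0); exact: DE.
move=> c _ h; exists `|f c| => k; rewrite -fc -lerN2; apply: h.
by rewrite inE; exact: DE.
Qed.

Lemma cbounded_of_clamp a b (f : 'rV[R]_N -> R[i]) : (forall i, a i <= b i) ->
  (forall k, ccontinuous f k) -> (forall k, f (clamp a b k) = f k) -> cbounded f.
Proof.
move=> ab cf fc.
have cr : continuous (fun k => complex.Re (f k)) by move=> k; case: (cf k).
have ci : continuous (fun k => complex.Im (f k)) by move=> k; case: (cf k).
have [C hC] := bounded_of_clamp ab cr (fun k => congr1 _ (fc k)).
have [D hD] := bounded_of_clamp ab ci (fun k => congr1 _ (fc k)).
split; first by split; exact: continuous_measurable_rV.
by exists (Num.max C D) => k; rewrite !le_max hC hD orbT.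
Qed.

Lemma ccontinuous_slice (f : R * 'rV[R]_N -> R[i]) l k : ccontinuous f (l, k) ->
  ccontinuous (fun k => f (l, k)) k.
Proof.
have c : continuous (fun k : 'rV[R]_N => (l, k)).
  move=> x; have h1 : (fun _ : 'rV[R]_N => l) @ x --> l by exact: cst_continuous.
  have h2 : (fun k : 'rV[R]_N => k) @ x --> x by exact: cvg_id.
  exact: (cvg_pair h1 h2).
exact: (ccontinuous_comp (c k)).
Qed.

Variables (a b : 'I_N -> R) (A : nat -> 'rV[R]_N -> R) (y l : R) (J : nat).
Hypothesis ab : forall i, a i <= b i.
Hypothesis ab01 : forall i : 'I_N, (i < J)%N -> a i = 0 /\ b i = 1.
Hypothesis cA : forall i, (i <= J)%N -> continuous (A i).
Hypothesis Aclamp : forall i k, A i (clamp a b k) = A i k.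
Hypothesis Agood : forall j k, (j <= J)%N -> good A y j l k.
Hypothesis AF : forall j k, (j < J)%N -> Fc A j (l +i* y) k != 0.

Let Fclamp j k : (j <= J)%N -> Fc A j (l +i* y) (clamp a b k) = Fc A j (l +i* y) k.
Proof.
move=> jJ; rewrite -Fc_clamped; last by move=> i ij; apply: ab01; exact: leq_trans jJ.
congr (Fc _ _ _ _); apply/funext => i; apply/funext => x; exact: Aclamp.
Qed.

Lemma cbounded_Fc_inv j : (j <= J)%N -> (forall k, Fc A j (l +i* y) k != 0) ->
  cbounded (fun k => (Fc A j (l +i* y) k)^-1).
Proof.
move=> jJ F0; apply: cbounded_of_clamp ab _ _ => k; last by rewrite Fclamp.
apply: ccontinuousV => //; apply: (ccontinuous_slice (f := Fx A y j)).
have cA' i (ij : (i <= j)%N) := cA (leq_trans ij jJ).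
by have [] := @Fx_continuous R N A y j (l, k) cA' (Agood k jJ).
Qed.

(** Clamped functions take only their values on a compact box, where a continuous function without
    zeros has a bounded reciprocal. That the means of the reciprocals do not vanish either is
    [Qx_good]. *)
Lemma invertible_good : invertible_below A (l +i* y) J.
Proof.
move=> j jJ; have cA' i (ij : (i <= j)%N) := cA (leq_trans ij (ltnW jJ)).
have Q k := @Qx_good R N A y j (l, k) cA' (Agood k jJ).
have F0 k := AF k jJ.
split=> //; first exact: cbounded_Fc_inv (ltnW jJ) F0.
  by move=> k; case: (Q k).
apply: cbounded_of_clamp ab _ _ => k.
  have [Q0 Qc] := Q k.
  exact: (ccontinuousV (f := fun k => Qx A y j (l, k)) Q0 (ccontinuous_slice Qc)).
congr (_^-1); apply: eq_Cmean => t t01; congr (_^-1).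
rewrite clamp_set_coord//; last by move=> i ij; apply: ab01; rewrite ij.
exact: (Fclamp _ (ltnW jJ)).
Qed.

End clamp.

Lemma good_pred {R : realType} {N : nat} (A : nat -> 'rV[R]_N -> R) y j l (k : 'rV[R]_N) :
  (forall i : 'I_N, val i = j -> 0 <= k ord0 i <= 1) -> good A y j.+1 l k ->
  good A y j l k /\ Fc A j (l +i* y) k != 0.
Proof.
move=> k01 g; have [jN|jN] := ltnP j N.
  have := g _ (k01 (Ordinal jN) erefl).
  rewrite (_ : set_coord _ _ _ = k)//; apply/rowP => i; rewrite mxE; case: eqP => // ij.
  by congr (k _ _); exact: val_inj.
(* For [j >= N] there is no coordinate to replace: [set_coord j] is the identity and any [t] in
   [0,1] will do. *)
have := g 0; rewrite lexx ler01 => /(_ isT).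
rewrite (_ : set_coord _ _ _ = k)//; apply/rowP => i; rewrite mxE; case: eqP => // ij.
by move: (ltn_ord i); rewrite ij ltnNge jN.
Qed.

(** * Monotonicity in the spectral parameter *)

Section real_branches.
Context {R : realType} {N : nat}.
Implicit Types (A B : nat -> 'rV[R]_N -> R) (k : 'rV[R]_N) (l m : R).

Lemma Fc_neq0 A j l k : (Fc A j (l +i* 0) k != 0) = (F A j l k != 0).
Proof.
rewrite -[l +i* 0]/(l%:C) FcE; congr negb; apply/eqP/eqP => [/(congr1 (@complex.Re R))//|-> //].
Qed.

Lemma goodS A j l k : good A 0 j.+1 l k <-> forall t, 0 <= t <= 1 ->
  good A 0 j l (set_coord j t k) /\ F A j l (set_coord j t k) != 0.
Proof.
split=> g t t01; have [g1 g2] := g t t01; split=> //; first by rewrite -Fc_neq0.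
by rewrite Fc_neq0.
Qed.

Lemma F_gtail A j l : (forall i, (i <= j)%N -> gtail i (A i)) -> gtail j (F A j l).
Proof.
move=> At k k' kk'; have := @Fc_gtail R N A j l%:C At k k' kk'; rewrite !FcE.
by move=> /(congr1 (@complex.Re R)).
Qed.

Lemma set_coord_tail j t k k' : (forall i : 'I_N, (j.+1 <= i)%N -> k ord0 i = k' ord0 i) ->
  forall i : 'I_N, (j <= i)%N -> set_coord j t k ord0 i = set_coord j t k' ord0 i.
Proof.
move=> kk' i ji; rewrite !mxE; case: eqP => // /eqP ij.
by apply: kk'; rewrite ltn_neqAle eq_sym ij.
Qed.

Lemma good_gtail A j l k k' : (forall i, (i <= j)%N -> gtail i (A i)) ->
  (forall i : 'I_N, (j <= i)%N -> k ord0 i = k' ord0 i) ->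
  good A 0 j l k -> good A 0 j l k'.
Proof.
elim: j k k' => [//|j IH] k k' At kk' g; apply/goodS => t t01.
have At' i (ij : (i <= j)%N) := At i (leqW ij).
have e := set_coord_tail t kk'; have [g1 g2] := (goodS _ _ _ _).1 g t t01; split.
  by apply: IH g1.
by rewrite -(F_gtail _ At' e).
Qed.

Lemma set_coord_cube j t k : 0 <= t <= 1 -> cube N k -> cube N (set_coord j t k).
Proof. by move=> t01 ck i; rewrite mxE; case: ifP. Qed.

Lemma F_ext A B j l k : (forall i k, (i <= j)%N -> cube N k -> A i k = B i k) ->
  cube N k -> F A j l k = F B j l k.
Proof.
elim: j k => [|j IH] k AB ck /=; first by rewrite AB.
rewrite AB//; congr (_ + _^-1); apply: eq_Rintegral => t; rewrite inE/= in_itv/= => t01.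
by rewrite IH//; [move=> i k' ij; exact/AB/leqW|exact: set_coord_cube].
Qed.

Lemma branch_ext A B j k : (forall i k, (i <= j)%N -> cube N k -> A i k = B i k) ->
  cube N k -> branch A j k = branch B j k.
Proof.
elim/ltn_ind: j k => -[|j] IH k AB ck; first by rewrite !branch0 AB.
rewrite !branchS; apply/seteqP.
have sw : swept (branch A) j.+1 k = swept (branch B) j.+1 k.
  apply: eq_bigcupr => r /= rj; apply: eq_bigcupr => k' [ck' _].
  by apply: IH => // i x ir; apply: AB; rewrite (leq_trans ir)// ltnW.
by rewrite sw; split => l [F0 sl]; split; rewrite -?F0//; [apply/esym|]; exact: F_ext.
Qed.

(** Trades the nested unions over fibres for [good], which replaces one coordinate at a time and is
    an open condition for continuous components. A failure of [good] leads to a lowest level at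
    which some $F_r$ vanishes, and this zero belongs to the branch of index [r]. *)
Lemma swept_branch A j l k : (j <= N)%N -> (forall i, (i <= j)%N -> gtail i (A i)) -> cube N k ->
  (swept (branch A) j k l <-> ~ good A 0 j l k) /\
  (branch A j k l <-> good A 0 j l k /\ F A j l k = 0).
Proof.
move=> jN At ck.
suff sw : forall k, cube N k -> swept (branch A) j k l <-> ~ good A 0 j l k.
  split; first exact: sw.
  case: j jN At sw => [|j] jN At sw.
    rewrite branch0 /=; split => [->|[_ /eqP]]; first by rewrite subrr.
    by rewrite subr_eq0 => /eqP.
  rewrite branchS; split=> [[F0 nsw]|[g F0]].
    by split=> //; apply: contrapT => /(sw _ ck).
  by split=> // /(sw _ ck).
elim: j jN At {k ck} => [|j IH] jN At k ck; first by split=> [[r]//|[]].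
have At' i (ij : (i <= j)%N) := At i (leqW ij).
have br k' : cube N k' -> branch A j k' l <-> good A 0 j l k' /\ F A j l k' = 0.
  move=> ck'; case: j IH At At' jN => [|j] IH At At' jN.
    rewrite branch0 /=; split => [->|[_ /eqP]]; first by rewrite subrr.
    by rewrite subr_eq0 => /eqP.
  rewrite branchS; split=> [[F0 nsw]|[g F0]].
    by split=> //; apply: contrapT => /(IH (ltnW jN) At' _ ck').
  by split=> // /(IH (ltnW jN) At' _ ck').
split.
  move=> [r /= rj [k' [ck' kk'] brl]] /goodS g.
  have k'01 : 0 <= k' ord0 (Ordinal jN) <= 1 by exact: ck'.
  have [g1 F0] := g _ k'01.
  (* [k'] and [k] share the coordinates after [j]; once the coordinate [j] is copied too, they share
     all those on which level [j] depends. *)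
  have e (i : 'I_N) : (j <= i)%N -> set_coord j (k' ord0 (Ordinal jN)) k ord0 i = k' ord0 i.
    move=> ji; rewrite mxE; case: eqP => [ij|/eqP ij]; first by congr (k' _ _); exact: val_inj.
    by rewrite kk'// ltn_neqAle eq_sym ij.
  have g1' := good_gtail At' e g1.
  have F0' : F A j l k' != 0 by rewrite -(F_gtail _ At' e).
  move: rj; rewrite ltnS leq_eqVlt => /predU1P[rj|rj].
    by rewrite rj in brl; have [_ /eqP] := (br _ ck').1 brl; rewrite (negbTE F0').
  by apply: (IH (ltnW jN) At' _ ck').1 g1'; exists r => //; exists k'.
move=> /goodS /existsNP[t /not_implyP[t01 h]].
have ck' := set_coord_cube j t01 ck; set k' := set_coord j t k in h ck'.
have fk' : fiber j.+1 k k'.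
  split=> // i ji; rewrite mxE; case: eqP => // ij; by rewrite ij ltnn in ji.
have [g|ng] := pselect (good A 0 j l k').
  exists j => //=; exists k' => //; apply/(br _ ck'); split=> //.
  by apply/eqP; rewrite -[_ == _]negbK; apply/negP => F0; apply: h.
have [r /= rj [k'' [ck'' kk''] b]] := (IH (ltnW jN) At' _ ck').2 ng.
exists r => /=; first exact: ltnW.
exists k'' => //; split=> // i ji; rewrite kk''; last exact: ltnW.
by case: fk' => _; exact.
Qed.

Variable J : nat.
Variable A : nat -> 'rV[R]_N -> R.
Hypothesis cA : forall i, (i <= J)%N -> continuous (A i).

Let cA' j : (j <= J)%N -> forall i, (i <= j)%N -> continuous (A i).
Proof. by move=> jJ i ij; apply: cA; exact: leq_trans jJ. Qed.

Lemma F_continuous j l k : (j <= J)%N -> good A 0 j l k ->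
  {for (l, k), continuous (fun x : R * 'rV[R]_N => F A j x.1 x.2)}.
Proof.
move=> jJ g; have [_ [c _] _] := @Fx_continuous R N A 0 j (l, k) (cA' jJ) g.
have -> // : (fun x : R * 'rV[R]_N => F A j x.1 x.2) = (fun x => complex.Re (Fx A 0 j x)).
by apply/funext => x; rewrite /Fx -[x.1 +i* 0]/(x.1%:C) FcE.
Qed.

Lemma near_good j l k : (j <= J)%N -> good A 0 j l k ->
  \forall x \near ((l, k) : R * 'rV[R]_N), good A 0 j x.1 x.2.
Proof. by move=> jJ g; have [] := @Fx_continuous R N A 0 j (l, k) (cA' jJ) g. Qed.

Lemma F_fibre_continuous j l k t : (j < J)%N -> good A 0 j.+1 l k -> 0 <= t <= 1 ->
  {for t, continuous (fun t => F A j l (set_coord j t k))}.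
Proof.
move=> jJ /goodS g t01; have [g1 _] := g t t01.
apply: (@continuous_comp _ _ _ (fun t => sweep j ((l, k), t)) (fun x => F A j x.1 x.2)).
  exact: continuous_sweepr.
exact: (F_continuous (ltnW jJ) g1).
Qed.

Lemma F_fibre_continuousV j l k t : (j < J)%N -> good A 0 j.+1 l k -> 0 <= t <= 1 ->
  {for t, continuous (fun t => (F A j l (set_coord j t k))^-1)}.
Proof.
move=> jJ g t01; apply: cvgV; last exact: F_fibre_continuous.
by have [] := (goodS _ _ _ _).1 g t t01.
Qed.

Lemma mean_inv_gt0 j l k (s : R) : (j < J)%N -> good A 0 j.+1 l k ->
  (forall t, 0 <= t <= 1 -> 0 < s * F A j l (set_coord j t k)) ->
  0 < s * mean j (fun k => (F A j l k)^-1) k.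
Proof.
move=> jJ g sF; have c t t01 := F_fibre_continuousV (t := t) jJ g t01.
rewrite -RintegralZl//; last exact: (unit_interval_integrable c).
apply: Rintegral_unit_gt0 => t t01; first by apply: cvgM; [exact: cvg_cst|exact: c].
have := sF t t01; have [s0|s0|->] := ltgtP s 0; last by rewrite !mul0r.
  by rewrite !nmulr_rgt0// invr_lt0.
by rewrite !pmulr_rgt0// invr_gt0.
Qed.

Lemma F_fibre_sign j l k : (j < J)%N -> good A 0 j.+1 l k ->
  (forall t, 0 <= t <= 1 -> 0 < F A j l (set_coord j t k)) \/
  (forall t, 0 <= t <= 1 -> F A j l (set_coord j t k) < 0).
Proof.
move=> jJ g; apply: constant_sign => t t01; first exact: F_fibre_continuous.
by have [] := (goodS _ _ _ _).1 g t t01.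
Qed.

(** Taking reciprocals twice around a mean preserves the order as long as both functions have the
    same sign on the fibre. Opposite signs occur when lower branches separate [l] from [m]; then the
    positive value is at [l], and the reciprocals of the means are ordered by their signs. *)
Lemma F_decreasing j l m k : (j <= J)%N -> l < m -> good A 0 j l k -> good A 0 j m k ->
  F A j m k < F A j l k.
Proof.
elim: j k => [|j IH] k jJ lm gl gm /=; first by rewrite ltrD2l ltrN2.
rewrite ltrD2l.
set f := fun t => F A j l (set_coord j t k); set g := fun t => F A j m (set_coord j t k).
have gf t : 0 <= t <= 1 -> g t < f t.
  move=> t01; apply: IH => //; first exact: ltnW.
    by have [] := (goodS _ _ _ _).1 gl t t01.
  by have [] := (goodS _ _ _ _).1 gm t t01.
have cf t t01 := F_fibre_continuousV (t := t) jJ gl t01.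
have cg t t01 := F_fibre_continuousV (t := t) jJ gm t01.
have f0 t (t01 : 0 <= t <= 1) : f t != 0 by have [] := (goodS _ _ _ _).1 gl t t01.
have g0 t (t01 : 0 <= t <= 1) : g t != 0 by have [] := (goodS _ _ _ _).1 gm t t01.
have h01 : 0 <= (0 : R) <= 1 by rewrite lexx ler01.
have [fp|fn] := F_fibre_sign jJ gl; have [gp|gn] := F_fibre_sign jJ gm.
- have mf : 0 < mean j (fun k => (F A j l k)^-1) k.
    by rewrite -[ltRHS]mul1r mean_inv_gt0// => t t01; rewrite mul1r fp.
  have mg : 0 < mean j (fun k => (F A j m k)^-1) k.
    by rewrite -[ltRHS]mul1r mean_inv_gt0// => t t01; rewrite mul1r gp.
  rewrite ltf_pV2//; apply: Rintegral_unit_lt => // t t01.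
  by rewrite ltf_pV2 ?posrE ?fp ?gp//; exact: gf.
- have mf : 0 < mean j (fun k => (F A j l k)^-1) k.
    by rewrite -[ltRHS]mul1r mean_inv_gt0// => t t01; rewrite mul1r fp.
  have mg : 0 < -1 * mean j (fun k => (F A j m k)^-1) k.
    by rewrite mean_inv_gt0// => t t01; rewrite mulN1r oppr_gt0 gn.
  by apply: (@lt_trans _ _ 0); rewrite ?invr_gt0// invr_lt0 -oppr_gt0 -mulN1r.
(* A negative value at [l] and a positive one at [m] would contradict the monotonicity at level
   [j]. *)
- by have := lt_trans (gp 0 h01) (lt_trans (gf 0 h01) (fn 0 h01)); rewrite ltxx.
- have mf : mean j (fun k => (F A j l k)^-1) k < 0.
    by rewrite -oppr_gt0 -mulN1r mean_inv_gt0// => t t01; rewrite mulN1r oppr_gt0 fn.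
  have mg : mean j (fun k => (F A j m k)^-1) k < 0.
    by rewrite -oppr_gt0 -mulN1r mean_inv_gt0// => t t01; rewrite mulN1r oppr_gt0 gn.
  rewrite ltf_nV2//; apply: Rintegral_unit_lt => // t t01.
  by rewrite ltf_nV2 ?negrE ?fn ?gn//; exact: gf.
Qed.

Lemma F_zero_uniq j l m k : (j <= J)%N -> good A 0 j l k -> F A j l k = 0 ->
  good A 0 j m k -> F A j m k = 0 -> l = m.
Proof.
move=> jJ gl Fl gm Fm; have [lm|ml|//] := ltgtP l m.
  by have := F_decreasing jJ lm gl gm; rewrite Fl Fm ltxx.
by have := F_decreasing jJ ml gm gl; rewrite Fl Fm ltxx.
Qed.

(* Lower hemicontinuity of the zero: [F] changes sign between [l - d] and [l + d]. *)
Lemma near_zero j l k (e : R) : (j <= J)%N -> good A 0 j l k -> F A j l k = 0 -> 0 < e ->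
  \forall k' \near k, exists m, [/\ `|m - l| < e, good A 0 j m k' & F A j m k' = 0].
Proof.
move=> jJ g F0 e0; have [[U V] /= [lU kV] UV] := near_good jJ g.
have /nbhs_ballP[d0 /= d00 dU] := lU.
pose d := Num.min (d0 / 2) (e / 2).
have dpos : 0 < d by rewrite lt_min !divr_gt0.
have dd0 : d < d0 by rewrite gt_min; apply/orP; left; lra.
have de : d < e by rewrite gt_min; apply/orP; right; lra.
have dg m k' : `|m - l| <= d -> V k' -> good A 0 j m k'.
  move=> md Vk'; apply: (UV (m, k')); split=> //; apply: dU.
  by rewrite /ball/= distrC (le_lt_trans md).
have Vk := nbhs_singleton kV.
have gm : good A 0 j (l - d) k by apply: dg => //; rewrite addrAC subrr sub0r normrN gtr0_norm.
have gp : good A 0 j (l + d) k by apply: dg => //; rewrite addrAC subrr add0r gtr0_norm.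
have sl m : good A 0 j m k -> {for k, continuous (fun k => F A j m k)}.
  move=> gm'; have h1 : (fun _ : 'rV[R]_N => m) @ k --> m by exact: cst_continuous.
  have h2 : (fun k : 'rV[R]_N => k) @ k --> k by exact: cvg_id.
  apply: (@continuous_comp _ _ _ (fun k : 'rV[R]_N => (m, k)) (fun x => F A j x.1 x.2)).
    exact: (cvg_pair h1 h2).
  exact: (F_continuous jJ gm').
have Fm : 0 < F A j (l - d) k by rewrite -F0 F_decreasing// gtrBl.
have Fp : F A j (l + d) k < 0 by rewrite -F0 F_decreasing// ltrDl.
near=> k'.
have Vk' : V k' by near: k'.
have Fm' : 0 < F A j (l - d) k' by near: k'; exact: (cvgr_gt _ (sl _ gm) _ Fm).
have Fp' : F A j (l + d) k' < 0 by near: k'; exact: (cvgr_lt _ (sl _ gp) _ Fp).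
have cw : {within `[l - d, l + d]%classic, continuous (fun m => F A j m k')}.
  apply: continuous_in_subspaceT => m; rewrite inE /= in_itv/= => mi.
  have h1 : (fun m : R => m) @ m --> m by exact: cvg_id.
  have h2 : (fun _ : R => k') @ m --> k' by exact: cst_continuous.
  have gm' : good A 0 j m k' by apply: dg => //; rewrite ler_distl.
  apply: (@continuous_comp _ _ _ (fun m : R => (m, k')) (fun x => F A j x.1 x.2)).
    exact: (cvg_pair h1 h2).
  exact: (F_continuous jJ gm').
have [] := IVT (_ : l - d <= l + d) cw (v := 0); first by rewrite lerD2l ge0_cp// ltW.
  by rewrite ge_min (ltW Fp') orbT le_max (ltW Fm').
move=> m; rewrite in_itv/= => mi Fm0; have md : `|m - l| <= d by rewrite ler_distl.
by exists m; split=> //; [exact: le_lt_trans de|exact: dg].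
Unshelve. all: by end_near. Qed.

End real_branches.

(** * Counting the intervals of the spectrum *)

Section alternations.
Context {R : realType}.
Implicit Types (E : set R) (x y : R).

(* [alt E n x]: there are [x = x_0 < y_1 < x_1 < ... < y_n < x_n] with every [x_i] in [E] and no [y_i] in [E]. *)
Fixpoint alt E n x : Prop :=
  if n is m.+1 then E x /\ exists y z, [/\ x < y, y < z, ~ E y & alt E m z] else E x.

Lemma alt_head E n x : alt E n x -> E x.
Proof. by case: n => [|n] //= []. Qed.

Lemma alt_mono E E' n x : E `<=` E' -> (forall w, x <= w -> E' w -> E w) -> alt E' n x -> alt E n x.
Proof.
move=> EE'; elim: n x => [|n IH] x h /=; first exact: h.
move=> [Ex [y [z [xy yz nEy ez]]]]; split; first exact: h.
exists y, z; split=> //; first by move=> /EE'.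
by apply: IH ez => w zw; apply: h; rewrite (le_trans _ zw)// ltW// (lt_trans xy).
Qed.

(** Deleting one point costs at most one alternation: if it is the head, the chain starts at the
    next point and is otherwise untouched; if not, the head is kept and the rest shortened. *)
Lemma alt_remove E E' n x : E `<=` E' -> is_subset1 (E' `\` E) -> alt E' n.+1 x ->
  exists2 x', x <= x' & alt E n x'.
Proof.
move=> EE' E1; elim: n x => [|n IH] x.
  move=> [Ex [y [z [xy yz nEy Ez]]]]; have xz := lt_trans xy yz.
  have [Ex'|nEx] := pselect (E x); first by exists x.
  exists z; first exact: ltW.
  apply: contrapT => nEz; move: xz; rewrite (E1 x z) ?ltxx//.
move=> [Ex [y [z [xy yz nEy az]]]]; have xz := lt_trans xy yz.
have [Ex'|nEx] := pselect (E x).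
  have [z' zz' az'] := IH z az; exists x => //; split=> //; exists y, z'; split=> //.
    exact: lt_le_trans zz'.
  by move=> /EE'.
exists z; first exact: ltW.
apply: (@alt_mono E E' n.+1 z EE' _ az) => w zw E'w; apply: contrapT => nEw.
by have := lt_le_trans xz zw; rewrite (E1 x w) ?ltxx.
Qed.

Lemma alt_above E n y x : y < x -> alt (E `&` [set w | y < w]) n x -> alt E n x.
Proof.
elim: n x => [|n IH] x yx /=; first by case.
move=> [[Ex _] [u [z [xu uz nEu az]]]]; split=> //; exists u, z; split=> //.
  by move=> Eu; apply: nEu; split=> //=; exact: lt_trans xu.
by apply: IH az; exact: lt_trans (lt_trans yx xu) uz.
Qed.

(** A longest chain is cut at its first outside point [y]: to the left of [y] no further gap is
    possible, and to the right one alternation fewer is available. Shorter maximal chains are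
    handled by padding with empty intervals. *)
Lemma alt_intervals E n : (forall x, ~ alt E n x) ->
  exists I : nat -> set R, (forall r, (r < n)%N -> is_interval (I r)) /\ E = \bigcup_(r in `I_n) I r.
Proof.
elim: n E => [|n IH] E nalt.
  exists (fun=> set0); split=> //; apply/seteqP; split=> [x Ex|x []//].
  by case: (nalt x).
have gap (E' : set R) : ~ is_interval E' -> exists a b c, [/\ E' a, E' b, ~ E' c, a < c & c < b].
  move=> /existsNP[a /existsNP[b /not_implyP[Ea /not_implyP[Eb /existsNP[c /not_implyP[/andP[ac cb] nEc]]]]]].
  exists a, b, c; split=> //; rewrite lt_neqAle ?ac ?cb andbT; apply/eqP => e; apply: nEc.
    by rewrite -e.
  by rewrite e.
case: n IH nalt => [|n] IH nalt.
  exists (fun=> E); split; last by rewrite II1 bigcup_set1.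
  move=> r _; apply: contrapT => /gap[a [b [c [Ea Eb nEc ac cb]]]].
  by apply: (nalt a); split=> //; exists c, b.
have [nalt'|] := pselect (forall x, ~ alt E n.+1 x).
  have [I [iI EI]] := IH E nalt'.
  exists (fun r => if (r < n.+1)%N then I r else set0); split.
    by move=> r _; case: ifP => [/iI//|_ a b []].
  rewrite EI; apply/seteqP; split=> [w [r /= rn Iw]|w [r /= _]].
    by exists r => /=; [exact: ltnW|rewrite rn].
  by case: ifP => // rn Iw; exists r.
move=> /existsNP[x /contrapT [Ex [y [z [xy yz nEy az]]]]].
have [I [iI EI]] : exists I : nat -> set R, (forall r, (r < n.+1)%N -> is_interval (I r)) /\
    E `&` [set w | y < w] = \bigcup_(r in `I_n.+1) I r.
  apply: IH => w aw; have [_ /= yw] := alt_head aw.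
  apply: (nalt x); split=> //; exists y, w; split=> //; exact: alt_above aw.
(* A gap of [E] below [y] could be put in front of the chain starting at [z] and would make it too
   long. *)
exists (fun r => if r is r'.+1 then I r' else E `&` [set w | w < y]); split.
  move=> [_|r]; last by rewrite ltnS; exact: iI.
  apply: contrapT => /gap[a [b [c [[Ea _] [Eb /= yb] nEc ac cb]]]].
  apply: (nalt a); split=> //; exists c, b; split=> //.
    by move=> Ec; apply: nEc; split=> //=; exact: lt_trans yb.
  by split=> //; exists y, z.
apply/seteqP; split=> [w Ew|w [[|r] /= rn]]; last 2 first.
- by case.
- move=> Iw; have : (E `&` [set w | y < w]) w by rewrite EI; exists r.
  by case.
have [wy|yw|wy] := ltgtP w y; first by exists 0%N.
- have [r rn Iw] : (\bigcup_(r in `I_n.+1) I r) w by rewrite -EI.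
  by exists r.+1.
- by rewrite wy in Ew.
Qed.

End alternations.

(** * Spectra of the fibres under motion of the fibre *)

Section spectral_bands.
Context {R : realType} {N : nat}.
Variables (J : nat) (A : nat -> 'rV[R]_N -> R) (C : R).
Hypothesis cA : forall i, (i <= J)%N -> continuous (A i).
Hypothesis bA : forall i k, (i <= J)%N -> `|A i k| <= C.

(* The spectrum of [A_0 + A_1 <.>_1 + ... + A_j <.>_(1,j)] on the fibre of [k]. *)
Definition spec j (k : 'rV[R]_N) : set R := [set l | ~ (good A 0 j l k /\ F A j l k != 0)].

(** The sign [s] treats both ends of the real line at once. The mean of reciprocals preserves a
    lower bound for the reciprocal of that mean, while each of the [j.+1] components costs at most
    [C]. *)
Lemma spec_bounded j l k s : (j <= J)%N -> s ^+ 2 = 1 -> forall c, 0 < c ->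
  s * l <= - (c + j.+1%:R * C) -> good A 0 j l k /\ c <= s * F A j l k.
Proof.
move=> jJ s2; have s1 : `|s| = 1.
  by apply/eqP; rewrite -sqrp_eq1// real_normK ?num_real// s2.
have sA i x : (i <= J)%N -> - C <= s * A i x.
  by move=> iJ; rewrite lerNl (le_trans (ler_norm _))// normrN normrM s1 mul1r bA.
elim: j jJ k => [|j IH] jJ k c c0 sl.
  by split=> //=; rewrite mulrBr; have := sA 0%N k jJ; lra.
have C0 : 0 <= C by rewrite (le_trans (normr_ge0 (A 0%N k)))// bA.
have IH' k' := IH (ltnW jJ) k' (c + C) (ltr_wpDr C0 c0).
have sl' : s * l <= - (c + C + j.+1%:R * C).
  by apply: le_trans sl _; rewrite lerN2 -addrA -[X in _ + (X + _) <= _]mul1r -mulrDl -natr1 addrC -[X in _ <= X]addrC -natr1; lra.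
have sF t := (IH' (set_coord j t k) sl').2.
have cC : 0 < c + C by rewrite ltr_wpDr.
have g : good A 0 j.+1 l k.
  apply/goodS => t t01; split; first by case: (IH' (set_coord j t k) sl').
  by apply: contraTneq (sF t) => ->; rewrite mulr0 -ltNge.
split=> //=; set M := mean j _ k.
have cf t t01 := F_fibre_continuousV (t := t) cA jJ g t01.
have Mpos : 0 < s * M by apply: (mean_inv_gt0 cA jJ g) => t t01; exact: (lt_le_trans cC (sF t)).
have Mle : s * M <= (c + C)^-1.
  rewrite -RintegralZl//; last exact: (unit_interval_integrable cf).
  rewrite -[leRHS]Rintegral_unit_cst; apply: le_Rintegral => //.
  - apply: (@unit_interval_integrable R (fun t => s * (F A j l (set_coord j t k))^-1)) => t t01.
    by apply: cvgM; [exact: cvg_cst|exact: cf].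
  - by apply: (@unit_interval_integrable R (cst (c + C)^-1)) => t _; exact: cst_continuous.
  - move=> t _; have -> : s * (F A j l (set_coord j t k))^-1 = (s * F A j l (set_coord j t k))^-1.
      have s0 : s != 0 by rewrite -normr_eq0 s1 oner_eq0.
      by rewrite invfM; congr (_ * _); apply: (mulfI s0); rewrite mulfV// -expr2.
    have p := lt_le_trans cC (sF t).
    by rewrite lef_pV2//; exact: sF.
have -> : s * (A j.+1 k + M^-1) = s * A j.+1 k + (s * M)^-1.
  rewrite mulrDr invfM; congr (_ + _ * _).
  have s0 : s != 0 by rewrite -normr_eq0 s1 oner_eq0.
  by apply: (mulfI s0); rewrite mulfV// -expr2.
have : c + C <= (s * M)^-1 by rewrite -[leLHS]invrK lef_pV2// posrE invr_gt0.
by have := sA j.+1 k jJ; lra.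
Qed.

(** Lower hemicontinuity: a zero of the current level persists by [near_zero], and a point due to an
    earlier level sits over one [set_coord j t k], where the induction applies. *)
Lemma spec_lower j l k (e : R) : (j <= J)%N -> spec j k l -> 0 < e ->
  \forall k' \near k, exists m, `|m - l| < e /\ spec j k' m.
Proof.
elim: j k => [|j IH] k jJ sl e0.
- have F0 : F A 0 l k = 0 by apply: contrapT => /eqP F0; apply: sl.
  have := near_zero cA jJ (I : good A 0 0 l k) F0 e0.
  by apply: filterS => k' [m [ml gm Fm]]; exists m; split=> // -[_]; rewrite Fm eqxx.
- have [g|ng] := pselect (good A 0 j.+1 l k).
    have F0 : F A j.+1 l k = 0 by apply: contrapT => /eqP F0; apply: sl.
    have := near_zero cA jJ g F0 e0.
    by apply: filterS => k' [m [ml gm Fm]]; exists m; split=> // -[_]; rewrite Fm eqxx.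
  move: ng => /goodS/existsNP[t /not_implyP[t01 h]].
  have n := IH _ (ltnW jJ) h e0.
  have c : continuous (fun k : 'rV[R]_N => set_coord j t k).
    move=> x; apply: continuous_rV => i; rewrite /set_coord.
    have [ij|ij] := eqVneq (val i) j.
      rewrite (_ : (fun _ => _) = cst t); first exact: cst_continuous.
      by apply/funext => q; rewrite mxE ij eqxx.
    rewrite (_ : (fun _ => _) = (fun q : 'rV[R]_N => q ord0 i)); first exact: continuous_coord.
    by apply/funext => q; rewrite mxE (negbTE ij).
  have n' : \forall k' \near k, exists m, `|m - l| < e /\ spec j (set_coord j t k') m := c k _ n.
  apply: filterS n' => k' [m [ml sm]]; exists m; split=> // -[/goodS g _].
  exact/sm/g.
Qed.

Lemma nspec_near j l k : (j <= J)%N -> ~ spec j k l ->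
  \forall x \near ((l, k) : R * 'rV[R]_N), ~ spec j x.2 x.1.
Proof.
move=> jJ /contrapT[g F0]; have ng := near_good cA jJ g.
have cF := F_continuous cA jJ g.
have nF : \forall x \near ((l, k) : R * 'rV[R]_N), F A j x.1 x.2 != 0 by exact: (cvgr_neq0 _ cF F0).
by apply: filterS2 ng nF => x gx Fx; apply.
Qed.

Lemma unit_connected (U V : R -> Prop) :
  (forall t, 0 <= t <= 1 -> U t \/ V t) -> (forall t, 0 <= t <= 1 -> U t -> V t -> False) ->
  (forall t, 0 <= t <= 1 -> U t -> \forall s \near t, U s) ->
  (forall t, 0 <= t <= 1 -> V t -> \forall s \near t, V s) -> U 0 -> U 1.
Proof.
move=> UV nUV oU oV U0.
have := @segment_connected R 0 1 [set t | (0 <= t <= 1) /\ U t].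
have -> : [set t | 0 <= t <= 1 /\ U t] = `[0, 1]%classic `&` U°.
  apply/seteqP; split=> t /=; rewrite in_itv/= => -[t01 Ut]; split=> //; first exact: oU.
  exact: interior_subset Ut.
move=> h; have : `[0, 1]%classic `&` U° = `[0, 1]%classic.
  apply: h.
  - by exists 0 => /=; rewrite in_itv/= lexx ler01; split=> //; apply: oU => //; rewrite lexx ler01.
  - by exists U° => //; exact: open_interior.
  - exists (~` V°); first by apply: open_closedC; exact: open_interior.
    apply/seteqP; split=> t /=; rewrite in_itv/= => -[t01 h']; split=> //.
      by move=> /interior_subset Vt; exact: nUV (interior_subset h') Vt.
    have [Ut|Vt] := UV _ t01; first exact: oU.
    by case: h'; exact: oV.
move=> /seteqP[_ /(_ 1)]/=; rewrite in_itv/= lexx ler01 => /(_ isT)[_].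
exact: interior_subset.
Qed.

Definition seg (k k' : 'rV[R]_N) (t : R) : 'rV[R]_N := k + t *: (k' - k).

Lemma continuous_seg k k' : continuous (seg k k').
Proof.
move=> t; apply: continuous_rV => i; rewrite /seg.
rewrite (_ : (fun _ => _) = (fun t => k ord0 i + t * (k' ord0 i - k ord0 i))); last first.
  by apply/funext => s; rewrite !mxE.
by apply: cvgD; [exact: cvg_cst|apply: cvgM; [exact: cvg_id|exact: cvg_cst]].
Qed.

Definition convexD (D : set 'rV[R]_N) : Prop :=
  forall k k' t, D k -> D k' -> 0 <= t <= 1 -> D (seg k k' t).

Lemma spec_meets (D : set 'rV[R]_N) j a b l k k' : (j <= J)%N -> convexD D -> D k -> D k' ->
  (forall x, D x -> ~ spec j x a) -> (forall x, D x -> ~ spec j x b) ->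
  a < l -> l < b -> spec j k l -> exists2 m, a < m < b & spec j k' m.
Proof.
move=> jJ cD Dk Dk' na nb al lb sl.
pose U t := exists2 m, a < m < b & spec j (seg k k' t) m.
(* Stated on the closed interval: its compactness makes [V] open in [t], and since [a] and [b] are
   never spectral, [V] is still the complement of [U]. *)
pose V t := forall m, a <= m <= b -> ~ spec j (seg k k' t) m.
have Ds t : 0 <= t <= 1 -> D (seg k k' t) by exact: cD.
have s0 : seg k k' 0 = k by rewrite /seg scale0r addr0.
have s1 : seg k k' 1 = k' by rewrite /seg scale1r addrCA subrr addr0.
suff : U 1 by rewrite /U s1.
apply: (@unit_connected U V); last by exists l; rewrite ?s0 ?al.
- move=> t t01; have [Ut|nU] := pselect (U t); [by left|right => m /andP[am mb] sm].
  apply: nU; exists m => //; rewrite !lt_neqAle am mb !andbT; apply/andP; split; apply/eqP => e.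
    by apply: (na _ (Ds _ t01)); rewrite e.
  by apply: (nb _ (Ds _ t01)); rewrite -e.
- by move=> t t01 [m /andP[am mb] sm] Vt; apply: (Vt m) => //; rewrite !ltW.
- move=> t t01 [m /andP[am mb] sm].
  have e0 : 0 < Num.min (m - a) (b - m) by rewrite lt_min !subr_gt0 am.
  have h : \forall s \near t, exists m', `|m' - m| < Num.min (m - a) (b - m) /\
      spec j (seg k k' s) m' := @continuous_seg k k' t _ (spec_lower jJ sm e0).
  apply: filterS h => s [m' [mm' sm']]; exists m' => //.
  by move: mm'; rewrite lt_min ltr_norml ltr_distl => /andP[/andP[p _] /andP[_ q]]; lra.
- move=> t t01 Vt; have := (compact_near_coveringP _).1 (@segment_compact R a b).
  move=> /(_ R (nbhs t) (fun s m => ~ spec j (seg k k' s) m) _) h.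
  have : \forall s \near t, `[a, b]%classic `<=` (fun m => ~ spec j (seg k k' s) m).
    apply: h => m; rewrite /= in_itv/= => /Vt/(nspec_near jJ)[[P Q] /= [mP kQ] PQ].
    exists (P, [set s | Q (seg k k' s)]); first by split=> //=; exact: (@continuous_seg k k' t _ kQ).
    by move=> [m' s] /= [Pm' Qs]; exact: (PQ (m', seg k k' s)).
  by apply: filterS => s h' m mab; apply: h'; rewrite /= in_itv.
Qed.

(** Each chosen point of the chain lies between two gaps common to all fibres, where the fibre of
    [k] has spectrum as well by [spec_meets]. The same gaps then separate the new points; [K],
    beyond all the spectra, serves as the last gap. *)
Lemma alt_union (D : set 'rV[R]_N) j k a n x : (j <= J)%N -> convexD D -> D k ->
  (forall x, D x -> ~ spec j x a) -> a < x ->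
  alt (\bigcup_(k' in D) spec j k') n x -> exists2 x', a < x' & alt (spec j k) n x'.
Proof.
move=> jJ cD Dk; have C0 : 0 <= C by rewrite (le_trans (normr_ge0 (A 0%N 0)))// bA.
pose K := 1 + j.+1%:R * C.
have nK b : K <= b -> forall x, ~ spec j x b.
  move=> Kb y; apply; have := @spec_bounded j b y (-1) jJ _ 1 ltr01.
  rewrite sqrrN expr1n => /(_ erefl); rewrite mulN1r lerN2 => /(_ Kb)[g h]; split=> //.
  by apply: contraTneq h => ->; rewrite mulr0 -ltNge.
elim: n a x => [|n IH] a x na ax /=.
  move=> [k' Dk' sx]; have xK : x < K.
    by rewrite ltNge; apply/negP => Kx; exact: (nK x Kx k').
  have [m /andP[am _] sm] := spec_meets jJ cD Dk' Dk na (fun y _ => nK K (lexx K) y) ax xK sx.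
  by exists m.
move=> [[k' Dk' sx] [y [z [xy yz ny az]]]].
have ny' : forall x, D x -> ~ spec j x y by move=> w Dw sw; apply: ny; exists w.
have [m /andP[am my] sm] := spec_meets jJ cD Dk' Dk na ny' ax xy sx.
have [z' yz' az'] := IH y z ny' yz az.
by exists m => //; split=> //; exists y, z'; split=> //; exact: ny'.
Qed.

Lemma alt_union_bounded (D : set 'rV[R]_N) j k n x : (j <= J)%N -> convexD D -> D k ->
  alt (\bigcup_(k' in D) spec j k') n x -> exists x', alt (spec j k) n x'.
Proof.
move=> jJ cD Dk ax; have C0 : 0 <= C by rewrite (le_trans (normr_ge0 (A 0%N 0)))// bA.
pose a := - (1 + j.+1%:R * C).
have na b : b <= a -> forall x, ~ spec j x b.
  move=> ab y; apply; have := @spec_bounded j b y 1 jJ _ 1 ltr01.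
  rewrite expr1n => /(_ erefl); rewrite mul1r => /(_ ab)[g h]; split=> //.
  by apply: contraTneq h => ->; rewrite mulr0 -ltNge.
have [k' Dk' sx] := alt_head ax.
have xa : a < x by rewrite ltNge; apply/negP => xa; exact: (na x xa k').
by have [x' _ h] := alt_union jJ cD Dk (fun y _ => na a (lexx a) y) xa ax; exists x'.
Qed.

Lemma spec_alt j k x : (j <= J)%N -> ~ alt (spec j k) j.+1 x.
Proof.
elim: j k x => [|j IH] k x jJ ax.
  move: ax => [sx [y [z [xy yz _ sz]]]].
  have F0 l : spec 0 k l -> F A 0 l k = 0 by move=> sl; apply: contrapT => /eqP F0; apply: sl.
  by move: (F0 _ sx) (F0 _ sz) => /= Fx Fz; have := lt_trans xy yz; lra.
pose D := [set set_coord j t k | t in `[0, 1]%classic].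
have cD : convexD D.
  move=> _ _ t [u /= u01 <-] [v /= v01 <-] t01; move: u01 v01; rewrite !in_itv/= => u01 v01.
  exists (u + t * (v - u)) => /=; first by rewrite in_itv/=; apply/andP; split; nra.
  by apply/rowP => i; rewrite /seg !mxE; case: eqP => // _; ring.
have D0 : D (set_coord j 0 k) by exists 0 => //=; rewrite in_itv/= lexx ler01.
have sub : \bigcup_(k' in D) spec j k' `<=` spec j.+1 k.
  move=> l [_ [t /= t01 <-] sl] [/goodS g _]; apply/sl/g.
  by move: t01; rewrite in_itv.
have one : is_subset1 (spec j.+1 k `\` \bigcup_(k' in D) spec j k').
  have gz l : (spec j.+1 k `\` \bigcup_(k' in D) spec j k') l -> good A 0 j.+1 l k /\ F A j.+1 l k = 0.
    move=> [sl nl]; have g : good A 0 j.+1 l k.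
      apply/goodS => t t01; apply: contrapT => h; apply: nl.
      by exists (set_coord j t k) => //; exists t => //=; rewrite in_itv.
    by split=> //; apply: contrapT => /eqP F0; apply: sl.
  by move=> l m /gz[gl Fl] /gz[gm Fm]; exact: (F_zero_uniq cA jJ gl Fl gm Fm).
have [x' _ ax'] := alt_remove sub one ax.
have [x'' ax''] := alt_union_bounded (ltnW jJ) cD D0 ax'.
exact: (IH _ _ (ltnW jJ) ax'').
Qed.

End spectral_bands.

(** * Spectrum of the operator *)

Section operator_spectrum.
Context {R : realType} {N : nat}.
Implicit Types (A B : nat -> 'rV[R]_N -> R) (k : 'rV[R]_N).

Definition clamp01 : 'rV[R]_N -> 'rV[R]_N := clamp (fun=> 0) (fun=> 1).
Definition extend A : nat -> 'rV[R]_N -> R := clamped (fun=> 0) (fun=> 1) A.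

Lemma clamp01_cube k : cube N (clamp01 k).
Proof. exact: (clamp_inbox (a := fun=> 0) (b := fun=> 1) k (fun=> ler01)). Qed.

Lemma clamp01_id k : cube N k -> clamp01 k = k.
Proof. by move=> ck; apply: clamp_id. Qed.

Lemma clamp_tail (a b : 'I_N -> R) j k k' : (forall i : 'I_N, (j <= i)%N -> k ord0 i = k' ord0 i) ->
  forall i : 'I_N, (j <= i)%N -> clamp a b k ord0 i = clamp a b k' ord0 i.
Proof. by move=> kk' i ji; rewrite !mxE kk'. Qed.

Lemma gtail_clamped (a b : 'I_N -> R) A j : gtail j (A j) -> gtail j (clamped a b A j).
Proof. by move=> At k k' kk'; apply: At; exact: clamp_tail. Qed.

Lemma extend_cube A j k : cube N k -> extend A j k = A j k.
Proof. by move=> ck; rewrite /extend /clamped -/clamp01 clamp01_id. Qed.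

Lemma within_cube_clamp (T : topologicalType) (f : 'rV[R]_N -> T) :
  {within cube N, continuous f} -> continuous (f \o clamp01).
Proof.
move=> /subspace_continuousP cf k U /(cf _ (clamp01_cube k)) h.
have h' : \forall x \near clamp01 k, cube N x -> U (f x) := h.
have h2 : \forall x \near k, cube N (clamp01 x) -> U (f (clamp01 x)) :=
  @continuous_clamp R N (fun=> 0) (fun=> 1) k _ h'.
by apply: filterS h2 => x /= Ux; apply: Ux; exact: clamp01_cube.
Qed.

Section extended.
Variable A : nat -> 'rV[R]_N -> R.
Hypothesis cA : continuous_tails A.

Lemma extend_continuous j : (j <= N)%N -> continuous (extend A j).
Proof. by move=> jN; have [c _] := cA jN; exact: within_cube_clamp. Qed.

Lemma extend_gtail j : (j <= N)%N -> gtail j (extend A j).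
Proof.
move=> jN k k' kk'; have [_ t] := cA jN.
apply: t => [||i ji]; [exact: clamp01_cube|exact: clamp01_cube|exact: clamp_tail ji].
Qed.

Lemma extend_bounded : exists C, forall j k, (j <= N)%N -> `|extend A j k| <= C.
Proof.
suff [C hC] : exists C, forall j k, (j < N.+1)%N -> `|extend A j k| <= C by exists C.
have : (N.+1 <= N.+1)%N by [].
elim: {1 3}N.+1 => [|n IH] nN; first by exists 0.
have [C hC] := IH (ltnW nN).
have [D hD] := bounded_of_clamp (fun=> ler01) (extend_continuous nN)
  (fun k => congr1 (A n) (clampK k (fun=> ler01))).
exists (Num.max C D) => j k; rewrite ltnS leq_eqVlt => /predU1P[->|jn]; rewrite le_max.
  by rewrite hD orbT.
by rewrite hC.
Qed.

End extended.

Lemma cbounded_real (f : 'rV[R]_N -> R) (C : R) : continuous f -> (forall k, `|f k| <= C) ->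
  cbounded (fun k => (f k)%:C).
Proof.
move=> cf fC; split; first by split; [exact: continuous_measurable_rV|exact: measurable_cst].
by exists C => k; rewrite /= normr0 fC; split=> //; exact: le_trans (fC k).
Qed.

Lemma good_downward A y J l k : (forall i : 'I_N, (i < J)%N -> 0 <= k ord0 i <= 1) ->
  good A y J l k -> forall j, (j <= J)%N -> good A y j l k /\ ((j < J)%N -> Fc A j (l +i* y) k != 0).
Proof.
elim: J => [|J IH] k01 g j jJ.
  by move: jJ; rewrite leqn0 => /eqP ->.
have [g' F0] : good A y J l k /\ Fc A J (l +i* y) k != 0.
  by apply: good_pred g => i iJ; apply: k01; rewrite iJ.
move: jJ; rewrite leq_eqVlt => /predU1P[->|jJ]; first by split; rewrite ?ltnn.
have [h1 h2] := IH (fun i iJ => k01 i (ltnW iJ)) g' j jJ; split=> // _.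
by move: jJ; rewrite ltnS leq_eqVlt => /predU1P[->|].
Qed.

Lemma interval_around (x e : R) : 0 <= x <= 1 -> 0 < e -> exists a b : R,
  [/\ 0 <= a, a < b, b <= 1 & forall t, a <= t <= b -> `|x - t| < e].
Proof.
move=> /andP[x0 x1] e0; exists (Num.max 0 (x - e / 2)), (Num.min 1 (x + e / 2)); split.
- by rewrite le_max lexx.
- by rewrite gt_max !lt_min ltr01 /=; apply/andP; split; [|apply/andP; split]; lra.
- by rewrite ge_min lexx.
- by move=> t; rewrite ge_max le_min ltr_norml => /andP[/andP[_ p] /andP[_ q]]; lra.
Qed.

Section clamped_spectrum.
Variable A : nat -> 'rV[R]_N -> R.
Variable C : R.
Hypothesis cA : forall j, (j <= N)%N -> continuous (A j).
Hypothesis tA : forall j, (j <= N)%N -> gtail j (A j).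
Hypothesis bA : forall j k, (j <= N)%N -> `|A j k| <= C.
Hypothesis iA : forall j k, A j (clamp01 k) = A j k.

Let Abnd j : (j <= N)%N -> cbounded (fun k => (A j k)%:C).
Proof. by move=> jN; apply: (@cbounded_real _ C) (cA jN) _ => k; exact: bA. Qed.

Let clampedA : clamped (fun=> 0) (fun=> 1) A = A.
Proof. by apply/funext => j; apply/funext => k; exact: iA. Qed.

Let good_clamp01 y j l k : good A y j l (clamp01 k) -> good A y j l k.
Proof. by rewrite -{2}clampedA => g; apply/good_clamped. Qed.

Let Fc_clamp01 j z k : Fc A j z (clamp01 k) = Fc A j z k.
Proof. by rewrite -{2}clampedA Fc_clamped. Qed.

Lemma good_not_spectrum y l :
  (forall k, cube N k -> good A y N l k /\ Fc A N (l +i* y) k != 0) ->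
  ~ L2_spectrum (operator A) (l +i* y).
Proof.
move=> h.
have h' k : good A y N l (clamp01 k) /\ Fc A N (l +i* y) (clamp01 k) != 0 := h _ (clamp01_cube k).
have dn k := good_downward (fun i _ => clamp01_cube k i) (h' k).1.
have g j k : (j <= N)%N -> good A y j l k by move=> jN; exact/good_clamp01/(dn k j jN).1.
have F0 k : Fc A N (l +i* y) k != 0 by rewrite -Fc_clamp01; exact: (h' k).2.
have FF j k : (j < N)%N -> Fc A j (l +i* y) k != 0.
  by move=> jN; rewrite -Fc_clamp01; exact: (dn k j (ltnW jN)).2.
apply: not_spectrum => //.
  by apply: (invertible_good (a := fun=> 0) (b := fun=> 1)) => // i; exact: ler01.
by apply: (cbounded_Fc_inv (a := fun=> 0) (b := fun=> 1) (J := N)) => // i; exact: ler01.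
Qed.

Lemma nonreal_not_spectrum y l : y != 0 -> ~ L2_spectrum (operator A) (l +i* y).
Proof.
move=> y0; apply: good_not_spectrum => k _.
have g := @good_nonreal R N A y N (l, k) y0 cA; split=> //.
have [_ _ /(_ y0)] := Fx_continuous cA g.
by apply: contraTneq; rewrite /Fx /= => ->; rewrite mulr0 ltxx.
Qed.

(** At level [N] the fibre of any point is the whole cube, so [good] at a single point controls all
    the lower levels everywhere. *)
Lemma top_invertible l k0 : cube N k0 -> good A 0 N l k0 -> invertible_below A l%:C N.
Proof.
move=> ck0 g0.
have h' k : good A 0 N l (clamp01 k).
  by apply: good_gtail g0 => // i; rewrite leqNgt ltn_ord.
have dn k := good_downward (fun i _ => clamp01_cube k i) (h' k).
apply: (invertible_good (a := fun=> 0) (b := fun=> 1)) => //.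
- by move=> j k jN; exact/good_clamp01/(dn k j jN).1.
- by move=> j k jN; rewrite -[l +i* 0]/(l%:C) -Fc_clamp01; exact: (dn k j (ltnW jN)).2.
Qed.

Lemma top_eigenvalue l k0 : cube N k0 -> good A 0 N l k0 -> F A N l k0 = 0 ->
  L2_eigenvalue (operator A) l%:C.
Proof.
move=> ck0 g0 F0; apply: eigenvalue_test => //; first exact: top_invertible g0.
move=> k _; rewrite FcE (_ : F A N l k = 0)// -F0.
by apply: F_gtail => // i; rewrite leqNgt ltn_ord.
Qed.

Lemma top_spectrum l k0 : cube N k0 -> good A 0 N l k0 -> F A N l k0 = 0 ->
  L2_spectrum (operator A) l%:C.
Proof.
move=> ck0 g0 F0; have ok := top_invertible ck0 g0.
have bw := cbounded_test_fun ok; have Lw := L2_cbounded bw.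
have w0 : 0 < L2norm (test_fun A l%:C N).
  apply: lt_le_trans (L2_mean1 (leqnn N) Lw).2.
  rewrite (_ : mean1 N _ = fun=> 1); last by apply/funext => k; exact: mean_test_fun.
  rewrite L2normE sqint_cubem; last exact: (@cbounded_cst R N 1).1.
  rewrite (_ : (fun k => _) = cst 1%E); last first.
    by apply/funext => k; rewrite /sqnorm /= expr1n expr0n addr0.
  by rewrite cubem_cst// sqrtr1 ltr01.
apply: approx_spectrum => d d0; exists (test_fun A l%:C N).
have z0 : (fun k => operator A (test_fun A l%:C N) k - l%:C * test_fun A l%:C N k) = fun=> 0.
  apply/funext => k; rewrite -trunc_opE trunc_op_test// FcE.
  by rewrite (_ : F A N l k = 0)// -F0; apply: F_gtail => // i; rewrite leqNgt ltn_ord.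
rewrite z0; split=> //; first exact/L2_cbounded/cbounded_cst.
rewrite L2normE /sqint /= (eq_integral (fun=> 0%E)) ?integral0 ?sqrtr0.
  by rewrite mulr_ge0// ltW.
by move=> k _; rewrite /sqnorm /= expr0n addr0.
Qed.

Lemma lower_spectrum r l k0 : (r < N)%N -> cube N k0 -> good A 0 r l k0 -> F A r l k0 = 0 ->
  L2_spectrum (operator A) l%:C.
Proof.
move=> rN ck0 g0 F0; have rN' := ltnW rN.
have cA' i (ir : (i <= r)%N) : continuous (A i) := cA (leq_trans ir rN').
have tA' i (ir : (i <= r)%N) : gtail i (A i) := tA (leq_trans ir rN').
apply: approx_spectrum => d d0.
(* $F_r$ vanishes at [k0], so it is at most [d] in a neighbourhood; this will be the relative error
   of the approximate eigenfunction. *)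
have [e e0 eP] : exists2 e : R, 0 < e & forall k, (forall i, `|k0 ord0 i - k ord0 i| < e) ->
    good A 0 r l k /\ `|F A r l k| <= d.
  have n1 := near_good cA' (leqnn r) g0.
  have n2 : \forall x \near ((l, k0) : R * 'rV[R]_N), `|F A r x.1 x.2| <= d.
    have /cvgrPdist_le /(_ d d0) := F_continuous cA' (leqnn r) g0.
    by apply: filterS => x; rewrite /= F0 sub0r normrN.
  have [[U V] /= [lU kV] UV] := filterI n1 n2.
  have /nbhs_ballP[e /= e0 eV] := kV; exists e => // k kk.
  apply: (UV (l, k)); split=> /=; first exact: nbhs_singleton lU.
  by apply: eV; split=> // i j; rewrite ord1; exact: kk.
have /choice[ab abP] : forall i : 'I_N, exists p : R * R,
    [/\ 0 <= p.1, p.1 < p.2, p.2 <= 1 & forall t, p.1 <= t <= p.2 -> `|k0 ord0 i - t| < e].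
  by move=> i; have [a [b h]] := interval_around (ck0 i) e0; exists (a, b).
(* Full sides below [r], because the averages up to level [r] run over them; short sides from [r]
   on, where the point must stay near [k0]. *)
pose a (i : 'I_N) := if (i < r)%N then 0 else (ab i).1; pose b (i : 'I_N) := if (i < r)%N then 1 else (ab i).2.
have abN i : [/\ 0 <= a i, a i < b i & b i <= 1].
  by rewrite /a /b; case: ifP => _; [split|case: (abP i)].
have ab_le i : a i <= b i by case: (abN i) => _ /ltW.
have ab01 (i : 'I_N) : (i < r)%N -> a i = 0 /\ b i = 1 by rewrite /a /b => ->.
have boxP k : inbox a b k -> good A 0 r l k /\ `|F A r l k| <= d.
  (* Only coordinates from [r] on matter to [good] and $F_r$, so the others may be replaced by those
     of [k0] to come within [e]. *)
  move=> kb; pose k' : 'rV[R]_N := \row_i (if (i < r)%N then k0 ord0 i else k ord0 i).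
  have kk' (i : 'I_N) : (r <= i)%N -> k' ord0 i = k ord0 i by rewrite mxE ltnNge => ->.
  have kn i : `|k0 ord0 i - k' ord0 i| < e.
    rewrite mxE; case: ifPn => ir; first by rewrite subrr normr0.
    have [_ _ _] := abP i; apply; have := kb i; rewrite /a /b (negbTE ir); exact.
  have [g Fd] := eP k' kn; split; first exact: good_gtail g.
  by rewrite -(F_gtail _ _ kk').
(* [A2] only sees fibres over the box, where [l] avoids the zeros of $F_0, \dots, F_{r-1}$; over
   other fibres of [A] it may not. *)
pose A2 := clamped a b A.
have cA2 j : (j <= N)%N -> continuous (A2 j).
  move=> jN k; apply: (@continuous_comp _ _ _ (clamp a b) (A j)); first exact: continuous_clamp.
  exact: cA.
have bA2 j k : (j <= N)%N -> `|A2 j k| <= C by move=> jN; exact: bA.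
have dn k : forall j, (j <= r)%N -> good A 0 j l (clamp a b k) /\
    ((j < r)%N -> Fc A j (l +i* 0) (clamp a b k) != 0).
  have cb := clamp_inbox k ab_le.
  apply: good_downward; last by case: (boxP _ cb).
  by move=> i ir; have := cb i; have [-> ->] := ab01 i ir.
have ok : invertible_below A2 l%:C r.
  apply: (invertible_good (a := a) (b := b)) => //.
  - by move=> i ir; apply: cA2; exact: leq_trans rN'.
  - by move=> i k; rewrite /A2 /clamped clampK.
  - move=> j k jr; apply/good_clamped; last by case: (dn k j jr).
    by move=> i ij; apply: ab01; exact: leq_trans jr.
  - move=> j k jr; rewrite Fc_clamped; first exact: (dn k j (ltnW jr)).2.
    by move=> i ij; apply: ab01; exact: ltn_trans jr.
pose ro := Ordinal rN.
apply: (@spectrum_test R N A A2 l%:C r rN _ _ _ _ ok (step_fun a b ro) d) => //.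
- by move=> j jN; exact/gtail_clamped/tA.
- by move=> j jN; apply: (@cbounded_real _ C) (cA2 j jN) _ => k; exact: bA2.
- exact: (@step_fun_gtail R N a b ro).
- exact: step_fun_cbounded.
- by move=> k; apply: (@step_fun_mean R N a b ro).
- exact: step_fun_L2norm.
- exact: ltW.
- move=> k ck /step_fun_neq0 kb.
  have ib : inbox a b k.
    move=> i; have [ir|ri] := ltnP i r; last exact: kb.
    by have [-> ->] := ab01 i ir; exact: ck.
  have ckE := clamp_id ib; split; first by move=> i _; rewrite /A2 /clamped ckE.
  rewrite Fc_clamped// ckE FcE /sqnorm /= expr0n addr0.
  by rewrite -[leLHS]real_normK ?num_real// ler_sqr ?nnegrE ?(ltW d0)//; case: (boxP k ib).
Qed.

End clamped_spectrum.

Lemma operator_ext A B u : (forall j k, (j <= N)%N -> cube N k -> A j k = B j k) ->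
  forall k, cube N k -> operator A u k = operator B u k.
Proof.
move=> AB k ck; rewrite /operator AB//; congr (_ + _); rewrite !big_nat.
by apply: eq_bigr => j /andP[_ jN]; rewrite AB.
Qed.

Lemma spectrum_ext A B z : (forall j k, (j <= N)%N -> cube N k -> A j k = B j k) ->
  (forall j, (j <= N)%N -> cbounded (fun k => (B j k)%:C)) ->
  (L2_spectrum (operator A) z <-> L2_spectrum (operator B) z) /\
  (L2_eigenvalue (operator A) z <-> L2_eigenvalue (operator B) z).
Proof.
move=> AB Bb.
have E u k : cube N k -> operator A u k = operator B u k by move=> ck; exact: operator_ext.
have E' u : eqL2 (operator A u) (operator B u) by apply: eqL2_cube => k; exact: E.
split; last first.
  split=> -[u [Lu u0 Tu]]; exists u; split=> //; apply: eqL2_trans Tu => //.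
  exact: eqL2_sym.
have bB := bounded_operator_trunc_op z Bb (leqnn N).
have LB u : L2 u -> L2 (fun k => operator B u k - z * u k).
  move=> Lu; have [T1 _ _ _] := bB; have := T1 u Lu; congr L2.
  by apply/funext => k; rewrite trunc_opE.
have eAB u : eqL2 (fun k => operator A u k - z * u k) (fun k => operator B u k - z * u k).
  by apply: eqL2_cube => k ck; rewrite E.
have LA u : L2 u -> L2 (fun k => operator A u k - z * u k).
  move=> Lu; apply: L2_eq (eqL2_sym (eAB u)) (LB u Lu).
  by apply: cube_meas_eq (L2_meas (LB u Lu)) => k ck; rewrite E.
suff H (T T' : ('rV[R]_N -> R[i]) -> 'rV[R]_N -> R[i]) :
    (forall u, eqL2 (fun k => T u k - z * u k) (fun k => T' u k - z * u k)) ->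
    (forall u, L2 u -> L2 (fun k => T u k - z * u k)) ->
    (forall u, L2 u -> L2 (fun k => T' u k - z * u k)) -> L2_spectrum T z -> L2_spectrum T' z.
  by split; apply: H => // u; exact: eqL2_sym.
move=> TT LT LT' + [S [bS ST]]; apply; exists S; split=> // u Lu; have [s1 s2] := ST u Lu.
have [S1 S2 _ _] := bS; split.
  exact: eqL2_trans (S2 _ _ (LT u Lu) (LT' u Lu) (TT u)) s1.
exact: eqL2_trans (TT _) s2.
Qed.

End operator_spectrum.

(** * Branches, bands and spectrum of a given operator *)

Section direct_problem.
Context {R : realType} {N : nat}.
Variable A : nat -> 'rV[R]_N -> R.
Hypothesis cA : continuous_tails A.

Let A1 := extend A.
Let cA1 j (jN : (j <= N)%N) : continuous (A1 j) := extend_continuous cA jN.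
Let tA1 j (jN : (j <= N)%N) : gtail j (A1 j) := extend_gtail cA jN.
Let iA1 j k : A1 j (clamp01 k) = A1 j k.
Proof. by rewrite /A1 /extend /clamped -/clamp01 [clamp01 (clamp01 k)]clampK// => i; exact: ler01. Qed.

Lemma branchP j l k : (j <= N)%N -> cube N k ->
  branch A j k l <-> good A1 0 j l k /\ F A1 j l k = 0.
Proof.
move=> jN ck; rewrite (@branch_ext R N A A1)//; last by move=> i x _ cx; rewrite /A1 extend_cube.
by apply: (swept_branch _ jN _ ck).2 => i ij; apply: tA1; exact: leq_trans jN.
Qed.

Lemma sweptP j l k : (j <= N)%N -> cube N k -> swept (branch A) j k l <-> ~ good A1 0 j l k.
Proof.
move=> jN ck; have At i (ij : (i <= j)%N) : gtail i (A1 i) := tA1 (leq_trans ij jN).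
rewrite -(swept_branch l jN At ck).1.
suff -> : swept (branch A) j k = swept (branch A1) j k by [].
apply: eq_bigcupr => r /= rj; apply: eq_bigcupr => k' [ck' _].
by apply: branch_ext => // i x _ cx; rewrite /A1 extend_cube.
Qed.

Lemma branch_subset1 j k : (j <= N)%N -> cube N k -> is_subset1 (branch A j k).
Proof.
move=> jN ck l m /(branchP _ jN ck)[gl Fl] /(branchP _ jN ck)[gm Fm].
exact: (F_zero_uniq cA1 jN gl Fl gm Fm).
Qed.

Let spectrumE z : (L2_spectrum (operator A) z <-> L2_spectrum (operator A1) z) /\
  (L2_eigenvalue (operator A) z <-> L2_eigenvalue (operator A1) z).
Proof.
have [C bA] := extend_bounded cA.
apply: spectrum_ext => [j k _ ck|j jN]; first by rewrite /A1 extend_cube.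
by apply: (@cbounded_real _ _ _ C) (cA1 jN) _ => k; exact: bA.
Qed.

Lemma spectrum_bands :
  L2_spectrum (operator A) = (fun l : R => l%:C) @` (\bigcup_(r in `I_N.+1) band A r).
Proof.
have [C bA] := extend_bounded cA.
apply/seteqP; split=> [[l y] /(spectrumE _).1 sp|_ [l [r /= rN [k ck bl]] <-]].
  have y0 : y = 0.
    by apply: contrapT => /eqP y0; exact: (nonreal_not_spectrum cA1 tA1 bA iA1 y0 sp).
  rewrite y0 in sp *; exists l => //; apply: contrapT => nb.
  apply: (good_not_spectrum cA1 tA1 bA iA1 _ sp) => k ck.
  have g : good A1 0 N l k.
    apply: contrapT => /(sweptP _ (leqnn N) ck)[r /= rN [k' [ck' _] bl]].
    by apply: nb; exists r => /=; [exact: ltnW|exists k'].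
  split=> //; rewrite Fc_neq0; apply/eqP => F0.
  by apply: nb; exists N => //=; exists k => //; apply/branchP.
apply/(spectrumE _).1; rewrite ltnS in rN; have [g F0] := (branchP _ rN ck).1 bl.
move: rN; rewrite leq_eqVlt => /predU1P[rN|rN].
  by rewrite rN in g F0; exact: (top_spectrum cA1 tA1 iA1 ck g F0).
exact: (lower_spectrum cA1 tA1 bA rN ck g F0).
Qed.

Lemma cube_seg k k' t : cube N k -> cube N k' -> 0 <= t <= 1 -> cube N (@seg R N k k' t).
Proof.
move=> ck ck' /andP[t0 t1] i; rewrite /seg !mxE.
by have /andP[p q] := ck i; have /andP[p' q'] := ck' i; apply/andP; split; nra.
Qed.

Lemma bands_intervals m : (m <= N)%N -> exists I : nat -> set R,
  (forall r, (r < m)%N -> is_interval (I r)) /\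
  \bigcup_(r in `I_m) band A r = \bigcup_(r in `I_m) I r.
Proof.
case: m => [|m] mN; first by exists (fun=> set0); split=> //; rewrite !II0 !bigcup_set0.
have mN' := ltnW mN; have [C bA] := extend_bounded cA.
have c0 : cube N (0 : 'rV[R]_N) by move=> i; rewrite mxE lexx ler01.
(* The first [m.+1] bands together are the union of the fibre spectra at level [m]; the single fibre
   of 0 then bounds the number of alternations. *)
have -> : \bigcup_(r in `I_m.+1) band A r = \bigcup_(k in cube N) spec A1 m k.
  apply/seteqP; split=> [l [r /= rm [k ck bl]]|l [k ck sl]].
    exists k => // -[g F0]; move: rm; rewrite ltnS leq_eqVlt => /predU1P[rm|rm].
      by rewrite rm in bl; have [_ e] := (branchP _ mN' ck).1 bl; rewrite e eqxx in F0.
    by apply: (sweptP l mN' ck).1 g; exists r => //; exists k.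
  have [g|ng] := pselect (good A1 0 m l k).
    exists m => //=; exists k => //; apply/branchP => //; split=> //.
    by apply: contrapT => /eqP F0; apply: sl.
  have [r /= rm [k' [ck' _] bl]] := (sweptP l mN' ck).2 ng.
  by exists r => /=; [exact: ltnW|exists k'].
apply: alt_intervals => x ax.
have bA1 i k (iN : (i <= N)%N) := bA i k iN.
have [x' ax'] := alt_union_bounded cA1 bA1 mN' cube_seg c0 ax.
exact: (spec_alt cA1 bA1 mN' ax').
Qed.

(** If a value [z] were skipped, then along a segment of the cube the unique zero would lie below
    [z] or above [z], each an open condition in the segment parameter; both occurring contradicts
    the connectedness of [0,1]. *)
Lemma band_interval j : (j <= N)%N -> (forall k, cube N k -> branch A j k !=set0) ->
  is_interval (band A j).
Proof.
move=> jN ne x y [k ck bx] [k' ck' by'] z /andP[xz zy]; apply: contrapT => nz.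
have nb w l : cube N w -> branch A j w l -> l != z.
  by move=> cw bl; apply/eqP => lz; apply: nz; exists w => //; rewrite -lz.
pose P t l := good A1 0 j l (seg k k' t) /\ F A1 j l (seg k k' t) = 0.
pose U t := exists2 l, l < z & P t l.
pose V t := exists2 l, z < l & P t l.
have cs t := @cube_seg k k' t ck ck'.
have s0 : seg k k' 0 = k by rewrite /seg scale0r addr0.
have s1 : seg k k' 1 = k' by rewrite /seg scale1r addrCA subrr addr0.
have nUV t : U t -> V t -> False.
  move=> [l lz [gl Fl]] [m zm [gm Fm]]; have := lt_trans lz zm.
  by rewrite (F_zero_uniq cA1 jN gl Fl gm Fm) ltxx.
have near_P t l (e : R) : P t l -> 0 < e -> \forall s \near t, exists m, `|m - l| < e /\ P s m.
  move=> [g F0] e0.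
  have h : \forall s \near t, exists m, [/\ `|m - l| < e, good A1 0 j m (seg k k' s) &
    F A1 j m (seg k k' s) = 0] := @continuous_seg _ _ k k' t _ (near_zero cA1 jN g F0 e0).
  by apply: filterS h => s [m [ml gm Fm]]; exists m.
have U1 : U 1.
  apply: (@unit_connected R U V).
  - move=> t t01; have [l bl] := ne _ (cs t t01); have lz := nb _ _ (cs t t01) bl.
    have Pl := (branchP l jN (cs t t01)).1 bl.
    by have [ltz|ltz|e] := ltgtP l z; [left; exists l|right; exists l|rewrite e eqxx in lz].
  - by move=> t _; exact: nUV.
  - move=> t _ [l lz Pl]; have := near_P t l (z - l) Pl; rewrite subr_gt0 => /(_ lz).
    by apply: filterS => s [m [ml Pm]]; exists m => //; move: ml; rewrite ltr_norml; lra.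
  - move=> t _ [l lz Pl]; have := near_P t l (l - z) Pl; rewrite subr_gt0 => /(_ lz).
    by apply: filterS => s [m [ml Pm]]; exists m => //; move: ml; rewrite ltr_norml; lra.
  - exists x; first by rewrite lt_neqAle xz andbT (nb k).
    by rewrite /P s0; exact/branchP.
apply: (nUV 1 U1); exists y; first by rewrite lt_neqAle zy andbT eq_sym (nb k').
by rewrite /P s1; exact/branchP.
Qed.

Lemma band_top_subset1 : is_subset1 (band A N).
Proof.
move=> l m [k ck /(branchP _ (leqnn N) ck)[gl Fl]] [k' ck' bm].
have kk' (i : 'I_N) : (N <= i)%N -> k ord0 i = k' ord0 i by rewrite leqNgt ltn_ord.
have [gm Fm] := (branchP _ (leqnn N) ck').1 bm.
apply: (F_zero_uniq cA1 (leqnn N) _ _ gm Fm); first exact: good_gtail kk' gl.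
by rewrite -(F_gtail _ _ kk').
Qed.

Lemma band_top_eigenvalue l : band A N l -> L2_eigenvalue (operator A) l%:C.
Proof.
have [C bA] := extend_bounded cA.
move=> [k ck /(branchP _ (leqnn N) ck)[g F0]]; apply/(spectrumE _).2.
exact: (top_eigenvalue cA1 tA1 bA iA1 ck g F0).
Qed.

End direct_problem.

(** * Reconstruction from the branches *)

Section inverse_problem.
Context {R : realType} {N : nat}.

(** Valid for arbitrary components, so that it applies to the reconstruction at a stage where the
    component of index [j] is not yet known to depend on the tail only. *)
Lemma not_good (A : nat -> 'rV[R]_N -> R) j l k : (j <= N)%N -> cube N k -> ~ good A 0 j l k ->
  exists r k', [/\ (r < j)%N, fiber j k k', good A 0 r l k' & F A r l k' = 0].
Proof.
elim: j k => [|j IH] k jN ck; first by case.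
move=> /goodS /existsNP[t /not_implyP[t01 h]].
have ck' := set_coord_cube j t01 ck; set k' := set_coord j t k in h ck'.
have kk' (i : 'I_N) : (j.+1 <= i)%N -> k' ord0 i = k ord0 i.
  by move=> ji; rewrite mxE; case: eqP => // ij; rewrite ij ltnn in ji.
have [g|ng] := pselect (good A 0 j l k').
  exists j, k'; split=> //; apply/eqP; rewrite -[_ == _]negbK; apply/negP => F0; exact: h.
have [r [k'' [rj [ck'' kk''] g F0]]] := IH _ (ltnW jN) ck' ng.
exists r, k''; split=> //; first exact: ltnW.
by split=> // i ji; rewrite kk'' ?kk'// ltnW.
Qed.

Variable lam : nat -> 'rV[R]_N -> R.

(** The next component evaluates the previous continued fraction at a parameter that varies with the
    point, so the recursion carries $F_j$, as a function of the parameter, along with $A_j$. *)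
Fixpoint inverse_pair j : ('rV[R]_N -> R) * (R -> 'rV[R]_N -> R) :=
  if j is j'.+1 then
    let Q l k := mean j' (fun k' => ((inverse_pair j').2 l k')^-1) k in
    let B k := - (Q (lam j (clamp01 k)) (clamp01 k))^-1 in
    (B, fun l k => B k + (Q l k)^-1)
  else (fun k => lam 0%N (clamp01 k), fun l k => lam 0%N (clamp01 k) - l).

Definition inverse j : 'rV[R]_N -> R := (inverse_pair j).1.

Lemma F_inverse j l k : F inverse j l k = (inverse_pair j).2 l k.
Proof.
elim: j k => [//|j IH] k /=; rewrite /inverse/=; congr (_ + (mean j _ _)^-1).
by apply/funext => k'; rewrite IH.
Qed.

Lemma inverseS j k : inverse j.+1 k =
  - (mean j (fun k' => (F inverse j (lam j.+1 (clamp01 k)) k')^-1) (clamp01 k))^-1.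
Proof.
rewrite {1}/inverse/=; congr (- (mean j _ _)^-1).
by apply/funext => k'; rewrite F_inverse.
Qed.

Lemma Qx_real (A : nat -> 'rV[R]_N -> R) j x :
  Qx A 0 j x = (mean j (fun k => (F A j x.1 k)^-1) x.2)%:C.
Proof.
have E : (fun k => (Fc A j (x.1 +i* 0) k)^-1) = (fun k => ((F A j x.1 k)^-1)%:C).
  by apply/funext => k; rewrite -[_ +i* 0]/(x.1%:C) FcE fmorphV.
rewrite /Qx E /Cmean; apply: complexP => //=.
by rewrite /mean /Rintegral/= integral0.
Qed.

Hypothesis clam : continuous_tails lam.
Hypothesis lam_free : forall j k, (1 <= j <= N)%N -> cube N k ->
  ~ swept (fun r k' => [set lam r k']) j k (lam j k).

Let ok j := [/\ continuous (inverse j), gtail j (inverse j) &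
  forall k, cube N k -> good inverse 0 j (lam j k) k /\ F inverse j (lam j k) k = 0].

Lemma inverse_ok j : (j <= N)%N -> ok j.
Proof.
elim/ltn_ind: j => -[_ _|j IH jN].
  split; first by have [c _] := clam (leq0n N); exact: within_cube_clamp.
    exact: (extend_gtail clam (leq0n N)).
  by move=> k ck; split=> //=; rewrite /inverse/= clamp01_id// subrr.
have cA i (ij : (i <= j)%N) : continuous (inverse i).
  by have [] := IH i ij (leq_trans ij (ltnW jN)).
have tA i (ij : (i <= j)%N) : gtail i (inverse i).
  by have [] := IH i ij (leq_trans ij (ltnW jN)).
(* Otherwise $\lambda_{j+1}$ would be a zero of some earlier $F_r$ over the fibre; zeros being
   unique, it would equal $\lambda_r$ there, which [lam_free] forbids. *)
have g k : cube N k -> good inverse 0 j.+1 (lam j.+1 k) k.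
  move=> ck; apply: contrapT => /(not_good jN ck)[r [k' [rj fk gr Fr]]].
  apply: (@lam_free j.+1 k) => //; exists r => //; exists k' => //=.
  have [_ _ /(_ k' fk.1)[gr' Fr']] := IH r rj (leq_trans (ltnW rj) jN).
  by apply: (F_zero_uniq (J := j) cA _ gr Fr gr' Fr').
split.
(* The parameter moves with the point, which is where joint continuity of the mean in both is
   needed. *)
- move=> k; pose h (k : 'rV[R]_N) := (lam j.+1 (clamp01 k), clamp01 k).
  have ch : {for k, continuous h}.
    have c1 := extend_continuous clam jN; have c2 := @continuous_clamp R N (fun=> 0) (fun=> 1).
    exact: (cvg_pair (c1 k) (c2 k)).
  have [Q0 Qc] := Qx_good (x := h k) cA (g _ (clamp01_cube k)).
  have [c _] := ccontinuous_comp ch (ccontinuousV Q0 Qc).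
  rewrite (_ : inverse j.+1 = (fun k => - complex.Re (Qx inverse 0 j (h k))^-1)).
    exact: cvgN c.
  by apply/funext => x; rewrite inverseS Qx_real -fmorphV.
- move=> k k' kk'; rewrite !inverseS.
  have -> : lam j.+1 (clamp01 k) = lam j.+1 (clamp01 k') := extend_gtail clam jN kk'.
  congr (- _^-1); apply: mean_gtail.
    by move=> x x' xx'; congr (_^-1); exact: F_gtail.
  exact: clamp_tail.
- move=> k ck; split; first exact: g.
  by rewrite /= inverseS clamp01_id// addNr.
Qed.

Let cI j (jN : (j <= N)%N) : continuous (inverse j). Proof. by case: (inverse_ok jN). Qed.
Let tI j (jN : (j <= N)%N) : gtail j (inverse j). Proof. by case: (inverse_ok jN). Qed.

Lemma inverse_continuous_tails : continuous_tails inverse.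
Proof.
move=> j jN; split; first exact/continuous_subspaceT/cI.
by move=> k k' _ _; exact: tI.
Qed.

Lemma inverse_branches : has_branches inverse lam.
Proof.
move=> j k jN ck; have [_ _ /(_ k ck)[gl Fl]] := inverse_ok jN.
have br l := (@swept_branch R N inverse j l k jN (fun i ij => tI (leq_trans ij jN)) ck).2.
apply/seteqP; split=> l; last by move=> ->; apply/br.
by move=> /br[g F0]; exact: (F_zero_uniq cI jN g F0 gl Fl).
Qed.

Lemma inverse_formula :
  (forall k, cube N k -> inverse 0%N k = lam 0%N k) /\
  (forall j k, (j < N)%N -> cube N k ->
    inverse j.+1 k = - (mean j (fun k' => (F inverse j (lam j.+1 k) k')^-1) k)^-1).
Proof.
split=> [k ck|j k _ ck]; last by rewrite inverseS clamp01_id.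
by rewrite /inverse/= clamp01_id.
Qed.

(** The equation $F_{j+1} = 0$ at $\lambda_{j+1}$ can be solved for $A_{j+1}$; what remains involves
    only earlier components, which agree by induction. *)
Lemma inverse_unique (B : nat -> 'rV[R]_N -> R) : has_branches B lam ->
  forall j k, (j <= N)%N -> cube N k -> B j k = inverse j k.
Proof.
move=> Bl; elim/ltn_ind => -[|j] IH k jN ck.
  have : branch B 0 k (lam 0%N k) by rewrite Bl.
  by rewrite branch0 /= => <-; rewrite inverse_formula.1.
have : branch B j.+1 k (lam j.+1 k) by rewrite Bl.
rewrite branchS => -[/= F0 _]; rewrite inverse_formula.2//.
rewrite -[LHS]subr0 -F0 opprD addNKr; congr (- _^-1).
apply: eq_Rintegral => t; rewrite inE/= in_itv/= => t01; congr (_^-1).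
apply: F_ext; last exact: set_coord_cube.
by move=> i x ij cx; apply: IH => //; exact: leq_trans (ltnW jN).
Qed.

End inverse_problem.

Theorem theorem1p4 (R : realType) (N : nat) (hN : (1 <= N)%N) :
  (forall A : nat -> 'rV[R]_N -> R, continuous_tails A ->
    [/\ forall j k, (j <= N)%N -> cube N k -> is_subset1 (branch A j k),
        L2_spectrum (operator A) =
          (fun l : R => l%:C) @` (\bigcup_(r in `I_N.+1) band A r),
        (forall m, (m <= N)%N -> exists I : nat -> set R,
          (forall r, (r < m)%N -> is_interval (I r)) /\
          \bigcup_(r in `I_m) band A r = \bigcup_(r in `I_m) I r) /\
        (forall j, (j < N)%N -> (forall k, cube N k -> branch A j k !=set0) ->
          is_interval (band A j)) &
        is_subset1 (band A N) /\
        (forall l, band A N l -> L2_eigenvalue (operator A) l%:C)]) /\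
  (forall lam : nat -> 'rV[R]_N -> R, continuous_tails lam ->
    (forall j k, (1 <= j <= N)%N -> cube N k ->
      ~ swept (fun r k' => [set lam r k']) j k (lam j k)) ->
    exists A : nat -> 'rV[R]_N -> R,
      [/\ continuous_tails A /\ has_branches A lam,
          forall B : nat -> 'rV[R]_N -> R, continuous_tails B -> has_branches B lam ->
            (forall j k, (j <= N)%N -> cube N k -> B j k = A j k) /\
            (forall u, L2 u -> eqL2 (operator B u) (operator A u)),
          (forall k, cube N k -> A 0%N k = lam 0%N k) /\
          (forall j k, (j < N)%N -> cube N k ->
            A j.+1 k = - (mean j (fun k' => (F A j (lam j.+1 k) k')^-1) k)^-1) &
          L2_spectrum (operator A) =
            (fun l : R => l%:C) @` (\bigcup_(r in `I_N.+1) lam r @` cube N)]).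
Proof.
split=> [A cA|lam clam lam_free].
  split.
  - by move=> j k; exact: branch_subset1.
  - exact: spectrum_bands.
  - split=> [m|j jN]; first exact: bands_intervals.
    exact: (band_interval cA (ltnW jN)).
  - by split; [exact: band_top_subset1|exact: band_top_eigenvalue].
have cI := inverse_continuous_tails clam lam_free.
have bI := inverse_branches clam lam_free.
exists (inverse lam); split.
- by split.
- move=> B _ bB; have BI := inverse_unique bB; split=> // u _.
  by apply: eqL2_cube; exact: operator_ext.
- exact: inverse_formula.
- rewrite spectrum_bands//; congr (_ @` _).
  apply: eq_bigcupr => r /= rN; apply/seteqP; split=> [l [k ck]|_ [k ck <-]].
    by rewrite bI// => ->; exists k.
  by exists k => //; rewrite bI.
Qed.
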